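(* Let $m\ge 1$ and let $f$ be a non-constant entire function in $\mathbb{C}^m$ whose hyper-order satisfies $\rho_1(f)\notin\mathbb{N}\cup\{\infty\}$. Suppose there is an entire function $\alpha$ in $\mathbb{C}^m$ such that $$\frac{\partial f}{\partial z_i}(z)=e^{\alpha(z)}f(z)\qquad (z\in\mathbb{C}^m)$$ for all $i\in\{1,\ldots,m\}$. Then $\alpha$ is a constant, say $\alpha(z)\equiv c$, and $$f(z_1,\ldots,z_m)=c_1e^{A(z_1+\cdots+z_m)},$$ where $A=e^c$ and $c_1$ are non-zero constants.
   Context: $\mathbb{N}=\{1,2,3,\ldots\}$. On $\mathbb{C}^m$ let $\tau_m(z)=\|z\|^2$ (Euclidean norm), $d=\partial+\bar\partial$, $d^c=\frac{\iota}{4\pi}(\bar\partial-\partial)$ with $\iota=\sqrt{-1}$, and on $\mathbb{C}^m\setminus\{0\}$ let $\omega_m=dd^c\log\tau_m$ and $\sigma_m=d^c\log\tau_m\wedge\omega_m^{m-1}$. For $r>0$ let $\mathbb{C}^m\langle r\rangle=\{z\in\mathbb{C}^m:\|z\|=r\}$. For an entire function $f$ in $\mathbb{C}^m$ the Nevanlinna characteristic function is $T(r,f)=m(r,f)=\int_{\mathbb{C}^m\langle r\rangle}\log^+|f|\,\sigma_m$ (the term $N(r,f)$ counting poles vanishes for entire $f$). The hyper-order of $f$ is $$\rho_1(f)=\limsup_{r\to\infty}\frac{\log\log T(r,f)}{\log r}.$$ *)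

(* Defs.v *)
From HB Require Import structures.
From mathcomp Require Import all_boot all_order all_fingroup all_algebra.
From mathcomp Require Import complex.
From mathcomp Require Import all_classical all_reals all_analysis.

Set Implicit Arguments.
Unset Strict Implicit.
Unset Printing Implicit Defensive.

Import Order.TTheory GRing.Theory Num.Theory.
Import numFieldNormedType.Exports.

Local Open Scope classical_set_scope.
Local Open Scope ring_scope.
Local Open Scope complex_scope.

(* The library only gives the regular module R[i]^o its normed topology. *)
HB.instance Definition _ (R : rcfType) := NormedModule.copy R[i] R[i]^o.

Section ComplexFunctions.
Context {R : realType}.
Local Notation C := R[i].

Definition cexp (z : C) : C :=
  (expR (complex.Re z))%:C * (cos (complex.Im z) +i* sin (complex.Im z)).

Definition cmod (z : C) : R := complex.Re `|z|.

Definition log_plus (x : R) : R := Num.max (ln x) 0.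

(* [differentiable] is taken over the scalar field C, so this is holomorphy
   on all of C^m. *)
Definition entire (m : nat) (f : 'rV[C]_m -> C) : Prop :=
  forall z, differentiable f z.

Definition partial (m : nat) (i : 'I_m) (f : 'rV[C]_m -> C) (z : 'rV[C]_m) : C :=
  'D_(delta_mx 0 i) f z.

Definition real_deriv (g : R -> C) (x : R) : C :=
  derive1 (fun t => complex.Re (g t)) x +i* derive1 (fun t => complex.Im (g t)) x.

End ComplexFunctions.

(* A (complex-valued) k-form on an open subset of C^m, viewed as a real
   manifold, is a function of a point and of k tangent vectors; tangent vectors
   are elements of C^m. *)
Section Forms.
Context {R : realType} {m : nat}.
Local Notation C := R[i].
Local Notation V := 'rV[C]_m.
Implicit Types (u : V -> C) (z v w : V).

Definition dir_deriv u z v : C := real_deriv (fun t => u (z + t%:C *: v)) 0.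

(* d/dz_j = (d/dx_j - i d/dy_j) / 2 and d/dzbar_j = (d/dx_j + i d/dy_j) / 2. *)
Definition wirt (j : 'I_m) u z : C :=
  2^-1 * (dir_deriv u z (delta_mx 0 j) - 'i%C * dir_deriv u z ('i%C *: delta_mx 0 j)).
Definition wirt_bar (j : 'I_m) u z : C :=
  2^-1 * (dir_deriv u z (delta_mx 0 j) + 'i%C * dir_deriv u z ('i%C *: delta_mx 0 j)).

Definition del u z v : C := \sum_(j < m) wirt j u z * v 0 j.
Definition delbar u z v : C := \sum_(j < m) wirt_bar j u z * conjc (v 0 j).

Definition dc u z v : C := 'i%C / (4 * pi)%:C * (delbar u z v - del u z v).

(* The exterior derivative of a 1-form, evaluated on constant vector fields
   (whose Lie bracket vanishes). *)
Definition ext_deriv (eta : V -> V -> C) z v w : C :=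
  dir_deriv (eta ^~ w) z v - dir_deriv (eta ^~ v) z w.

Definition tau z : R := \sum_(j < m) cmod (z 0 j) ^+ 2.

Definition log_tau z : C := (ln (tau z))%:C.

Definition omega z v w : C := ext_deriv (dc log_tau) z v w.

(* The wedge product of one 1-form and m - 1 2-forms:
   (a /\ b_1 /\ .. /\ b_n)(x_0, .., x_2n) is the sum over the permutations s of
   sgn s * a(x_(s 0)) * prod_j b_j(x_(s (2j-1)), x_(s (2j))), divided by
   1! * 2!^n. *)
Definition sigma z (x : 'I_(m.-1.*2.+1) -> V) : C :=
  (2 ^+ m.-1)^-1 *
  \sum_(s : 'S_(m.-1.*2.+1))
    (-1) ^+ s * dc log_tau z (x (s ord0)) *
    \prod_(j < m.-1) omega z (x (s (inord j.*2.+1))) (x (s (inord j.*2.+2))).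

End Forms.

(* The sphere |z| = r of C^m is parametrized by 2m - 1 real coordinates u_k,
   k <= 2m - 2: the even ones u_(2j) in [0, 2 pi] are the arguments of the z_j,
   0 <= j < m, the odd ones u_(2j-1) in ]0, 1[ are the numbers |z_j|^2 / r^2,
   1 <= j < m, and |z_0|^2 / r^2 is 1 minus their sum, which must be
   positive.  Up to null sets each point of the sphere is reached once, and the
   order of the coordinates gives the orientation of the sphere as the boundary
   of the ball. *)
Section Sphere.
Context {R : realType}.
Local Notation C := R[i].

Definition upd (u : nat -> R) (k : nat) (x : R) : nat -> R :=
  fun l => if l == k then x else u l.

Definition sphere_sq (m : nat) (u : nat -> R) (j : nat) : R :=
  if j == 0%N then 1 - \sum_(1 <= l < m) u l.*2.-1 else u j.*2.-1.

Definition sphere_pt (m : nat) (r : R) (u : nat -> R) : 'rV[C]_m :=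
  \row_(j < m) ((r * Num.sqrt (sphere_sq m u j))%:C *
                (cos (u j.*2) +i* sin (u j.*2))).

Definition sphere_tangent (m : nat) (r : R) (u : nat -> R) (k : nat) : 'rV[C]_m :=
  \row_(j < m) real_deriv (fun x => sphere_pt m r (upd u k x) 0 j) (u k).

Definition coord_range (k : nat) : set R :=
  if odd k then `]0, 1[%classic else `[0, 2 * pi]%classic.

Fixpoint iter_integral (k : nat) (F : (nat -> R) -> \bar R) (u : nat -> R) : \bar R :=
  if k is l.+1 then
    (\int[@lebesgue_measure R]_(x in coord_range l) iter_integral l F (upd u l x))%E
  else F u.

(* The integral of g sigma_m over the sphere of radius r.  The form sigma_m is
   real, so taking the real part of its coefficient loses nothing. *)
Definition sphere_integral (m : nat) (r : R) (g : 'rV[C]_m -> R) : \bar R :=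
  iter_integral m.-1.*2.+1
    (fun u =>
       if 0 < sphere_sq m u 0 then
         (g (sphere_pt m r u) *
          complex.Re (sigma (sphere_pt m r u)
            (fun k : 'I_(m.-1.*2.+1) => sphere_tangent m r u k)))%:E
       else 0%E)
    (fun=> 0).

End Sphere.

Section Nevanlinna.
Context {R : realType} {m : nat}.
Implicit Types (f : 'rV[R[i]]_m -> R[i]).

Definition nevanlinna_T (r : R) f : \bar R :=
  sphere_integral r (fun z => log_plus (cmod (f z))).

Definition hyper_order f : \bar R :=
  limf_esup (fun r : R => (lne (lne (nevanlinna_T r f)) * ((ln r)^-1)%:E)%E)
            (pinfty_nbhs R).

End Nevanlinna.

(* Main.v *)
Require Import Defs.
From mathcomp Require Import all_boot all_order all_fingroup all_algebra.
From mathcomp Require Import complex.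
From mathcomp Require Import all_classical all_reals all_analysis.
From mathcomp Require Import ring lra zify.

(** All the partial derivatives of [f] are equal, so [f] is constant along the
    directions whose entries have sum zero: [f z = g (z_1 + .. + z_m)] for an
    entire function [g] of one variable, with [g' = H * g] and [H = exp a], where
    [a] is the restriction of [alpha] to a coordinate axis.  A linear differential
    equation has a unique solution, so [g] has no zero, and [u = log |g|] is
    a harmonic function with gradient given by [H].

    The hyper-order being finite, [T(r,f) <= exp (r^s)] for large [r], for any
    [s] above it.  The characteristic function is the mean of [u^+] over a sphere.
    On the part of the sphere where all the coordinates but one are small, the
    integration over the argument of the large coordinate is a mean of [u^+] over a
    circle almost centred at the origin; Poisson's formula and a formula for
    the gradient of a harmonic function then give
    [|H z| <= C * (T(r,f) + 1) / r] for [r] comparable with [|z|]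
    ([off_centre_bound], [characteristic_ge]).  As [|H| = exp (Re a)], the real part
    of [a] is at most of the order of [|z|^s], and Liouville's theorem
    ([little_o_of_Re], [growth_drop]) shows that [a] is a polynomial of degree
    at most the integral part [d] of the hyper-order.

    Conversely, if [a] has degree at most [d], then [|u|] is at most of the order of
    [exp (C * r^d)], so that the hyper-order is at most [d]
    ([hyper_order_upper]).  If [d >= 1], the hyper-order would be the positive
    integer [d], which is excluded.  So [d = 0] and [a] is a constant [c]
    ([exponent_const]); the equation [g' = exp c * g] is solved by an exponential, and
    [alpha], a continuous logarithm of the constant [exp c], is constant.

    The function theory needed for this is developed from real integrals over
    [[0, 2 pi]] ([circ]).  The basic fact is the mean value property of a holomorphic
    function with continuous derivative ([circ_mean]), proved by differentiating
    under the integral sign with respect to the radius.  Cauchy's formula for the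
    derivative ([circ_cauchy]) makes the derivative holomorphic as well, and Poisson's
    formula ([poisson_formula]) follows by differentiating an integral along
    the segments that join a point of the disc to the points of the circle.

    The measure on the sphere requires a computation with forms.  On the
    coordinate vectors of the sphere, the two forms that enter [sigma_m]
    are given by simple matrices, and each term of the sum over permutations defining
    the wedge product is nonnegative ([pair_term_eq1]).  Hence the density of
    the measure is bounded, and bounded below by a positive multiple of the
    squared modulus of a coordinate ([density_ge], [density_le]). *)

Set Implicit Arguments.
Unset Strict Implicit.
Unset Printing Implicit Defensive.

Import Order.TTheory GRing.Theory Num.Theory.
Import numFieldNormedType.Exports.

Local Open Scope classical_set_scope.
Local Open Scope ring_scope.
Local Open Scope complex_scope.

(** * Moduli and components of complex numbers *)

Section ComplexBasics.
Context {R : realType}.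
Local Notation C := R[i].
Local Notation Re := (@complex.Re R).
Local Notation Im := (@complex.Im R).
Implicit Types x y z w : C.

Lemma cReD x y : Re (x + y) = Re x + Re y. Proof. by case: x y => a b [c d]. Qed.
Lemma cImD x y : Im (x + y) = Im x + Im y. Proof. by case: x y => a b [c d]. Qed.
Lemma cReN x : Re (- x) = - Re x. Proof. by case: x. Qed.
Lemma cImN x : Im (- x) = - Im x. Proof. by case: x. Qed.
Lemma cReB x y : Re (x - y) = Re x - Re y. Proof. by rewrite cReD cReN. Qed.
Lemma cImB x y : Im (x - y) = Im x - Im y. Proof. by rewrite cImD cImN. Qed.
Lemma cReM x y : Re (x * y) = Re x * Re y - Im x * Im y.
Proof. by case: x y => a b [c d]. Qed.
Lemma cImM x y : Im (x * y) = Re x * Im y + Im x * Re y.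
Proof. by case: x y => a b [c d]. Qed.
Lemma cReJ x : Re (conjc x) = Re x. Proof. by case: x. Qed.
Lemma cImJ x : Im (conjc x) = - Im x. Proof. by case: x. Qed.

Definition ReImE := (cReD, cImD, cReN, cImN, cReM, cImM, cReJ, cImJ).

Lemma cmodE z : cmod z = Num.sqrt (Re z ^+ 2 + Im z ^+ 2).
Proof. by rewrite /cmod normc_def. Qed.
Lemma cmod_norm z : `|z| = (cmod z)%:C.
Proof. by rewrite /cmod normc_def. Qed.
Lemma cmod_sq z : cmod z ^+ 2 = Re z ^+ 2 + Im z ^+ 2.
Proof. by rewrite cmodE sqr_sqrtr // addr_ge0 ?sqr_ge0. Qed.
Lemma cmod_ge0 z : 0 <= cmod z.
Proof. by rewrite cmodE sqrtr_ge0. Qed.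
Lemma cmodM x y : cmod (x * y) = cmod x * cmod y.
Proof. by apply: (@complexI R); rewrite -cmod_norm normrM !cmod_norm rmorphM. Qed.
Lemma cmod_real (a : R) : cmod a%:C = `|a|.
Proof. by rewrite cmodE /= expr0n addr0 sqrtr_sqr. Qed.
Lemma cmod0 : cmod (0 : C) = 0.
Proof. by have := cmod_real 0; rewrite normr0. Qed.
Lemma cmod1 : cmod (1 : C) = 1.
Proof. by have := cmod_real 1; rewrite normr1. Qed.
Lemma cmodN z : cmod (- z) = cmod z.
Proof. by rewrite /cmod normrN. Qed.
Lemma cmod_distC x y : cmod (x - y) = cmod (y - x).
Proof. by rewrite /cmod distrC. Qed.
Lemma cmodJ z : cmod (conjc z) = cmod z.
Proof. by rewrite !cmodE cReJ cImJ sqrrN. Qed.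
Lemma cmodD x y : cmod (x + y) <= cmod x + cmod y.
Proof. by rewrite -lecR rmorphD /= -!cmod_norm ler_normD. Qed.
Lemma cmodB x y : cmod (x - y) <= cmod x + cmod y.
Proof. by rewrite -(cmodN y) cmodD. Qed.
Lemma cmodB_ge x y : cmod x - cmod y <= cmod (x - y).
Proof. by rewrite lerBlDr -{1}(subrK y x) cmodD. Qed.
Lemma cmod_eq0 z : (cmod z == 0) = (z == 0).
Proof. by rewrite -(inj_eq (@complexI R)) -cmod_norm normr_eq0. Qed.
Lemma cmod_gt0 z : (0 < cmod z) = (z != 0).
Proof. by rewrite lt_neqAle cmod_ge0 andbT eq_sym cmod_eq0. Qed.

Lemma normRe_le z : `|Re z| <= cmod z.
Proof.
rewrite -(ler_pXn2r (ltn0Sn 1)) ?nnegrE ?normr_ge0 ?cmod_ge0//.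
by rewrite cmod_sq real_normK ?num_real// lerDl sqr_ge0.
Qed.
Lemma normIm_le z : `|Im z| <= cmod z.
Proof.
rewrite -(ler_pXn2r (ltn0Sn 1)) ?nnegrE ?normr_ge0 ?cmod_ge0//.
by rewrite cmod_sq real_normK ?num_real// lerDr sqr_ge0.
Qed.
Lemma Re_le z : Re z <= cmod z.
Proof. exact: le_trans (ler_norm _) (normRe_le z). Qed.
Lemma cmod_le_ReIm z : cmod z <= `|Re z| + `|Im z|.
Proof.
rewrite -(ler_pXn2r (ltn0Sn 1)) ?nnegrE ?cmod_ge0 ?addr_ge0//.
rewrite cmod_sq sqrrD !real_normK ?num_real// lerD2r lerDl.
by rewrite mulrn_wge0// mulr_ge0.
Qed.
Lemma mulJ z : z * conjc z = (cmod z ^+ 2)%:C.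
Proof. by case: z => a b; rewrite cmod_sq /=; apply/eqP; rewrite eq_complex /=; apply/andP; split; apply/eqP; ring. Qed.

(** Bounds on [cmod z] are obtained from bounds on the real parts of the numbers
    [e * z] with [e] unimodular; this gives the best [e]. *)
Lemma rotate_cmod z : exists2 e : C, cmod e = 1 & e * z = (cmod z)%:C.
Proof.
have [->|z0] := eqVneq z 0; first by exists 1; rewrite ?cmod1// mul1r cmod0.
exists ((cmod z)^-1%:C * conjc z).
  by rewrite cmodM cmodJ cmod_real ger0_norm ?invr_ge0 ?cmod_ge0// mulVf// cmod_eq0.
rewrite -mulrA [_^* * _]mulrC mulJ -rmorphM /= expr2 mulKf //.
by rewrite cmod_eq0.
Qed.

End ComplexBasics.

(** * Curves in the complex plane *)

Section ComplexTopology.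
Context {R : realType}.
Local Notation C := R[i].
Local Notation Re := (@complex.Re R).
Local Notation Im := (@complex.Im R).

(** Type class resolution does not see that the neighbourhoods of a point of
    [R[i]] form a filter; all the limits below rely on this instance. *)
#[global] Instance complex_nbhs_filter (z : C) : ProperFilter (nbhs z).
Proof. exact: (@nbhs_pfilter (R[i] : topologicalType) z). Qed.

Lemma gt0_complexP (e : C) : 0 < e -> exists2 d : R, 0 < d & e = d%:C.
Proof.
case: e => a b; rewrite ltcE /= => /andP[/eqP -> a0]; by exists a.
Qed.

Lemma near_cmodP (z : C) (P : C -> Prop) :
  (\forall w \near z, P w) <->
  exists2 d : R, 0 < d & forall w, cmod (w - z) < d -> P w.
Proof.
split.
  case/nbhs_normP => e /= /gt0_complexP[d d0 ->] H; exists d => // w wz.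
  by apply: H; rewrite /= cmod_norm ltcR cmod_distC.
case=> d d0 H; apply/nbhs_normP; exists d%:C => /=; first by rewrite ltcR.
by move=> w /=; rewrite cmod_norm ltcR cmod_distC => /H.
Qed.

Lemma cvg_cmodP (T : Type) (F : set_system T) {FF : Filter F} (f : T -> C) (l : C) :
  f @ F --> l <-> forall e : R, 0 < e -> \forall x \near F, cmod (f x - l) < e.
Proof.
split => [/cvgrPdist_lt H e e0|H].
  have e0' : 0 < e%:C by rewrite ltcR.
  by apply: filterS (H _ e0') => x; rewrite cmod_norm ltcR cmod_distC.
apply/cvgrPdist_lt => e /gt0_complexP[d d0 ->].
by apply: filterS (H _ d0) => x; rewrite cmod_norm ltcR cmod_distC.
Qed.

Lemma cvg_complex (T : Type) (F : set_system T) {FF : Filter F} (f : T -> C) (l : C) :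
  (fun x => Re (f x)) @ F --> Re l -> (fun x => Im (f x)) @ F --> Im l ->
  f @ F --> l.
Proof.
move=> /cvgrPdist_lt fr /cvgrPdist_lt fi; apply/cvg_cmodP => e e0.
have e20 : 0 < e / 2 by rewrite divr_gt0.
near=> x; apply: le_lt_trans (cmod_le_ReIm _) _.
rewrite cReB cImB [e]splitr ltrD//.
  by rewrite distrC; near: x; exact: fr.
by rewrite distrC; near: x; exact: fi.
Unshelve. all: by end_near. Qed.

Section Cvg.
Context (T : Type) (F : set_system T) {FF : Filter F}.
Lemma cvg_Re (f : T -> C) (l : C) : f @ F --> l -> (fun x => Re (f x)) @ F --> Re l.
Proof.
move=> /cvg_cmodP fl; apply/cvgrPdist_lt => e e0.
apply: filterS (fl _ e0) => x; apply: le_lt_trans.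
by rewrite distrC -cReB normRe_le.
Qed.
Lemma cvg_Im (f : T -> C) (l : C) : f @ F --> l -> (fun x => Im (f x)) @ F --> Im l.
Proof.
move=> /cvg_cmodP fl; apply/cvgrPdist_lt => e e0.
apply: filterS (fl _ e0) => x; apply: le_lt_trans.
by rewrite distrC -cImB normIm_le.
Qed.
Lemma cvg_real (f : T -> R) (l : R) : f @ F --> l -> (fun x => (f x)%:C) @ F --> (l%:C : C).
Proof. by move=> fl; apply: cvg_complex => //=; apply: cvg_cst. Qed.
Lemma cvg_cplx (f g : T -> R) (l k : R) : f @ F --> l -> g @ F --> k ->
  (fun x => f x +i* g x) @ F --> (l +i* k : C).
Proof. by move=> fl gk; apply: cvg_complex. Qed.
Lemma cvg_conjc (f : T -> C) (l : C) : f @ F --> l -> (fun x => conjc (f x)) @ F --> conjc l.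
Proof.
move=> fl; apply: cvg_complex; under eq_fun do rewrite (cReJ, cImJ).
  by rewrite cReJ; exact: cvg_Re.
by rewrite cImJ; apply: cvgN; exact: cvg_Im.
Qed.
Lemma cvg_mulc (f g : T -> C) (l k : C) : f @ F --> l -> g @ F --> k ->
  (fun x => f x * g x) @ F --> l * k.
Proof. exact: cvgM. Qed.
Lemma cvg_addc (f g : T -> C) (l k : C) : f @ F --> l -> g @ F --> k ->
  (fun x => f x + g x) @ F --> l + k.
Proof. exact: cvgD. Qed.
Lemma cvg_scalec (c : C) (g : T -> C) (k : C) : g @ F --> k ->
  (fun x => c * g x) @ F --> c * k.
Proof. exact: (@cvg_mulc (fun=> c)) (cvg_cst _). Qed.
Lemma cvg_invc (f : T -> C) (l : C) : l != 0 -> f @ F --> l ->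
  (fun x => (f x)^-1) @ F --> l^-1.
Proof. by move=> l0 fl; apply: cvgV. Qed.
Lemma cvg_oppc (f : T -> C) (l : C) : f @ F --> l -> (fun x => - f x) @ F --> - l.
Proof. exact: cvgN. Qed.
Lemma cvg_cmod (f : T -> C) (l : C) : f @ F --> l -> (fun x => cmod (f x)) @ F --> cmod l.
Proof.
move=> fl; under eq_fun do rewrite cmodE; rewrite cmodE.
apply: (continuous_cvg _ (@sqrt_continuous R _)).
by apply: cvgD; rewrite expr2; under eq_fun do rewrite expr2; apply: cvgM;
   (exact: cvg_Re || exact: cvg_Im).
Qed.
End Cvg.

End ComplexTopology.

Section CurveDerivative.
Context {R : realType}.
Local Notation C := R[i].
Local Notation Re := (@complex.Re R).
Local Notation Im := (@complex.Im R).

Lemma is_derive_epsP (f : R -> R) (x l : R) :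
  is_derive x 1 f l <->
  forall e, 0 < e -> exists2 d, 0 < d & forall h, `|h| < d ->
    `|f (x + h) - f x - l * h| <= e * `|h|.
Proof.
split.
  move=> [fd fl] e e0.
  have : (fun h => h^-1 *: (f (h *: 1 + x) - f x)) @ 0^' --> l.
    by rewrite -fl; exact: fd.
  move=> /cvgrPdist_le /(_ _ e0) [d /= d0 H]; exists d => // h hd.
  have [->|h0] := eqVneq h 0; first by rewrite addr0 subrr mulr0 subr0 normr0 mulr0.
  have /= := H h; rewrite sub0r normrN => /(_ hd h0).
  rewrite /= -[h *: 1]/(h * 1) mulr1 -[_ *: _]/(h^-1 * _) => H'.
  rewrite -[X in X <= _]normrN.
  have -> : - (f (x + h) - f x - l * h) = (l - h^-1 * (f (h + x) - f x)) * h.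
    by rewrite [h + x]addrC; field.
  by rewrite normrM ler_wpM2r.
move=> H.
have fd : (fun h => h^-1 *: (f (h *: 1 + x) - f x)) @ 0^' --> l.
  apply/cvgrPdist_le => e e0; have [d d0 Hd] := H e e0.
  exists d => //= h /=; rewrite sub0r normrN => hd h0.
  rewrite -[h *: 1]/(h * 1) mulr1 -[_ *: _]/(h^-1 * _).
  have {}Hd := Hd h hd.
  rewrite -(@ler_pM2r _ `|h|) ?normr_gt0//; apply: le_trans Hd.
  rewrite -normrM -[X in X <= _]normrN le_eqVlt; apply/orP; left; apply/eqP.
  by congr `| _ |; rewrite [h + x]addrC; field.
split; last exact: cvg_lim fd.
by apply/cvg_ex; exists l.
Qed.

(** A curve in the plane is differentiated with respect to its real parameter,
    component by component, so that the calculus of real functions applies. *)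
Definition cderive (g : R -> C) (t : R) (l : C) : Prop :=
  is_derive t 1 (fun s => Re (g s)) (Re l) /\
  is_derive t 1 (fun s => Im (g s)) (Im l).

Lemma cderive_epsP (g : R -> C) t l :
  cderive g t l <->
  forall e, 0 < e -> exists2 d, 0 < d & forall h, `|h| < d ->
    cmod (g (t + h) - g t - l * h%:C) <= e * `|h|.
Proof.
split.
  case=> /is_derive_epsP gr /is_derive_epsP gi e e0.
  have e20 : 0 < e / 2 by rewrite divr_gt0.
  have [d d0 Hd] := gr _ e20; have [d' d'0 Hd'] := gi _ e20.
  exists (Num.min d d'); first by rewrite lt_min d0.
  move=> h; rewrite lt_min => /andP[hd hd'].
  apply: le_trans (cmod_le_ReIm _) _.
  rewrite [e]splitr mulrDl lerD//.
    by rewrite !ReImE /= mulr0 subr0; exact: Hd.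
  by rewrite !ReImE /= mulr0 add0r; exact: Hd'.
move=> H; split; apply/is_derive_epsP => e /H [d d0 Hd]; exists d => // h /Hd; apply: le_trans.
  by apply: le_trans (normRe_le _); rewrite !ReImE /= mulr0 subr0.
by apply: le_trans (normIm_le _); rewrite !ReImE /= mulr0 add0r.
Qed.

Lemma cderive_ext (f g : R -> C) (t : R) (l m : C) : f =1 g -> l = m -> cderive f t l -> cderive g t m.
Proof. by move=> /funext -> ->. Qed.

Lemma is_derive_ext (f g : R -> R) (t l m : R) : f =1 g -> l = m -> is_derive t 1 f l -> is_derive t 1 g m.
Proof. by move=> /funext -> ->. Qed.

Lemma cderive_cst (c : C) t : cderive (fun=> c) t 0.
Proof. by split; exact: is_derive_cst. Qed.

Lemma cderive_real (f : R -> R) (t l : R) : is_derive t 1 f l -> cderive (fun s => (f s)%:C) t l%:C.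
Proof. by move=> fl; split => //=; exact: is_derive_cst. Qed.

Lemma cderive_id t : cderive (fun s => s%:C) t 1.
Proof. by apply: cderive_real; exact: is_derive_id. Qed.

Lemma cderiveD f g t l m : cderive f t l -> cderive g t m -> cderive (fun s => f s + g s) t (l + m).
Proof.
by move=> [a b] [c d]; split; [have := is_deriveD a c|have := is_deriveD b d];
  apply: is_derive_ext => [s|]; rewrite ?(cReD, cImD).
Qed.

Lemma cderiveM f g t l m : cderive f t l -> cderive g t m -> cderive (fun s => f s * g s) t (l * g t + f t * m).
Proof.
move=> [a b] [c d]; split.
  have := is_deriveB (is_deriveM a c) (is_deriveM b d).
  apply: is_derive_ext => [s|]; first by rewrite cReM.
  by rewrite !ReImE /GRing.scale/=; ring.
have := is_deriveD (is_deriveM a d) (is_deriveM b c).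
apply: is_derive_ext => [s|]; first by rewrite cImM.
by rewrite !ReImE /GRing.scale/=; ring.
Qed.

Lemma cderiveZ (c : C) f t l : cderive f t l -> cderive (fun s => c * f s) t (c * l).
Proof. by move=> fl; have := cderiveM (cderive_cst c t) fl; rewrite mul0r add0r. Qed.

Lemma cderiveV f t l : cderive f t l -> f t != 0 -> cderive (fun s => (f s)^-1) t (- l / f t ^+ 2).
Proof.
move=> [a b] f0.
have VE z : Re z^-1 = Re z / (Re z ^+ 2 + Im z ^+ 2) /\ Im z^-1 = - Im z / (Re z ^+ 2 + Im z ^+ 2).
  by case: z => x y /=; rewrite mulNr.
have n0 : Re (f t) ^+ 2 + Im (f t) ^+ 2 != 0 by rewrite -cmod_sq expf_neq0// cmod_eq0.
have q : is_derive t 1 (fun s => Re (f s) ^+ 2 + Im (f s) ^+ 2)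
   (Re (f t) * Re l *+ 2 + Im (f t) * Im l *+ 2).
  have := is_deriveD (is_deriveM a a) (is_deriveM b b).
  by apply: is_derive_ext => [s|] //; rewrite /GRing.scale/=; ring.
have qV := @is_deriveV _ (fun s => Re (f s) ^+ 2 + Im (f s) ^+ 2) t _ 1 n0 q.
clear q; have nz (p q : R) : p * p + q * q != 0 ->
    (p * p - q * q) * (p * p - q * q) + (p * q + q * p) * (p * q + q * p) != 0.
  move=> pq0; have -> : (p * p - q * q) * (p * p - q * q) +
     (p * q + q * p) * (p * q + q * p) = (p * p + q * q) ^+ 2 by ring.
  by rewrite expf_neq0.
split.
  have := is_deriveM a qV; apply: is_derive_ext => [s|]; first by rewrite (VE _).1.
  rewrite !(ReImE, (VE _).1, (VE _).2, expr2) /GRing.scale/=.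
  move: (Re (f t)) (Im (f t)) (Re l) (Im l) n0 => p q' r s; rewrite !expr2 => n0.
  by field; rewrite n0 nz.
have b' : is_derive t 1 (fun s => - Im (f s)) (- Im l) := is_deriveN b.
have := is_deriveM b' qV; apply: is_derive_ext => [s|]; first by rewrite (VE _).2.
rewrite !(ReImE, (VE _).1, (VE _).2, expr2) /GRing.scale/=.
move: (Re (f t)) (Im (f t)) (Re l) (Im l) n0 => p q' r s; rewrite !expr2 => n0.
by field; rewrite n0 nz.
Qed.

Lemma is_derive_cont (f : R -> R) (t l : R) : is_derive t 1 f l -> {for t, continuous f}.
Proof. by case=> fd _; exact/differentiable_continuous/derivable1_diffP. Qed.

Lemma cderive_cont f t l : cderive f t l -> f x @[x --> t] --> f t.
Proof. by case=> a b; apply: cvg_complex; [exact: (is_derive_cont a)|exact: (is_derive_cont b)]. Qed.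

Lemma cderive_comp (f : R -> C) (g : R -> R) t l m :
  cderive f (g t) l -> is_derive t 1 g m -> cderive (fun s => f (g s)) t (l * m%:C).
Proof.
by move=> [a b] gm; split; [have := is_derive1_comp a gm|have := is_derive1_comp b gm];
  apply: is_derive_ext => [s|] //; rewrite !ReImE /= ?mulr0 ?subr0 ?add0r.
Qed.

(** The mean value theorem fails for complex values, but the inequality follows
    from the real theorem for the component of the curve along the chord. *)
Lemma cderive_MVT (g g' : R -> C) (M : R) :
  (forall t : R, 0 <= t <= 1 -> cderive g t (g' t)) ->
  (forall t : R, 0 <= t <= 1 -> cmod (g' t) <= M) -> cmod (g 1 - g 0) <= M.
Proof.
move=> dg bg; have [e e1 eg] := rotate_cmod (g 1 - g 0).
pose f s := Re (e * g s).
have df (t : R) : 0 <= t <= 1 -> is_derive t 1 f (Re (e * g' t)).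
  by move=> /dg /(cderiveZ e) [].
have [t t01 E] : exists2 c, c \in `[(0:R), 1]%R & f 1 - f 0 = Re (e * g' c) * (1 - 0).
  apply: MVT_segment => //.
    by move=> x; rewrite in_itv /= => /andP[x0 x1]; apply: df; rewrite !ltW.
  apply: continuous_in_subspaceT => x; rewrite inE /= in_itv /= => xx.
  exact: is_derive_cont (df _ xx).
have -> : cmod (g 1 - g 0) = Re (e * g' t).
  by rewrite subr0 mulr1 in E; rewrite -E -cReB -mulrBr eg.
apply: le_trans (Re_le _) _; rewrite cmodM e1 mul1r; apply: bg.
by move: t01; rewrite in_itv.
Qed.

Lemma cderive_is_cst (g : R -> C) : (forall t, cderive g t 0) -> forall t s, g t = g s.
Proof.
move=> g0 t s; apply/eqP; rewrite eq_complex; apply/andP; split; apply/eqP.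
  by apply: (@is_derive_0_is_cst _ (fun t => Re (g t))) => x; have [] := g0 x.
by apply: (@is_derive_0_is_cst _ (fun t => Im (g t))) => x; have [] := g0 x.
Qed.

End CurveDerivative.

(** * Functions with a continuous gradient and holomorphic functions *)

Section C1.
Context {R : realType}.
Local Notation C := R[i].
Local Notation Re := (@complex.Re R).
Local Notation Im := (@complex.Im R).
Implicit Types (D : set C) (u : C -> R) (F h : C -> C).

(** [u] has the gradient [conjc (h z)] at [z], written as a complex number, and
    this gradient is continuous.  The harmonic functions met below, such as the
    logarithm of the modulus of a zero-free function, come with their gradient
    although no holomorphic function having them as real part is constructed. *)
Definition gradC1 D u h : Prop := forall z, D z ->
  (forall v, is_derive (0:R) 1 (fun t => u (z + t%:C * v)) (Re (h z * v))) /\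
  h w @[w --> z] --> h z.

(** Holomorphy is recorded by real directional derivatives together with a
    continuous candidate for the complex derivative.  With continuity, directional
    derivatives suffice for total differentiability ([gradC1_frechet]). *)
Definition holC1 D F F' : Prop := forall z, D z ->
  (forall v, cderive (fun t => F (z + t%:C * v)) 0 (F' z * v)) /\
  F' w @[w --> z] --> F' z.

Lemma is_derive_at0 (f : R -> R) (t l : R) :
  is_derive (0:R) 1 (fun s => f (t + s)) l -> is_derive t 1 f l.
Proof.
move=> /is_derive_epsP H; apply/is_derive_epsP => e /H [d d0 Hd].
by exists d => // h /Hd; rewrite add0r addr0.
Qed.

Lemma gradC1_line D u h z w (t : R) : gradC1 D u h -> D (z + t%:C * w) ->
  is_derive t 1 (fun s => u (z + s%:C * w)) (Re (h (z + t%:C * w) * w)).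
Proof.
move=> uh /uh [H _]; apply: is_derive_at0.
apply: is_derive_ext (H w) => // s.
by rewrite -addrA -mulrDl rmorphD.
Qed.

(** Along the segment from [z] to [z + w], the mean value theorem expresses the
    increment of [u] by the gradient at an intermediate point, which is close to the
    gradient at [z] by continuity. *)
Lemma gradC1_frechet D u h z : open D -> gradC1 D u h -> D z ->
  forall e, 0 < e -> exists2 d : R, 0 < d & forall w, cmod w < d ->
    `|u (z + w) - u z - Re (h z * w)| <= e * cmod w.
Proof.
move=> Do uh Dz e e0; have [_ /cvg_cmodP/(_ _ e0) hz] := uh z Dz.
have : \forall w \near z, D w /\ cmod (h w - h z) < e.
  by apply: filterI; [exact: open_nbhs_nbhs|exact: hz].
move=> /near_cmodP [d d0 Hd]; exists d => // w wd.
pose f t := u (z + t%:C * w) - Re (h z * w) * t.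
have in_d (t : R) : 0 <= t <= 1 -> D (z + t%:C * w) /\ cmod (h (z + t%:C * w) - h z) < e.
  move=> /andP[t0 t1]; apply: Hd; rewrite addrC addKr cmodM cmod_real ger0_norm//.
  by apply: le_lt_trans wd; rewrite ler_piMl// cmod_ge0.
have df (t : R) : 0 <= t <= 1 -> is_derive t 1 f (Re ((h (z + t%:C * w) - h z) * w)).
  move=> t01; have [Dt _] := in_d t t01.
  have k : is_derive t 1 (fun t => Re (h z * w) * t) (Re (h z * w)).
    have := is_deriveM (is_derive_cst (Re (h z * w)) t 1) (is_derive_id t (1:R)).
    by apply: is_derive_ext => // ; rewrite /GRing.scale /= mulr1 mulr0 addr0.
  have := is_deriveB (gradC1_line uh Dt) k.
  by apply: is_derive_ext => //; rewrite !ReImE; ring.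
have [t t01 E] : exists2 c, c \in `[(0:R), 1]%R &
    f 1 - f 0 = Re ((h (z + c%:C * w) - h z) * w) * (1 - 0).
  apply: (MVT_segment (f := f) (df := fun t => Re ((h (z + t%:C * w) - h z) * w))) => //.
    by move=> x; rewrite in_itv /= => /andP[x0 x1]; apply: df; rewrite !ltW.
  apply: continuous_in_subspaceT => x; rewrite inE /= in_itv /= => xx.
  exact: is_derive_cont (df _ xx).
have -> : u (z + w) - u z - Re (h z * w) = f 1 - f 0.
  by rewrite /f mulr0 subr0 mulr1 mul0r addr0 mul1r addrAC.
rewrite E subr0 mulr1; apply: le_trans (normRe_le _) _; rewrite cmodM.
apply: ler_wpM2r; rewrite ?cmod_ge0//; apply: ltW.
by apply: (in_d _ _).2; move: t01; rewrite in_itv.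
Qed.

Lemma gradC1_chain D u h (g : R -> C) (t : R) (l : C) : open D -> gradC1 D u h ->
  D (g t) -> cderive g t l -> is_derive t 1 (fun s => u (g s)) (Re (h (g t) * l)).
Proof.
move=> Do uh Dz gl; apply/is_derive_epsP => e e0.
set z := g t; pose K := cmod l + cmod (h z) + 1 + 1.
have K0 : 0 < K by rewrite /K ltr_wpDl// !addr_ge0// ?cmod_ge0.
pose e1 := Num.min 1 (e / K).
have e1K : e1 <= e / K by rewrite /e1 ge_min lexx orbT.
have e11 : e1 <= 1 by rewrite /e1 ge_min lexx.
have e10 : 0 < e1 by rewrite lt_min ltr01 divr_gt0.
have [d d0 Hd] := gradC1_frechet Do uh Dz e10.
have [d' d'0 Hd'] := (cderive_epsP _ _ _).1 gl _ e10.
have dK : 0 < d / (cmod l + 1) by rewrite divr_gt0// ltr_wpDl// cmod_ge0.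
exists (Num.min d' (d / (cmod l + 1))); first by rewrite lt_min d'0.
move=> s; rewrite lt_min => /andP[sd' sd].
pose w := g (t + s) - z.
have ws : cmod (w - l * s%:C) <= e1 * `|s| by exact: Hd'.
have wl : cmod w <= (cmod l + 1) * `|s|.
  have -> : w = (w - l * s%:C) + l * s%:C by rewrite subrK.
  apply: le_trans (cmodD _ _) _; rewrite cmodM cmod_real addrC mulrDl lerD2l.
  by apply: le_trans ws _; rewrite ler_wpM2r.
have wd : cmod w < d.
  apply: le_lt_trans wl _; rewrite mulrC -ltr_pdivlMr// ltr_wpDl// cmod_ge0//.
have /= := Hd w wd; have -> : z + w = g (t + s) by rewrite addrC subrK.
move=> H.
have -> : u (g (t + s)) - u z - Re (h z * l) * s =
   (u (g (t + s)) - u z - Re (h z * w)) + Re (h z * (w - l * s%:C)).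
  by rewrite !ReImE /=; ring.
apply: le_trans (ler_normD _ _) _.
apply: (@le_trans _ _ (e1 * ((cmod l + 1) * `|s|) + cmod (h z) * (e1 * `|s|))).
  apply: lerD; first by apply: le_trans H _; rewrite ler_wpM2l// ltW.
  apply: le_trans (normRe_le _) _; rewrite cmodM ler_wpM2l ?cmod_ge0//.
have -> : e1 * ((cmod l + 1) * `|s|) + cmod (h z) * (e1 * `|s|) = e1 * (cmod l + cmod (h z) + 1) * `|s| by ring.
rewrite ler_wpM2r//; apply: le_trans (_ : e / K * K <= e); last by rewrite divfK// gt_eqF.
apply: ler_pM => //; first exact: ltW.
  by rewrite !addr_ge0// cmod_ge0.
by rewrite /K lerDl.
Qed.

Lemma gradC1_cont D u h z : open D -> gradC1 D u h -> D z -> u w @[w --> z] --> u z.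
Proof.
move=> Do uh Dz; have [d d0 Hd] := gradC1_frechet Do uh Dz ltr01.
apply/cvgrPdist_lt => e e0; apply/near_cmodP.
pose K := cmod (h z) + 1.
have K0 : 0 < K by rewrite ltr_wpDl// cmod_ge0.
exists (Num.min d (e / K)); first by rewrite lt_min d0 divr_gt0.
move=> w; rewrite lt_min => /andP[wd we].
have := Hd _ wd; rewrite (addrC z) subrK mul1r => H.
have -> : u z - u w = - ((u w - u z - Re (h z * (w - z))) + Re (h z * (w - z))) by ring.
rewrite normrN; apply: le_lt_trans (ler_normD _ _) _.
apply: (@le_lt_trans _ _ (cmod (w - z) * K)); last by rewrite -ltr_pdivlMr.
have -> : cmod (w - z) * K = cmod (w - z) + cmod (h z) * cmod (w - z) by rewrite /K; ring.
apply: lerD => //.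
by apply: le_trans (normRe_le _) _; rewrite cmodM.
Qed.

(** A holomorphic function is handled through the real parts of its multiples:
    [c = 1] and [c = - 'i%C] give the two components, and a unimodular [c] gives
    the component in any direction. *)
Lemma holC1_Re D F F' (c : C) : holC1 D F F' -> gradC1 D (fun z => Re (c * F z)) (fun z => c * F' z).
Proof.
move=> FF z /FF [H cF]; split.
  by move=> v; have [] := cderiveZ c (H v); rewrite mulrA.
by apply: cvg_scalec; exact: cF.
Qed.

Lemma holC1_chain D F F' (g : R -> C) (t : R) (l : C) : open D -> holC1 D F F' ->
  D (g t) -> cderive g t l -> cderive (fun s => F (g s)) t (F' (g t) * l).
Proof.
move=> Do FF Dz gl; split.
  have := gradC1_chain Do (holC1_Re 1 FF) Dz gl.
  by apply: is_derive_ext => [s|]; rewrite mul1r.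
have := gradC1_chain Do (holC1_Re (- 'i%C) FF) Dz gl.
by apply: is_derive_ext => [s|]; rewrite !ReImE /=; ring.
Qed.

Lemma holC1_cont D F F' z : open D -> holC1 D F F' -> D z -> F w @[w --> z] --> F z.
Proof.
move=> Do FF Dz; apply: cvg_complex.
  by have := gradC1_cont Do (holC1_Re 1 FF) Dz; under eq_fun do rewrite mul1r; rewrite mul1r.
have := gradC1_cont Do (holC1_Re (- 'i%C) FF) Dz.
have E w : Re (- 'i%C * F w) = Im (F w) by rewrite !ReImE /=; ring.
by rewrite E; under eq_fun do rewrite E; exact.
Qed.

Lemma holC1_ext D F F' G G' : holC1 D F F' -> F =1 G -> F' =1 G' -> holC1 D G G'.
Proof. by move=> FF /funext <- /funext <-. Qed.

Lemma holC1_sub D E F F' : E `<=` D -> holC1 D F F' -> holC1 E F F'.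
Proof. by move=> ED FF z /ED /FF. Qed.

Lemma holC1_cst D (c : C) : holC1 D (fun=> c) (fun=> 0).
Proof.
move=> z _; split; last exact: cvg_cst.
by move=> v; rewrite mul0r; exact: cderive_cst.
Qed.

Lemma cderive_line (z v : C) (t : R) : cderive (fun t => z + t%:C * v) t v.
Proof.
have := cderiveD (cderive_cst z t) (cderiveM (cderive_id t) (cderive_cst v t)).
by apply: cderive_ext => //; rewrite add0r mul1r mulr0 addr0.
Qed.

Lemma holC1_id D : holC1 D id (fun=> 1).
Proof.
move=> z _; split; last exact: cvg_cst.
by move=> v; rewrite mul1r; exact: cderive_line.
Qed.

Lemma holC1D D F F' G G' : holC1 D F F' -> holC1 D G G' ->
  holC1 D (fun z => F z + G z) (fun z => F' z + G' z).
Proof.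
move=> FF GG z Dz; have [a b] := FF z Dz; have [c d] := GG z Dz; split.
  by move=> v; rewrite mulrDl; exact: cderiveD (a v) (c v).
exact: (cvg_addc b d).
Qed.

Lemma holC1M D F F' G G' : open D -> holC1 D F F' -> holC1 D G G' ->
  holC1 D (fun z => F z * G z) (fun z => F' z * G z + F z * G' z).
Proof.
move=> Do FF GG z Dz; have [a b] := FF z Dz; have [c d] := GG z Dz; split.
  move=> v; have := cderiveM (a v) (c v); apply: cderive_ext => //.
  by rewrite mul0r addr0; ring.
by apply: cvg_addc; apply: cvg_mulc; [exact: b|exact: holC1_cont GG _|exact: holC1_cont FF _|exact: d].
Qed.

Lemma holC1Z D (c : C) F F' : holC1 D F F' -> holC1 D (fun z => c * F z) (fun z => c * F' z).
Proof.
move=> FF z Dz; have [a b] := FF z Dz; split.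
  by move=> v; rewrite -mulrA; exact: cderiveZ.
by apply: cvg_scalec; exact: b.
Qed.

Lemma holC1V D F F' : open D -> holC1 D F F' -> (forall z, D z -> F z != 0) ->
  holC1 D (fun z => (F z)^-1) (fun z => - F' z / F z ^+ 2).
Proof.
move=> Do FF F0 z Dz; have [a b] := FF z Dz; split.
  move=> v; have := cderiveV (a v); rewrite mul0r addr0 => /(_ (F0 z Dz)).
  by apply: cderive_ext => //; ring.
apply: cvg_mulc; first exact: (cvg_oppc b).
have cF := holC1_cont Do FF Dz.
apply: cvg_invc; first by rewrite expf_neq0 ?F0.
exact: (cvg_mulc cF cF).
Qed.

Lemma holC1_affine D F F' (a b : C) : holC1 D F F' ->
  holC1 [set z | D (a + b * z)] (fun z => F (a + b * z)) (fun z => b * F' (a + b * z)).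
Proof.
move=> FF z /= Dz; have [H cF] := FF _ Dz; split.
  move=> v; have := H (b * v); apply: cderive_ext => [t|]; last by ring.
  by congr F; ring.
apply: cvg_scalec.
have : a + b * w @[w --> z] --> a + b * z.
  by apply: cvg_addc; [exact: cvg_cst|apply: cvg_scalec; exact: cvg_id].
by move=> /cvg_comp; apply.
Qed.

Lemma gradC1_affine u h (c : C) (r : R) : gradC1 setT u h ->
  gradC1 setT (fun z => u (c + r%:C * z)) (fun z => r%:C * h (c + r%:C * z)).
Proof.
move=> uh z _; have [H cF] := uh (c + r%:C * z) I; split.
  move=> v; have := H (r%:C * v); apply: is_derive_ext => [t|]; last by congr (Re _); ring.
  by congr u; ring.
apply: cvg_scalec.
have : c + r%:C * w @[w --> z] --> c + r%:C * z.
  by apply: cvg_addc; [exact: cvg_cst|apply: cvg_scalec; exact: cvg_id].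
by move=> /cvg_comp; apply.
Qed.

End C1.

(** * Integrals over a period *)

Section CircleIntegral.
Context {R : realType}.
Local Notation C := R[i].
Local Notation Re := (@complex.Re R).
Local Notation Im := (@complex.Im R).
Local Notation mu := (@lebesgue_measure R).

(** Integrals over the unit circle, parametrized by the argument. *)
Definition circ (k : R -> R) : R := \int[mu]_(x in `[0, 2 * pi]%classic) k x.

Lemma twopi_gt0 : 0 < 2 * pi :> R.
Proof. by rewrite mulr_gt0// pi_gt0. Qed.

Lemma circ_integrable (k : R -> R) : continuous k ->
  mu.-integrable `[0, 2 * pi]%classic (EFin \o k).
Proof.
move=> ck; apply: continuous_compact_integrable; first exact: segment_compact.
exact: continuous_subspaceT.
Qed.
Local Hint Resolve circ_integrable : core.

Lemma circ_meas : measurable (`[0, 2 * pi]%classic : set R).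
Proof. exact: measurable_itv. Qed.
Local Hint Resolve circ_meas : core.

Lemma circD (k l : R -> R) : continuous k -> continuous l ->
  circ (fun x => k x + l x) = circ k + circ l.
Proof. by move=> ck cl; rewrite /circ RintegralD//; exact: circ_integrable. Qed.

Lemma circZ (c : R) (k : R -> R) : continuous k -> circ (fun x => c * k x) = c * circ k.
Proof. by move=> ck; rewrite /circ RintegralZl//; exact: circ_integrable. Qed.

Lemma circB (k l : R -> R) : continuous k -> continuous l ->
  circ (fun x => k x - l x) = circ k - circ l.
Proof. by move=> ck cl; rewrite /circ RintegralB//; exact: circ_integrable. Qed.

Lemma circ_cst (c : R) : circ (fun=> c) = c * (2 * pi).
Proof.
rewrite /circ Rintegral_cst//= lebesgue_measure_itv /= lte_fin twopi_gt0.
by rewrite -EFinD /= subr0.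
Qed.

Lemma eq_circ (k l : R -> R) : k =1 l -> circ k = circ l.
Proof. by move=> /funext ->. Qed.

Lemma le_circ (k l : R -> R) : continuous k -> continuous l ->
  (forall x, 0 <= x <= 2 * pi -> k x <= l x) -> circ k <= circ l.
Proof.
move=> ck cl kl; apply: le_Rintegral; [exact: circ_meas|exact: circ_integrable|exact: circ_integrable|].
by move=> x /=; rewrite in_itv /= => /kl.
Qed.

Lemma circ_norm_le (k l : R -> R) : continuous k -> continuous l ->
  (forall x, 0 <= x <= 2 * pi -> `|k x| <= l x) -> `|circ k| <= circ l.
Proof.
move=> ck cl kl; apply: le_trans (le_normr_Rintegral _ _) _ => //.
  exact: circ_integrable.
by apply: le_circ => // x; apply: (continuous_comp (ck x)); exact: norm_continuous.
Qed.

Lemma circ_FTC (k K : R -> R) : continuous k ->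
  (forall x : R, is_derive x 1 K (k x)) -> circ k = K (2 * pi) - K 0.
Proof.
move=> ck dK; have cK (x : R) : {for x, continuous K} := is_derive_cont (dK x).
rewrite /circ /Rintegral (@continuous_FTC2 _ k K)//.
- exact: twopi_gt0.
- exact: continuous_subspaceT.
- split.
  + by move=> x _; have [] := dK x.
  + by apply: cvg_at_right_filter; exact: cK.
  + by apply: cvg_at_left_filter; exact: cK.
- by move=> x _; rewrite derive1E; exact: derive_val.
Qed.

(** The period is compact, so that a jointly continuous kernel varies uniformly
    when its parameter varies. *)
Lemma circ_uniform (T : topologicalType) (K : T -> R -> R) (a : T) :
  (forall x, K p.1 p.2 @[p --> (a, x)] --> K a x) ->
  forall e, 0 < e ->
  \forall t \near a, forall x, 0 <= x <= 2 * pi -> `|K t x - K a x| < e.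
Proof.
move=> cK e e0.
have cKa : continuous (K a).
  move=> x; apply: (@cvg_comp _ _ _ (fun y : R => (a, y)) (fun p : T * R => K p.1 p.2) _ _ _ _ (cK x)).
  have A1 : (fun=> a) @ x --> a by exact: cvg_cst.
  have A2 : id @ x --> x by exact: cvg_id.
  exact: (cvg_pair A1 A2).
have nc := (compact_near_coveringP _).1 (@segment_compact R 0 (2 * pi)).
have : \forall t \near a, `[0, 2 * pi]%classic `<=` (fun x => `|K t x - K a x| < e).
  apply: (nc T (nbhs a) (fun t x => `|K t x - K a x| < e)) => x _.
  have h2 : 0 < e / 2 by rewrite divr_gt0.
  have /cvgrPdist_lt/(_ _ h2) N1 := cK x.
  have /cvgrPdist_lt/(_ _ h2) N2 := cKa x.
  case: N1 => -[A B] /= [nA nB] AB.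
  exists (B `&` [set y | `|K a x - K a y| < e / 2], A) => /=.
    by split => //; exact: filterI.
  move=> [y t] /= [[By yy] At].
  have := AB (t, y) (conj At By) => /= H.
  have -> : K t y - K a y = (K a x - K a y) - (K a x - K t y) by ring.
  apply: le_lt_trans (ler_normB _ _) _.
  by rewrite [e]splitr ltrD.
by apply: filterS => t H x xI; apply: H; rewrite /= in_itv.
Qed.

Lemma circ_cvg (T : topologicalType) (K : T -> R -> R) (a : T) :
  (forall t, continuous (K t)) ->
  (forall x, K p.1 p.2 @[p --> (a, x)] --> K a x) ->
  circ (K t) @[t --> a] --> circ (K a).
Proof.
move=> cK cKa; apply/cvgrPdist_lt => e e0.
have e1 : 0 < e / (2 * pi) / 2 by rewrite !divr_gt0 ?twopi_gt0.
apply: filterS (circ_uniform cKa e1) => t Ht.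
rewrite -circB//.
apply: (@le_lt_trans _ _ (circ (fun=> e / (2 * pi) / 2))).
  apply: circ_norm_le => [x|x|x xI]; last by rewrite distrC ltW// Ht.
    by apply: cvgB; exact: cK.
  exact: cvg_cst.
rewrite circ_cst mulrAC divfK ?gt_eqF ?twopi_gt0//.
by rewrite ltr_pdivrMr// ltr_pMr// ltr1n.
Qed.

(** By uniformity, near [a] the derivative of the integrand is at most
    [`|D a x| + 1], which dominates the difference quotients. *)
Lemma circ_deriv_under (U D : R -> R -> R) (a r : R) : 0 < r ->
  (forall t : R, `|t - a| < r -> continuous (U t)) ->
  (forall t x : R, `|t - a| < r -> is_derive t 1 (U ^~ x) (D t x)) ->
  (forall x, D p.1 p.2 @[p --> (a, x)] --> D a x) ->
  is_derive a 1 (fun t => circ (U t)) (circ (D a)).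
Proof.
move=> r0 cU dU cderive'.
have cDa : continuous (D a).
  move=> x; apply: (@cvg_comp _ _ _ (fun y : R => (a, y)) (fun p : R * R => D p.1 p.2) _ _ _ _ (cderive' x)).
  have A1 : (fun=> a) @ x --> a by exact: cvg_cst.
  have A2 : id @ x --> x by exact: cvg_id.
  exact: (cvg_pair A1 A2).
have := circ_uniform cderive' ltr01.
move=> /nbhs_normP [d /= d0 Hd].
pose e := Num.min r d.
have e0 : 0 < e by rewrite lt_min r0.
have inI t : t \in `]a - e, a + e[ -> `|t - a| < e.
  by rewrite in_itv /= ltr_distl.
have er t : `|t - a| < e -> `|t - a| < r by rewrite lt_min => /andP[].
have Ia : a \in `]a - e, a + e[ by rewrite in_itv /= ltrDl e0 ltrBlDr ltrDl e0.
have G_int : mu.-integrable `[0, 2 * pi]%classic (EFin \o (fun x => `|D a x| + 1)).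
  apply: circ_integrable => x; apply: cvgD; last exact: cvg_cst.
  by apply: (continuous_comp (cDa x)); exact: norm_continuous.
have derU t x : `|t - a| < r -> partial1of2 U t x = D t x.
  by move=> /dU dd; rewrite partial1of2E; exact: derive_val.
have H1 := @derivable_under_integral R _ _ mu U _ circ_meas a _ _ Ia _ _ (fun x => `|D a x| + 1) _ G_int.
have H2 := @differentiation_under_integral R _ _ mu U _ circ_meas a _ _ Ia _ _ (fun x => `|D a x| + 1) _ G_int.
have A1 : forall x : R, `]a - e, a + e[%classic x -> mu.-integrable `[0, 2 * pi]%classic (EFin \o U x).
  by move=> t /inI/er /cU; exact: circ_integrable.
have A2 : forall x y : R, `]a - e, a + e[%classic x -> `[0, 2 * pi]%classic y -> derivable (U^~ y) x 1.
  by move=> t x /inI/er/(dU t x)[].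
have A3 : forall y : R, 0 <= `|D a y| + 1 by move=> y; rewrite addr_ge0.
have A4 : forall x y : R, `]a - e, a + e[%classic x -> `[0, 2 * pi]%classic y ->
    `|partial1of2 U x y| <= `|D a y| + 1.
  move=> t x /inI te xI; rewrite derU; last exact: er.
  rewrite -lerBlDl; apply: le_trans (lerB_dist _ _) _ => //.
  rewrite ltW//; apply: Hd => //=.
  by rewrite distrC; move: te; rewrite lt_min => /andP[].
split; first exact: (H1 A1 A2 A3 A4).
have := H2 A1 A2 A3 A4; rewrite derive1E => ->.
apply: eq_Rintegral => x _; apply: derU.
by rewrite subrr normr0.
Qed.

End CircleIntegral.

(** * The mean value property *)

Section Circle.
Context {R : realType}.
Local Notation C := R[i].
Local Notation Re := (@complex.Re R).
Local Notation Im := (@complex.Im R).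

Definition ei (x : R) : C := cos x +i* sin x.

Lemma cmod_ei x : cmod (ei x) = 1.
Proof. by rewrite cmodE /= cos2Dsin2 sqrtr1. Qed.

Lemma ei_J x : ei x * conjc (ei x) = 1.
Proof. by rewrite mulJ cmod_ei expr1n. Qed.

Lemma ei_neq0 x : ei x != 0.
Proof. by rewrite -cmod_eq0 cmod_ei oner_eq0. Qed.

Lemma ei_2pi : ei (2 * pi) = ei 0.
Proof. by rewrite /ei mulr_natl cos2pi sin2pi cos0 sin0. Qed.

Lemma ei_cont : forall x, ei y @[y --> x] --> ei x.
Proof. by move=> x; apply: cvg_cplx; [exact: continuous_cos|exact: continuous_sin]. Qed.

Lemma cderive_ei (x : R) : cderive ei x ('i%C * ei x).
Proof.
split; rewrite !ReImE /= mul0r.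
  by rewrite sub0r mul1r; exact: is_derive_cos.
by rewrite mul1r add0r; exact: is_derive_sin.
Qed.

(** All the integral formulas below are proved by differentiating an integral over
    the circle along segments [a x + t%:C * b x] that depend on the point of the
    circle. *)
Lemma circ_line (D : set C) (u : C -> R) (h : C -> C) (a b : R -> C) (p : R -> R) (t0 r : R) :
  open D -> gradC1 D u h -> 0 < r ->
  (forall x, a y @[y --> x] --> a x) -> (forall x, b y @[y --> x] --> b x) ->
  continuous p ->
  (forall t x : R, `|t - t0| < r -> D (a x + t%:C * b x)) ->
  is_derive t0 1 (fun t : R => circ (fun x => u (a x + t%:C * b x) * p x))
    (circ (fun x => Re (h (a x + t0%:C * b x) * b x) * p x)).
Proof.
move=> Do uh r0 ca cb cp HD.
apply: (@circ_deriv_under _ (fun t x => u (a x + t%:C * b x) * p x)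
         (fun t x => Re (h (a x + t%:C * b x) * b x) * p x) t0 r r0).
- move=> t tr x; apply: cvgM; last exact: cp.
  have g : a y + t%:C * b y @[y --> x] --> a x + t%:C * b x.
    by apply: cvg_addc; [exact: ca|apply: cvg_scalec; exact: cb].
  exact: (cvg_comp _ _ g (gradC1_cont Do uh (HD t x tr))).
- move=> t x tr.
  have d1 := gradC1_chain Do uh (HD t x tr) (cderive_line (a x) (b x) t).
  have := is_deriveM d1 (is_derive_cst (p x) t 1).
  apply: is_derive_ext => //.
  by rewrite /GRing.scale /= mulr0 add0r mulrC.
- move=> x.
  have x1 : (fun q : R * R => q.2) @ (t0, x) --> x by exact: cvg_snd.
  have t1 : (fun q : R * R => q.1) @ (t0, x) --> t0 by exact: cvg_fst.
  have bx : (fun q : R * R => b q.2) @ (t0, x) --> b x by exact: (cvg_comp _ _ x1 (cb x)).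
  apply: cvgM; last exact: (cvg_comp _ _ x1 (cp x)).
  apply: cvg_Re; apply: cvg_mulc; last exact: bx.
  have g : (fun q : R * R => a q.2 + q.1%:C * b q.2) @ (t0, x) --> a x + t0%:C * b x.
    apply: cvg_addc; first exact: (cvg_comp _ _ x1 (ca x)).
    by apply: cvg_mulc; [exact: cvg_real|exact: bx].
  have Dx : D (a x + t0%:C * b x) by apply: HD; rewrite subrr normr0.
  exact: (cvg_comp _ _ g (uh _ Dx).2).
Qed.

Lemma disc_open (r : R) : open [set z : C | cmod z < r].
Proof.
rewrite openE => z /= zr; apply/near_cmodP; exists (r - cmod z); first by rewrite subr_gt0.
move=> w wz; rewrite -(subrK z w); apply: le_lt_trans (cmodD _ _) _.
by rewrite -ltrBrDr.
Qed.

(** The integral over the circle of radius [t] does not depend on [t]: its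
    derivative is the integral of the real part of [F' (t * e^(ix)) * e^(ix)], which is [t^-1]
    times the derivative in [x] of the imaginary part of [F (t * e^(ix))], a periodic
    function.  At [t = 0] the integral is that of a constant. *)
Lemma circ_mean (rho : R) (F F' : C -> C) : 1 < rho ->
  holC1 [set z | cmod z < rho] F F' ->
  circ (fun x => Re (F (ei x))) = Re (F 0) * (2 * pi).
Proof.
move=> rho1 FF; set D := [set z | cmod z < rho].
have Do : open D := @disc_open rho.
have rho0 : 0 < rho by apply: lt_trans rho1.
have FR : gradC1 D (fun z => Re (F z)) F'.
  by move=> z /FF [H c]; split => // v; have [] := H v.
pose Phi (t : R) := circ (fun x => Re (F (0 + t%:C * ei x)) * 1).
have Dt (t : R) x : `|t| < rho -> D (0 + t%:C * ei x).
  by move=> tr; rewrite /D /= add0r cmodM cmod_ei cmod_real mulr1.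
have dPhi (t : R) : `|t| < rho ->
    is_derive t 1 Phi (circ (fun x => Re (F' (0 + t%:C * ei x) * ei x) * 1)).
  move=> tr; apply: (@circ_line D (fun z => Re (F z)) F' (fun=> 0) ei (fun=> 1) t (rho - `|t|) Do FR); rewrite ?subr_gt0 //; clear -Dt tr.
  - by move=> x; exact: cvg_cst.
  - exact: ei_cont.
  - by move=> x; exact: cvg_cst.
  - move=> s x st; apply: Dt; rewrite -(subrK t s).
    by apply: le_lt_trans (ler_normD _ _) _; rewrite -ltrBrDr.
have cF' (t x : R) : `|t| < rho -> F' (0 + t%:C * ei y) @[y --> x] --> F' (0 + t%:C * ei x).
  move=> tr; have g : 0 + t%:C * ei y @[y --> x] --> 0 + t%:C * ei x.
    by apply: cvg_addc; [exact: cvg_cst|apply: cvg_scalec; exact: ei_cont].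
  exact: (cvg_comp _ _ g (FF _ (Dt t x tr)).2).
have dPhi0 (t : R) : `|t| < rho -> t != 0 -> is_derive t 1 Phi 0.
  move=> tr t0; have := dPhi t tr; apply: is_derive_ext => //.
  pose K x := t^-1 * Im (F (0 + t%:C * ei x)).
  have -> : 0 = K (2 * pi) - K 0 by rewrite /K ei_2pi subrr.
  apply: circ_FTC.
    move=> x; apply: cvgM; last exact: cvg_cst.
    by apply: cvg_Re; apply: cvg_mulc; [exact: cF'|exact: ei_cont].
  move=> x.
  have := holC1_chain Do FF (Dt t x tr) (cderiveD (cderive_cst 0 x) (cderiveZ t%:C (cderive_ei x))).
  case=> _ dI; have := is_deriveM (is_derive_cst t^-1 x 1) dI.
  apply: is_derive_ext => //; rewrite /GRing.scale.
  have -> : (0 + t%:C * ('i%C * ei x) = t%:C * 'i%C * ei x) by rewrite add0r mulrA.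
  cbv beta; move: (F' (0 + t%:C * ei x)) (Im (F (0 + t%:C * ei x))) => q f; move: (ei x) => e; rewrite !ReImE /=.
  by field.
have cPhi (t : R) : `|t| < rho -> {for t, continuous Phi}.
  by move=> /dPhi; exact: is_derive_cont.
have [c _ E] : exists2 c, c \in `[(0:R), 1] & Phi 1 - Phi 0 = 0 * (1 - 0).
  apply: (MVT_segment (f := Phi) (df := fun=> 0)) => //.
    move=> x; rewrite in_itv /= => /andP[x0 x1]; apply: dPhi0; last by rewrite gt_eqF.
    by rewrite ger0_norm ?ltW// (lt_trans x1).
  apply: continuous_in_subspaceT => x; rewrite inE /= in_itv /= => /andP[x0 x1].
  by apply: cPhi; rewrite ger0_norm// (le_lt_trans x1).
move: E; rewrite mul0r => /eqP; rewrite subr_eq0 => /eqP.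
rewrite /Phi.
have -> : (fun x => Re (F (0 + 0%:C * ei x)) * 1) = (fun=> Re (F 0)).
  by apply/funext => x; rewrite mul0r addr0 mulr1.
rewrite circ_cst => <-; apply: eq_circ => x.
by rewrite mulr1 add0r mul1r.
Qed.

Lemma circ_mean_entire (F F' : C -> C) : holC1 setT F F' ->
  circ (fun x => Re (F (ei x))) = Re (F 0) * (2 * pi).
Proof.
move=> FF; apply: (@circ_mean 2 F F'); first by rewrite ltr1n.
exact: holC1_sub FF.
Qed.

End Circle.

(** * Derivatives of holomorphic functions are holomorphic *)

Section Closure.
Context {R : realType}.
Local Notation C := R[i].
Local Notation Re := (@complex.Re R).
Local Notation Im := (@complex.Im R).

Lemma openCT : open (setT : set C).
Proof. exact: openT. Qed.

Lemma ei_comp_cont (F : C -> C) (a b : C) : (forall z, F w @[w --> z] --> F z) ->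
  forall x, F (a + b * ei y) @[y --> x] --> F (a + b * ei x).
Proof.
move=> cF x; have g : a + b * ei y @[y --> x] --> a + b * ei x.
  by apply: cvg_addc; [exact: cvg_cst|apply: cvg_scalec; exact: ei_cont].
exact: (cvg_comp _ _ g (cF _)).
Qed.

Lemma ei_comp_contR (u : C -> R) (a b : C) : (forall z, u w @[w --> z] --> u z) ->
  forall x, u (a + b * ei y) @[y --> x] --> u (a + b * ei x).
Proof.
move=> cF x; have g : a + b * ei y @[y --> x] --> a + b * ei x.
  by apply: cvg_addc; [exact: cvg_cst|apply: cvg_scalec; exact: ei_cont].
exact: (cvg_comp _ _ g (cF _)).
Qed.

Lemma holC1_real D (F F' : C -> C) : holC1 D F F' -> gradC1 D (fun z => Re (F z)) F'.
Proof. by move=> FF z /FF [H c]; split => // v; have [] := H v. Qed.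

Lemma holC1_contT (F F' : C -> C) : holC1 setT F F' -> forall z, F w @[w --> z] --> F z.
Proof. by move=> FF z; exact: holC1_cont openCT FF I. Qed.

Lemma cos_ei x : cos x = Re (ei x). Proof. by []. Qed.
Lemma sin_ei x : sin x = Im (ei x). Proof. by []. Qed.
Lemma ei_sq (x : R) : Re (ei x) * Re (ei x) + Im (ei x) * Im (ei x) = 1.
Proof. by rewrite -!expr2 -cmod_sq cmod_ei expr1n. Qed.

(** The integral [Phi t] of the real part of [F (t * e^(ix)) * e^(-ix)] has for
    derivative the integral [Q t] of the real part of [F' (t * e^(ix))], and an
    integration by parts in [x] gives [Phi t = t * Q t].  Hence [Phi t / t] is
    constant, equal to its limit [Q 0] at the origin.  Only the continuity of [F']
    is used, as it is to be shown that [F'] is itself differentiable. *)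
Lemma circ_cauchy (F F' : C -> C) : holC1 setT F F' ->
  circ (fun x => Re (F (ei x) * conjc (ei x))) = Re (F' 0) * (2 * pi).
Proof.
move=> FF.
pose P1 (t : R) := circ (fun x => Re (F (0 + t%:C * ei x)) * cos x).
pose P2 (t : R) := circ (fun x => Re (- 'i%C * F (0 + t%:C * ei x)) * sin x).
pose Q (t : R) := circ (fun x => Re (F' (0 + t%:C * ei x))).
have cF := holC1_contT FF.
have cF' z : F' w @[w --> z] --> F' z by exact: (FF z I).2.
have cc : continuous (@cos R) by exact: continuous_cos.
have cs : continuous (@sin R) by exact: continuous_sin.
have c0 : forall x : R, (fun=> (0:C)) y @[y --> x] --> (0:C) by move=> x; exact: cvg_cst.
have cFe (t : R) := ei_comp_cont (a := 0) (b := t%:C) cF.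
have cFe' (t : R) := ei_comp_cont (a := 0) (b := t%:C) cF'.
have d1 (t : R) : is_derive t 1 P1 (circ (fun x => Re (F' (0 + t%:C * ei x) * ei x) * cos x)).
  by apply: (circ_line openCT (holC1_real FF) ltr01 c0 ei_cont cc).
have d2 (t : R) : is_derive t 1 P2 (circ (fun x => Re (- 'i%C * F' (0 + t%:C * ei x) * ei x) * sin x)).
  by apply: (circ_line openCT (holC1_Re (- 'i%C) FF) ltr01 c0 ei_cont cs).
have dP (t : R) : is_derive t 1 (fun t => P1 t + P2 t) (Q t).
  have := is_deriveD (d1 t) (d2 t); apply: is_derive_ext => //.
  rewrite -circD.
  - apply: eq_circ => x; rewrite cos_ei sin_ei -[RHS]mulr1 -[X in _ = _ * X](ei_sq x).
    by rewrite !ReImE /=; ring.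
  - move=> x; apply: cvgM; last exact: cc.
    by apply: cvg_Re; apply: cvg_mulc; [exact: cFe'|exact: ei_cont].
  - move=> x; apply: cvgM; last exact: cs.
    apply: cvg_Re; apply: cvg_mulc; last exact: ei_cont.
    by apply: cvg_scalec; exact: cFe'.
have Pt (t : R) : P1 t + P2 t = t * Q t.
  apply/esym/eqP; rewrite -subr_eq0.
  pose K x := Im (F (0 + t%:C * ei x) * conjc (ei x)).
  have k2 : continuous (fun x => Re (F' (0 + t%:C * ei x))) by move=> x; apply: cvg_Re; exact: cFe'.
  have k3 : continuous (fun x => Re (F (0 + t%:C * ei x)) * cos x).
    by move=> x; apply: cvgM; [apply: cvg_Re; exact: cFe|exact: cc].
  have k4 : continuous (fun x => Re (- 'i%C * F (0 + t%:C * ei x)) * sin x).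
    by move=> x; apply: cvgM; [apply: cvg_Re; apply: cvg_scalec; exact: cFe|exact: cs].
  have k1 : continuous (fun x => t * Re (F' (0 + t%:C * ei x))).
    by move=> x; apply: cvgM; [exact: cvg_cst|exact: k2].
  have k5 : continuous (fun x => Re (F (0 + t%:C * ei x)) * cos x + Re (- 'i%C * F (0 + t%:C * ei x)) * sin x).
    by move=> x; apply: cvgD; [exact: k3|exact: k4].
  rewrite /P1 /P2 /Q -circZ// -circD// -circB//.
  apply/eqP; transitivity (K (2 * pi) - K 0); last by rewrite /K ei_2pi subrr.
  apply: circ_FTC.
    by move=> x; apply: cvgB; [exact: k1|exact: k5].
  move=> x.
  have dF := holC1_chain openCT FF I (cderiveD (cderive_cst 0 x) (cderiveZ t%:C (cderive_ei x))).
  have dJ : cderive (fun y => conjc (ei y)) x (conjc ('i%C * ei x)).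
    have [a b] := cderive_ei x; split; first by apply: is_derive_ext a => [y|]; rewrite ReImE.
    by have := is_deriveN b; apply: is_derive_ext => [y|]; rewrite [RHS]ReImE.
  have [_] := cderiveM dF dJ; apply: is_derive_ext => //.
  rewrite cos_ei sin_ei; have := ei_sq x.
  rewrite add0r mulrCA.
  move: (F' _) (F _) => q f; move: (ei x) => e E; rewrite !ReImE /=.
  have -> : t * Re q = t * Re q * (Re e * Re e + Im e * Im e) by rewrite E mulr1.
  by ring.
have H1 : P1 1 + P2 1 = circ (fun x => Re (F (ei x) * conjc (ei x))).
  rewrite /P1 /P2 -circD.
  - apply: eq_circ => x; rewrite add0r mul1r cos_ei sin_ei.
    by rewrite !ReImE /=; ring.
  - by move=> x; apply: cvgM; [apply: cvg_Re; exact: cFe|exact: cc].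
  - by move=> x; apply: cvgM; [apply: cvg_Re; apply: cvg_scalec; exact: cFe|exact: cs].
rewrite -H1.
have H0 : Q 0 = Re (F' 0) * (2 * pi).
  rewrite /Q -circ_cst; apply: eq_circ => x.
  by rewrite mul0r addr0.
rewrite -H0.
pose Psi t := P1 t + P2 t.
have Pc (t : R) : 0 < t -> t <= 1 -> Psi t = t * Psi 1.
  move=> t0 t1.
  have dG (s : R) : 0 < s -> is_derive s 1 (fun s => Psi s / s) 0.
    move=> s0; have sn : s != 0 by rewrite gt_eqF.
    have dV := @is_deriveV _ id s _ 1 sn (is_derive_id s (1:R)).
    have := is_deriveM (dP s) dV; apply: is_derive_ext => //.
    by rewrite Pt /GRing.scale /=; field.
  have [c _ E] : exists2 c, c \in `[t, 1] & Psi 1 / 1 - Psi t / t = 0 * (1 - t).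
    apply: (MVT_segment (f := fun s => Psi s / s) (df := fun=> 0)) => //.
      by move=> x; rewrite in_itv /= => /andP[x0 _]; apply: dG; exact: lt_trans x0.
    apply: continuous_in_subspaceT => x; rewrite inE /= in_itv /= => /andP[x0 _].
    by apply: is_derive_cont (dG _ _); exact: lt_le_trans x0.
  move: E; rewrite mul0r divr1 => /eqP; rewrite subr_eq0 => /eqP ->.
  by rewrite mulrC divfK// gt_eqF.
rewrite -/(Psi 1); apply/eqP; rewrite -subr_eq0 -normr_eq0 eq_le normr_ge0 andbT.
apply/ler_addgt0Pr => e e0; rewrite add0r.
have [d d0 Hd] := (is_derive_epsP _ _ _).1 (dP 0) _ e0.
pose h := Num.min (d / 2) 1.
have h0 : 0 < h by rewrite lt_min ltr01 andbT divr_gt0.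
have hd : `|h| < d.
  by rewrite ger0_norm ?ltW// /h gt_min ltr_pdivrMr// ltr_pMr// ltr1n.
have := Hd h hd; rewrite add0r -/(Psi h) Pc//; last by rewrite ge_min lexx orbT.
have -> : P1 0 + P2 0 = 0 by rewrite Pt mul0r.
have -> : h * Psi 1 - 0 - Q 0 * h = (Psi 1 - Q 0) * h by ring.
by rewrite normrM ler_pM2r// normr_gt0 gt_eqF.
Qed.

(** The second derivative, as given by differentiating under the integral sign
    Cauchy's formula for the first one on the unit circle centred at [z]. *)
Definition deriv2 (F' : C -> C) (z : C) : C :=
  ((2 * pi)^-1)%:C * (circ (fun x => Re (F' (z + ei x) * conjc (ei x))) +i*
   circ (fun x => Im (F' (z + ei x) * conjc (ei x)))).

Lemma holC1_deriv (F F' : C -> C) : holC1 setT F F' -> holC1 setT F' (deriv2 F').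
Proof.
move=> FF; have tp := gt_eqF (@twopi_gt0 R).
have cF := holC1_contT FF.
have cF' z : F' w @[w --> z] --> F' z by exact: (FF z I).2.
have cc : continuous (@cos R) by exact: continuous_cos.
have cs : continuous (@sin R) by exact: continuous_sin.
have c1 (z : C) : forall x : R, z + ei y @[y --> x] --> z + ei x.
  by move=> x; apply: cvg_addc; [exact: cvg_cst|exact: ei_cont].
have cFe' (z : C) : forall x : R, F' (z + ei y) @[y --> x] --> F' (z + ei x).
  by move=> x; exact: (cvg_comp _ _ (c1 z x) (cF' _)).
have cFe (z : C) : forall x : R, F (z + ei y) @[y --> x] --> F (z + ei x).
  by move=> x; exact: (cvg_comp _ _ (c1 z x) (cF _)).
have ckJ (k : C -> C) (ck : forall z x, k (z + ei y) @[y --> x] --> k (z + ei x)) z x :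
    k (z + ei y) * conjc (ei y) @[y --> x] --> k (z + ei x) * conjc (ei x).
  by apply: cvg_mulc; [exact: ck|apply: cvg_conjc; exact: ei_cont].
have repr (c z : C) : Re (c * F' z) = (2 * pi)^-1 *
   circ (fun x => Re (c * F (z + ei x) * conjc (ei x))).
  have := circ_cauchy (holC1Z c (holC1_affine (a := z) (b := 1) FF)).
  rewrite mulr0 addr0 mul1r => E.
  have -> : circ (fun x => Re (c * F (z + ei x) * conjc (ei x))) = Re (c * F' z) * (2 * pi).
    by rewrite -E; apply: eq_circ => x; rewrite mul1r.
  by rewrite mulrCA mulVf ?tp// mulr1.
have der (c z v : C) : is_derive (0:R) 1 (fun t => Re (c * F' (z + t%:C * v))) (Re (c * (deriv2 F' z * v))).
  pose a x := z + ei x.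
  have cv : forall x : R, (fun=> v) y @[y --> x] --> v by move=> x; exact: cvg_cst.
  have d1 : is_derive (0:R) 1 (fun t : R => circ (fun x => Re (c * F (a x + t%:C * v)) * cos x))
     (circ (fun x => Re (c * F' (a x + 0%:C * v) * v) * cos x)).
    exact: (circ_line openCT (holC1_Re c FF) ltr01 (c1 z) cv cc).
  have d2 : is_derive (0:R) 1 (fun t : R => circ (fun x => Re (- 'i%C * c * F (a x + t%:C * v)) * sin x))
     (circ (fun x => Re (- 'i%C * c * F' (a x + 0%:C * v) * v) * sin x)).
    exact: (circ_line openCT (holC1_Re (- 'i%C * c) FF) ltr01 (c1 z) cv cs).
  have d3 := is_deriveM (is_derive_cst (2 * pi)^-1 (0:R) 1) (is_deriveD d1 d2).
  apply: is_derive_ext d3 => [t|].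
    rewrite repr /=; congr (_ * _); rewrite -[LHS]/(_ + _) -circD.
    - apply: eq_circ => x; rewrite /a cos_ei sin_ei addrAC !ReImE /=; ring.
    - move=> x; apply: cvgM; last exact: cc.
      apply: cvg_Re; apply: cvg_scalec; rewrite /a addrAC.
      by under eq_fun do rewrite addrAC; exact: cFe.
    - move=> x; apply: cvgM; last exact: cs.
      apply: cvg_Re; apply: cvg_scalec; rewrite /a addrAC.
      by under eq_fun do rewrite addrAC; exact: cFe.
  rewrite /GRing.scale /= mulr0 addr0.
  have -> : circ (fun x => Re (c * F' (a x + 0%:C * v) * v) * cos x) + circ (fun x => Re (- 'i%C * c * F' (a x + 0%:C * v) * v) * sin x)
    = circ (fun x => Re (c * v * (F' (z + ei x) * conjc (ei x)))).
    rewrite -circD.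
    - by apply: eq_circ => x; rewrite /a mul0r addr0 cos_ei sin_ei !ReImE /=; ring.
    - move=> x; apply: cvgM; last exact: cc.
      apply: cvg_Re; apply: cvg_mulc; last exact: cvg_cst.
      by apply: cvg_scalec; rewrite /a mul0r addr0; under eq_fun do rewrite addr0; exact: cFe'.
    - move=> x; apply: cvgM; last exact: cs.
      apply: cvg_Re; apply: cvg_mulc; last exact: cvg_cst.
      by apply: cvg_scalec; rewrite /a mul0r addr0; under eq_fun do rewrite addr0; exact: cFe'.
  set k := fun x => F' (z + ei x) * conjc (ei x).
  have ck1 : continuous (fun x => Re (k x)) by move=> x; apply: cvg_Re; exact: (ckJ F' cFe').
  have ck2 : continuous (fun x => Im (k x)) by move=> x; apply: cvg_Im; exact: (ckJ F' cFe').
  have -> : circ (fun x => Re (c * v * k x)) =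
      Re (c * v) * circ (fun x => Re (k x)) - Im (c * v) * circ (fun x => Im (k x)).
    rewrite -!circZ// -circB.
    - by apply: eq_circ => x; rewrite cReM.
    - by move=> x; apply: cvgM; [exact: cvg_cst|exact: ck1].
    - by move=> x; apply: cvgM; [exact: cvg_cst|exact: ck2].
  by rewrite /deriv2 -/k !ReImE /=; ring.
move=> z _; split.
  move=> v; split.
    have := der 1 z v; apply: is_derive_ext => [t|]; by rewrite mul1r.
  have := der (- 'i%C) z v; apply: is_derive_ext => [t|]; by rewrite !ReImE /=; ring.
have jc x : F' (q.1 + ei q.2) * conjc (ei q.2) @[q --> (z, x)] --> F' (z + ei x) * conjc (ei x).
  have x1 : (fun q : C * R => q.2) @ (z, x) --> x by exact: cvg_snd.
  have z1 : (fun q : C * R => q.1) @ (z, x) --> z by exact: cvg_fst.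
  have e1 : (fun q : C * R => ei q.2) @ (z, x) --> ei x by exact: (cvg_comp _ _ x1 (@ei_cont R x)).
  apply: cvg_mulc; last by apply: cvg_conjc; exact: e1.
  have g : (fun q : C * R => q.1 + ei q.2) @ (z, x) --> z + ei x by apply: cvg_addc; [exact: z1|exact: e1].
  exact: (cvg_comp _ _ g (cF' _)).
apply: cvg_scalec; apply: cvg_cplx.
  apply: (@circ_cvg _ C (fun w x => Re (F' (w + ei x) * conjc (ei x))) z).
    by move=> w x; apply: cvg_Re; exact: (ckJ F' cFe').
  by move=> x; apply: cvg_Re; exact: jc.
apply: (@circ_cvg _ C (fun w x => Im (F' (w + ei x) * conjc (ei x))) z).
  by move=> w x; apply: cvg_Im; exact: (ckJ F' cFe').
by move=> x; apply: cvg_Im; exact: jc.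
Qed.

End Closure.

(** * The gradient and Poisson formulas *)

Section Poisson.
Context {R : realType}.
Local Notation C := R[i].
Local Notation Re := (@complex.Re R).
Local Notation Im := (@complex.Im R).
Context (u : C -> R) (h h' : C -> C).
Context (uh : gradC1 setT u h).
Context (hh : holC1 setT h h').

Let cu z : u w @[w --> z] --> u z. Proof. exact: gradC1_cont openCT uh I. Qed.
Let ch z : h w @[w --> z] --> h z. Proof. exact: holC1_contT hh z. Qed.
Let c0 : forall x : R, (fun=> (0:C)) y @[y --> x] --> (0:C).
Proof. by move=> x; exact: cvg_cst. Qed.

Lemma const_of_derive0 (f : R -> R) (c : R) :
  (forall t : R, is_derive t 1 f c) -> f 1 = f 0 + c.
Proof.
move=> df.
have dg (t : R) : is_derive t 1 (fun t => f t - c * t) 0.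
  have := is_deriveB (df t) (is_deriveM (is_derive_cst c t 1) (is_derive_id t (1:R))).
  by apply: is_derive_ext => //; rewrite /GRing.scale /= mulr1 mulr0 addr0 subrr.
have := is_derive_0_is_cst 1 0 dg; rewrite mulr1 mulr0 subr0 => /eqP.
by rewrite subr_eq => /eqP.
Qed.

(** The integral of [u (t * e^(ix))] against the real part of [e * e^(-ix)] has for
    derivative in [t] a mean of two terms, by the formula for a product of real
    parts.  The first one is the mean of a multiple of [h], the second one the mean of a
    holomorphic function that vanishes at the origin. *)
Lemma circ_gradient (e : C) :
  circ (fun x => u (ei x) * Re (e * conjc (ei x))) = Re (e * h 0) * pi.
Proof.
pose p x := Re (e * conjc (ei x)).
have cp : continuous p.
  by move=> x; apply: cvg_Re; apply: cvg_scalec; apply: cvg_conjc; exact: ei_cont.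
have p0 : circ p = 0.
  have := circ_mean_entire (holC1Z (conjc e) (@holC1_id R setT)).
  rewrite /= mulr0 mul0r => <-; apply: eq_circ => x.
  by rewrite /p !ReImE; ring.
pose Phi (t : R) := circ (fun x => u (0 + t%:C * ei x) * p x).
have d (t : R) : is_derive t 1 Phi (Re (e * h 0) * pi).
  have := circ_line (t0 := t) openCT uh ltr01 c0 (@ei_cont R) cp (fun _ _ _ => I).
  apply: is_derive_ext => //.
  have hcirc := holC1_affine (a := 0) (b := t%:C) hh.
  have m1 := circ_mean_entire (holC1Z e hcirc).
  have m2 := circ_mean_entire (holC1Z (conjc e) (holC1M openCT (holC1M openCT (@holC1_id R setT) (@holC1_id R setT)) hcirc)).
  rewrite /= mulr0 addr0 in m1; rewrite /= !(mulr0, mul0r) in m2.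
  have ce : forall x : R, h (0 + t%:C * ei y) @[y --> x] --> h (0 + t%:C * ei x).
    exact: ei_comp_cont ch.
  have k1 : continuous (fun x => Re (e * h (0 + t%:C * ei x))).
    by move=> x; apply: cvg_Re; apply: cvg_scalec; exact: ce.
  have k2 : continuous (fun x => Re (conjc e * (ei x * ei x * h (0 + t%:C * ei x)))).
    move=> x; apply: cvg_Re; apply: cvg_scalec; apply: cvg_mulc; last exact: ce.
    by apply: cvg_mulc; exact: ei_cont.
  have -> : circ (fun x => Re (h (0 + t%:C * ei x) * ei x) * p x) =
     circ (fun x => 2^-1 * (Re (e * h (0 + t%:C * ei x)) + Re (conjc e * (ei x * ei x * h (0 + t%:C * ei x))))).
    apply: eq_circ => x; rewrite /p.
    have := ei_sq x; move: (h _) => q; move: (ei x) => z E.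
    rewrite !ReImE.
    have -> : Re e * Re q - Im e * Im q = (Re e * Re q - Im e * Im q) * (Re z * Re z + Im z * Im z) by rewrite E mulr1.
    by field.
  rewrite circZ; last by move=> x; apply: cvgD; [exact: k1|exact: k2].
  rewrite circD// m1 m2 addr0.
  by field.
have := const_of_derive0 d; rewrite /Phi.
have -> : circ (fun x => u (0 + 0%:C * ei x) * p x) = u 0 * circ p.
  rewrite -circZ//; apply: eq_circ => x.
  by rewrite mul0r addr0.
rewrite p0 mulr0 add0r => <-; apply: eq_circ => x.
by rewrite add0r mul1r.
Qed.

Definition poisson (z : C) (x : R) : R := (1 - cmod z ^+ 2) / cmod (ei x - z) ^+ 2.

Section PoissonPoint.
Context (z : C).
Context (z1 : cmod z < 1).

(* a radius above 1 for which [1 - conjc z * w] has no zero of modulus less than [rho] *)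
Let rho := 2 / (1 + cmod z).
Let zp : 0 < 1 + cmod z. Proof. by rewrite ltr_wpDr// cmod_ge0. Qed.
Let rho1 : 1 < rho.
Proof. by rewrite ltr_pdivlMr// mul1r -[2]/(1 + 1) ltrD2l. Qed.
Let den_neq0 w : cmod w < rho -> 1 - conjc z * w != 0.
Proof.
move=> wr; rewrite subr_eq0 eq_sym; apply/eqP => E.
have : cmod (conjc z * w) = 1 by rewrite E cmod1.
rewrite cmodM cmodJ => E'.
have : cmod z * cmod w <= cmod z * rho by rewrite ler_wpM2l ?cmod_ge0// ltW.
rewrite E' mulrA ler_pdivlMr// mul1r mulr_natr mulr2n lerD2r.
by rewrite leNgt z1.
Qed.

Let ei_z x : ei x - z != 0.
Proof.
rewrite subr_eq0; apply/eqP => E; move: z1.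
by rewrite -E cmod_ei ltxx.
Qed.

Let inv_holC1 : holC1 [set w | cmod w < rho] (fun w => (1 - conjc z * w)^-1)
  (fun w => - (0 + - conjc z * 1) / (1 - conjc z * w) ^+ 2).
Proof.
apply: holC1V; [exact: disc_open| |exact: den_neq0].
have X := holC1D (@holC1_cst R [set w | cmod w < rho] 1) (holC1Z (- conjc z) (@holC1_id R _)).
by apply: (holC1_ext X) => w //=; rewrite mulNr.
Qed.

(** This is what makes the derivative in [poisson_formula] the mean of a
    holomorphic function of the point of the circle. *)
Lemma poisson_kernelE x :
  (poisson z x)%:C * (ei x - z) = (1 - cmod z ^+ 2)%:C * (ei x * (1 - conjc z * ei x)^-1).
Proof.
have e1 : 1 - conjc z * ei x = ei x * conjc (ei x - z).
  by rewrite [conjc (_ - _)]rmorphB mulrBr ei_J [conjc z * _]mulrC.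
have n2 : conjc (ei x - z) != 0 by rewrite conjc_eq0.
rewrite e1 /poisson rmorphM fmorphV /= -mulJ.
have := ei_neq0 x; move: n2 (ei_z x); move: (ei x) (ei x - z) (conjc (ei x - z)) => c b a a0 b0 c0'.
by field; rewrite a0 b0 c0'.
Qed.

Lemma poisson_ge0 x : 0 <= poisson z x.
Proof.
apply: divr_ge0; last by rewrite sqr_ge0.
by rewrite subr_ge0 -(expr1n _ 2) ler_pXn2r ?nnegrE ?cmod_ge0// ltW.
Qed.

Lemma poisson_cont : continuous (poisson z).
Proof.
move=> x; apply: cvgM; first exact: cvg_cst.
apply: cvgV; first by rewrite expf_neq0// cmod_eq0.
have c : cmod (ei y - z) @[y --> x] --> cmod (ei x - z).
  by apply: cvg_cmod; apply: cvg_addc; [exact: ei_cont|exact: cvg_cst].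
by apply: (cvgM c c).
Qed.

Lemma circ_poisson : circ (poisson z) = 2 * pi.
Proof.
have := circ_mean rho1 inv_holC1; rewrite mulr0 subr0 invr1 mul1r => m.
have k1 : continuous (fun x => Re (1 - conjc z * ei x)^-1).
  move=> x; apply: cvg_Re; apply: cvg_invc; first by rewrite den_neq0// cmod_ei.
  by apply: cvg_addc; [exact: cvg_cst|apply: cvg_oppc; apply: cvg_scalec; exact: ei_cont].
have -> : circ (poisson z) = circ (fun x => 2 * Re (1 - conjc z * ei x)^-1 - 1).
  apply: eq_circ => x; rewrite /poisson.
  have dn : cmod (ei x - z) ^+ 2 = Re (1 - conjc z * ei x) ^+ 2 + Im (1 - conjc z * ei x) ^+ 2.
    rewrite -cmod_sq; congr (_ ^+ 2).
    have -> : 1 - conjc z * ei x = ei x * conjc (ei x - z).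
      by rewrite [conjc (_ - _)]rmorphB mulrBr ei_J [conjc z * _]mulrC.
    by rewrite cmodM cmod_ei cmodJ mul1r.
  have VE w : Re w^-1 = Re w / (Re w ^+ 2 + Im w ^+ 2) by case: w.
  rewrite VE -dn.
  have n0 : cmod (ei x - z) ^+ 2 != 0 by rewrite expf_neq0// cmod_eq0.
  apply: (mulIf n0); rewrite divfK// mulrBl mulrA divfK// mul1r.
  rewrite (cmod_sq z) (cmod_sq (ei x - z)); have := ei_sq x.
  by move: (ei x) => e; rewrite !ReImE /=; lra.
rewrite circB; first last.
- by move=> x; exact: cvg_cst.
- by move=> x; apply: cvgM; [exact: cvg_cst|exact: k1].
rewrite circZ// m circ_cst; ring.
Qed.

(** The integral of [u (z + t * (e^(ix) - z))] against the kernel does not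
    depend on [t].  By [poisson_kernelE] its derivative is the mean over the circle
    of a function that is holomorphic beyond the closed disc, up to the radius
    [rho], and vanishes at the origin. *)
Lemma poisson_formula : circ (fun x => u (ei x) * poisson z x) = u z * (2 * pi).
Proof.
pose Phi (t : R) := circ (fun x => u (z + t%:C * (ei x - z)) * poisson z x).
have cz : forall x : R, (fun=> z) y @[y --> x] --> z by move=> x; exact: cvg_cst.
have cb : forall x : R, ei y - z @[y --> x] --> ei x - z.
  by move=> x; apply: cvg_addc; [exact: ei_cont|exact: cvg_cst].
have d (t : R) : is_derive t 1 Phi 0.
  have := circ_line (t0 := t) openCT uh ltr01 cz cb poisson_cont (fun _ _ _ => I).
  apply: is_derive_ext => //.
  have hz := holC1_affine (a := z - t%:C * z) (b := t%:C) hh.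
  have G := holC1Z (1 - cmod z ^+ 2)%:C (holC1M (@disc_open R rho) (holC1M (@disc_open R rho) (@holC1_id R _) inv_holC1)
     (holC1_sub (fun _ _ => I) hz)).
  have := circ_mean rho1 G; rewrite /= mul0r mul0r mulr0 mul0r => <-.
  apply: eq_circ => x.
  have E : z + t%:C * (ei x - z) = z - t%:C * z + t%:C * ei x by ring.
  rewrite E mulrA -poisson_kernelE.
  move: (h _) (ei x - z) (poisson z x) => q b p; rewrite !ReImE /=; ring.
have := const_of_derive0 d; rewrite addr0 /Phi.
have -> : circ (fun x => u (z + 0%:C * (ei x - z)) * poisson z x) = u z * (2 * pi).
  rewrite -circ_poisson -circZ; last exact: poisson_cont.
  by apply: eq_circ => x; rewrite mul0r addr0.
move=> <-; apply: eq_circ => x.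
by rewrite mul1r addrC subrK.
Qed.

Lemma poisson_le3 x : cmod z <= 1 / 2 -> poisson z x <= 3.
Proof.
move=> z2; rewrite ler_pdivrMr; last by rewrite exprn_gt0// cmod_gt0.
have ge : 1 - cmod z <= cmod (ei x - z) by rewrite -(cmod_ei x) cmodB_ge.
have z0 := cmod_ge0 z.
apply: (@le_trans _ _ (3 * (1 - cmod z) ^+ 2)); last first.
  by rewrite ler_pM2l// ler_pXn2r ?nnegrE ?cmod_ge0// subr_ge0 ltW.
by nra.
Qed.

End PoissonPoint.

End Poisson.

(** * Growth of harmonic and of entire functions *)

Section Growth.
Context {R : realType}.
Local Notation C := R[i].
Local Notation Re := (@complex.Re R).
Local Notation Im := (@complex.Im R).

Lemma poisson0 (x : R) : poisson (0 : C) x = 1.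
Proof. by rewrite /poisson subr0 cmod_ei cmod0 expr0n subr0 expr1n divr1. Qed.

Lemma circ_mean_at (u : C -> R) (h h' : C -> C) (c : C) (r : R) :
  gradC1 setT u h -> holC1 setT h h' ->
  circ (fun x => u (c + r%:C * ei x)) = u c * (2 * pi).
Proof.
move=> uh hh.
have z1 : cmod (0 : C) < 1 by rewrite cmod0.
have := poisson_formula (gradC1_affine c r uh) (holC1Z r%:C (holC1_affine (a := c) (b := r%:C) hh)) z1.
by rewrite mulr0 addr0 => <-; apply: eq_circ => x; rewrite poisson0 mulr1.
Qed.

Lemma max0_cont (k : R -> R) : continuous k -> continuous (fun x => Num.max (k x) 0).
Proof.
move=> ck.
have -> : (fun x => Num.max (k x) 0) = (fun x => (k x + `|k x|) / 2).
  by apply/funext => y; rewrite maxr_absE subr0 addr0.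
move=> x; apply: cvgM; last exact: cvg_cst.
by apply: cvgD; [exact: ck|apply: cvg_norm; exact: ck].
Qed.

(** The Poisson kernel is positive and at most 3 on the disc of half the radius. *)
Lemma le_circ_pos (u : C -> R) (h h' : C -> C) (c w : C) (r : R) :
  gradC1 setT u h -> holC1 setT h h' -> 0 < r -> cmod (w - c) <= r / 2 ->
  u w * (2 * pi) <= 3 * circ (fun x => Num.max (u (c + r%:C * ei x)) 0).
Proof.
move=> uh hh r0 wc.
have cu z : u w @[w --> z] --> u z by exact: gradC1_cont openCT uh I.
pose z := r^-1%:C * (w - c).
have zE : c + r%:C * z = w.
  by rewrite /z mulrA -rmorphM mulfV ?gt_eqF// mul1r addrC subrK.
have z2 : cmod z <= 1 / 2.
  rewrite /z cmodM cmod_real gtr0_norm ?invr_gt0//.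
  by rewrite ler_pdivrMl// mulrA mulr1.
have z1 : cmod z < 1 by apply: le_lt_trans z2 _; rewrite ltr_pdivrMr// mul1r ltr1n.
have := poisson_formula (gradC1_affine c r uh) (holC1Z r%:C (holC1_affine (a := c) (b := r%:C) hh)) z1.
rewrite zE => <-.
have k : continuous (fun x => u (c + r%:C * ei x)) by exact: ei_comp_contR cu.
have km := max0_cont k.
rewrite -circZ//; apply: le_circ.
- by move=> x; apply: cvgM; [exact: k|exact: poisson_cont].
- by move=> x; apply: cvgM; [exact: cvg_cst|exact: km].
move=> x _; rewrite mulrC.
apply: (@le_trans _ _ (poisson z x * Num.max (u (c + r%:C * ei x)) 0)).
  by rewrite ler_wpM2l ?poisson_ge0// le_max lexx.
by rewrite ler_wpM2r ?poisson_le3// le_max lexx orbT.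
Qed.

Lemma gradC1_sub_from (u : C -> R) (h : C -> C) (M : R) : gradC1 setT u h ->
  gradC1 setT (fun z => M - u z) (fun z => -1 * h z).
Proof.
move=> uh z _; have [H c] := uh z I; split; last by apply: cvg_scalec.
move=> v; have := is_deriveB (is_derive_cst M (0:R) 1) (H v).
by apply: is_derive_ext => //; rewrite sub0r mulN1r mulNr cReN.
Qed.

(** Poisson's formula for the nonnegative function [M - u]. *)
Lemma harnack (u : C -> R) (h h' : C -> C) (M rho : R) (w : C) :
  gradC1 setT u h -> holC1 setT h h' -> 0 < rho ->
  (forall w, cmod w <= rho -> u w <= M) -> cmod w <= rho / 2 ->
  M - u w <= 3 * (M - u 0).
Proof.
move=> uh hh rho0 uM wr.
have vh := gradC1_sub_from M uh; have vhh := holC1Z (-1) hh.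
rewrite -(ler_pM2r (@twopi_gt0 R)) -mulrA.
have wr' : cmod (w - 0) <= rho / 2 by rewrite subr0.
apply: le_trans (le_circ_pos vh vhh rho0 wr') _.
rewrite -(circ_mean_at 0 rho vh vhh) le_eqVlt; apply/orP; left; apply/eqP.
congr (_ * _); apply: eq_circ => x; apply/max_idPl.
by rewrite subr_ge0 uM// add0r cmodM cmod_ei cmod_real mulr1 gtr0_norm.
Qed.

Lemma gradient_bound (u : C -> R) (h h' : C -> C) (z : C) (r B : R) :
  gradC1 setT u h -> holC1 setT h h' -> 0 < r ->
  (forall w, cmod (w - z) <= r -> `|u w| <= B) -> cmod (h z) * r <= 2 * B.
Proof.
move=> uh hh r0 uB.
have cu x : u w @[w --> x] --> u x by exact: gradC1_cont openCT uh I.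
have [e e1 eh] := rotate_cmod (h z).
have := circ_gradient (gradC1_affine z r uh) (holC1Z r%:C (holC1_affine (a := z) (b := r%:C) hh)) e.
rewrite mulr0 addr0.
have -> : Re (e * (r%:C * h z)) = cmod (h z) * r.
  by rewrite mulrCA eh -rmorphM /= mulrC.
move=> E; rewrite -(ler_pM2r (@pi_gt0 R)) -E.
have -> : 2 * B * pi = circ (fun=> B) by rewrite circ_cst; ring.
apply: le_trans (ler_norm _) _; apply: circ_norm_le.
- move=> x; apply: cvgM; first exact: (ei_comp_contR (a := z) (b := r%:C) cu).
  by apply: cvg_Re; apply: cvg_scalec; apply: cvg_conjc; exact: ei_cont.
- by move=> x; exact: cvg_cst.
move=> x _; rewrite normrM -[B]mulr1; apply: ler_pM => //.
  by apply: uB; rewrite addrC addKr cmodM cmod_ei cmod_real mulr1 gtr0_norm.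
by apply: le_trans (normRe_le _) _; rewrite cmodM cmodJ cmod_ei e1 mulr1.
Qed.

(** On the circle that is available, only the positive part of [u] is controlled,
    and the circle is centred near the origin but not at it.  Poisson's formula bounds [u] from
    above on a disc centred at the origin, Harnack's inequality there bounds it
    from below in terms of [u 0], and the gradient formula then bounds [h]. *)
Lemma off_centre_bound (u : C -> R) (h h' : C -> C) (c z : C) (r r' : R) :
  gradC1 setT u h -> holC1 setT h h' -> 0 < r -> cmod c <= r / 8 -> r / 2 <= r' ->
  cmod z <= r / 32 ->
  cmod (h z) * (r / 32) <=
    2 * (6 * (circ (fun x => Num.max (u (c + r'%:C * ei x)) 0) / (2 * pi)) + 3 * `|u 0|).
Proof.
move=> uh hh r0 cr rr' zr.
set N := circ _ / _.
have r'0 : 0 < r' by apply: lt_le_trans rr'; rewrite divr_gt0.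
have up w : cmod w <= r / 8 -> u w <= 3 * N.
  move=> wr; rewrite /N mulrA ler_pdivlMr ?twopi_gt0//.
  apply: le_circ_pos uh hh r'0 _; apply: le_trans (cmodB _ _) _.
  by lra.
have r8 : 0 < r / 8 by rewrite divr_gt0.
have lo w : cmod w <= r / 16 -> `|u w| <= 6 * N + 3 * `|u 0|.
  move=> wr.
  have H1 : u w <= 3 * N by apply: up; lra.
  have H2 : 3 * N - u w <= 3 * (3 * N - u 0).
    by apply: harnack uh hh r8 up _; lra.
  have N0 : 0 <= N.
    apply: divr_ge0; last exact: ltW twopi_gt0.
    by apply: Rintegral_ge0 => x _; rewrite le_max lexx orbT.
  have := ler_norm (u 0); have := ler_norm (- u 0); rewrite normrN => n1 n2.
  by rewrite ler_norml; apply/andP; split; lra.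
apply: (gradient_bound uh hh); first by rewrite divr_gt0.
move=> w wz; apply: lo; rewrite -(subrK z w).
by apply: le_trans (cmodD _ _) _; lra.
Qed.

Lemma holC1_lineD (F F' : C -> C) (z v : C) (t : R) : holC1 setT F F' ->
  cderive (fun t => F (z + t%:C * v)) t (F' (z + t%:C * v) * v).
Proof. by move=> FF; exact: holC1_chain openCT FF I (cderive_line z v t). Qed.

Lemma holC1_mean_le (F F' : C -> C) (z : C) (M : R) : holC1 setT F F' ->
  (forall w, cmod w <= cmod z -> cmod (F' w) <= M) -> cmod (F z) <= cmod (F 0) + cmod z * M.
Proof.
move=> FF FM.
have E1 : F z = F (0 + 1%:C * z) by rewrite add0r mul1r.
have E0 : F 0 = F (0 + 0%:C * z) by rewrite mul0r addr0.
have H : cmod (F z - F 0) <= M * cmod z.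
  rewrite [in F z]E1 [in F 0]E0.
  apply: (@cderive_MVT R (fun t => F (0 + t%:C * z)) (fun t => F' (0 + t%:C * z) * z)).
    by move=> t _; exact: holC1_lineD.
  move=> t /andP[t0 t1]; rewrite cmodM ler_wpM2r ?cmod_ge0// FM//.
  by rewrite add0r cmodM cmod_real ger0_norm// ler_piMl ?cmod_ge0.
rewrite -[F z](subrK (F 0)); apply: le_trans (cmodD _ _) _.
by rewrite addrC lerD2l mulrC.
Qed.

Lemma cauchy_bound (F F' : C -> C) (z : C) (r B : R) : holC1 setT F F' -> 0 < r ->
  (forall w, cmod (w - z) <= r -> cmod (F w) <= B) -> cmod (F' z) * r <= 2 * B.
Proof.
move=> FF r0 FB; apply: (gradient_bound (holC1_real FF) (holC1_deriv FF) r0) => w wz.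
exact: le_trans (normRe_le _) (FB w wz).
Qed.

(** The constant [B] absorbs what happens on bounded sets, so that no radius needs
    to be mentioned. *)
Definition little_o_pow (d : nat) (F : C -> R) : Prop :=
  forall e : R, 0 < e -> exists B, forall z, F z <= e * (1 + cmod z) ^+ d + B.

(** Cauchy's estimate on circles of large radius shows that the derivative
    vanishes. *)
Lemma liouville (F F' : C -> C) : holC1 setT F F' ->
  little_o_pow 1 (fun z => cmod (F z)) -> forall z, F z = F 0.
Proof.
move=> FF Fo.
have F'0 z : F' z = 0.
  apply/eqP; rewrite -cmod_eq0 eq_le cmod_ge0 andbT.
  apply/ler_addgt0Pr => e e0; rewrite add0r.
  have e4 : 0 < e / 4 by rewrite divr_gt0.
  have [B HB] := Fo _ e4.
  pose K := 1 + cmod z.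
  (* large enough for the constant [B] of the hypothesis to contribute little *)
  pose r := 1 + K + 4 * `|B| / e.
  have K1 : 1 <= K by rewrite /K lerDl cmod_ge0.
  have e1 : 0 <= 4 * `|B| / e by rewrite divr_ge0 ?mulr_ge0// ltW.
  have r0 : 0 < r by rewrite /r; lra.
  rewrite -(ler_pM2r r0).
  apply: le_trans (cauchy_bound FF r0 (B := e / 4 * (K + r) + `|B|) _) _.
    move=> w wz; apply: le_trans (HB w) _; rewrite expr1.
    apply: lerD; last exact: ler_norm.
    rewrite ler_pM2l//; have := cmodD (w - z) z; rewrite subrK /K; lra.
  have E : e * r = e * (1 + K) + 4 * `|B| by rewrite /r; field; rewrite gt_eqF.
  have : e * 1 <= e * K by rewrite ler_pM2l.
  by nra.
have H := holC1_ext FF (fun=> erefl) F'0.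
move=> z.
have l t : cderive (fun t => F (0 + t%:C * z)) t 0.
  by apply: cderive_ext (holC1_lineD 0 z t H) => //; rewrite mul0r.
have := cderive_is_cst l 1 0; rewrite mul0r !add0r => <-.
by rewrite mul1r.
Qed.

(** By induction on [d]: Cauchy's estimate lowers the growth of the derivative by
    one power.  This says that [F] is a polynomial of degree at most [d], in the
    only form needed later. *)
Lemma growth_drop (d : nat) (F F' : C -> C) : holC1 setT F F' ->
  little_o_pow d.+1 (fun z => cmod (F z)) ->
  exists2 K, 0 <= K & forall z, cmod (F z) <= K * (1 + cmod z) ^+ d.
Proof.
elim: d F F' => [|d IH] F F' FF Fo.
  exists (cmod (F 0)); first exact: cmod_ge0.
  by move=> z; rewrite (liouville FF Fo) expr0 mulr1.
have Fo' : little_o_pow d.+1 (fun z => cmod (F' z)).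
  move=> e e0.
  have p0 : 0 < (2:R) ^+ d.+3 by rewrite exprn_gt0.
  have [B HB] := Fo (e / 2 ^+ d.+3) (divr_gt0 e0 p0).
  exists (2 * `|B|) => z.
  pose K := 1 + cmod z.
  have K1 : 1 <= K by rewrite /K lerDl cmod_ge0.
  have K0 : 0 < K by apply: lt_le_trans K1.
  have := cauchy_bound (z := z) FF K0 (B := e / 2 ^+ d.+3 * (2 * K) ^+ d.+2 + `|B|).
  rewrite -/K => H; rewrite -(ler_pM2r K0); apply: le_trans (H _) _.
    move=> w wz; apply: le_trans (HB w) _; apply: lerD; last exact: ler_norm.
    rewrite ler_pM2l ?divr_gt0// ler_pXn2r ?nnegrE ?addr_ge0 ?cmod_ge0//; last by rewrite mulr_ge0// ltW.
    rewrite -(subrK z w); have := cmodD (w - z) z; rewrite /K in wz *; lra.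
  have -> : e / 2 ^+ d.+3 * (2 * K) ^+ d.+2 = e * K ^+ d.+1 * K / 2.
    rewrite exprMn [2 ^+ d.+3]exprS [K ^+ d.+2]exprS.
    have q0 : (2:R) ^+ d.+2 != 0 by rewrite gt_eqF// exprn_gt0.
    by field.
  have : `|B| <= `|B| * K by rewrite ler_peMr.
  by lra.
have [K K0 HK] := IH _ _ (holC1_deriv FF) Fo'.
exists (cmod (F 0) + K); first by rewrite addr_ge0 ?cmod_ge0.
move=> z; apply: le_trans (holC1_mean_le FF (M := K * (1 + cmod z) ^+ d) _) _.
  move=> w wz; apply: le_trans (HK w) _; rewrite ler_wpM2l//.
  by rewrite lerXn2r ?nnegrE ?addr_ge0 ?cmod_ge0// lerD2l.
rewrite mulrDl lerD//.
  by rewrite ler_peMr ?cmod_ge0// exprn_ege1// lerDl cmod_ge0.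
rewrite mulrCA ler_wpM2l// exprS ler_wpM2r//.
  by rewrite exprn_ge0// addr_ge0 ?cmod_ge0.
by rewrite lerDr.
Qed.

(** Harnack's inequality bounds the real part from below as well, and then the
    gradient formula bounds the derivative. *)
Lemma little_o_of_Re (d : nat) (F F' : C -> C) : holC1 setT F F' ->
  little_o_pow d.+1 (fun z => Re (F z)) -> little_o_pow d.+1 (fun z => cmod (F z)).
Proof.
move=> FF Fo e e0.
have p0 : 0 < 4 * (5:R) ^+ d.+1 by rewrite mulr_gt0 ?exprn_gt0.
have [B HB] := Fo (e / (4 * 5 ^+ d.+1)) (divr_gt0 e0 p0).
pose B' := 4 * `|B| + 6 * `|Re (F 0)|.
have B'0 : 0 <= B' by rewrite /B' addr_ge0 ?mulr_ge0.
have dF z w : cmod w <= cmod z ->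
    cmod (F' w) * (1 + cmod z) <= e * (1 + cmod z) ^+ d.+1 + B'.
  move=> wz; pose K := 1 + cmod z.
  have K1 : 1 <= K by rewrite /K lerDl cmod_ge0.
  have K0 : 0 < K by apply: lt_le_trans K1.
  have r0 : 0 < 4 * K by rewrite mulr_gt0.
  pose M := e / 4 * K ^+ d.+1 + `|B|.
  have up x : cmod x <= 4 * K -> Re (F x) <= M.
    move=> xK; apply: le_trans (HB x) _; apply: lerD; last exact: ler_norm.
    have -> : e / 4 * K ^+ d.+1 = e / (4 * 5 ^+ d.+1) * (5 * K) ^+ d.+1.
      rewrite exprMn; have q0 : (5:R) ^+ d.+1 != 0 by rewrite gt_eqF// exprn_gt0.
      by field.
    rewrite ler_pM2l ?divr_gt0// lerXn2r ?nnegrE ?addr_ge0 ?cmod_ge0//.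
      by rewrite mulr_ge0// ltW.
    by lra.
  have M0 : 0 <= M by rewrite addr_ge0// mulr_ge0// ?exprn_ge0// ltW// divr_gt0.
  have lo x : cmod x <= 2 * K -> `|Re (F x)| <= 2 * M + 3 * `|Re (F 0)|.
    move=> xK.
    have H1 : Re (F x) <= M by apply: up; lra.
    have H2 : M - Re (F x) <= 3 * (M - Re (F 0)).
      by apply: harnack (holC1_real FF) (holC1_deriv FF) r0 up _; lra.
    have := ler_norm (Re (F 0)); have := ler_norm (- Re (F 0)); rewrite normrN => n1 n2.
    by rewrite ler_norml; apply/andP; split; lra.
  apply: le_trans (gradient_bound (z := w) (holC1_real FF) (holC1_deriv FF) K0 (B := 2 * M + 3 * `|Re (F 0)|) _) _.
    move=> x xw; apply: lo; rewrite -(subrK w x).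
    by apply: le_trans (cmodD _ _) _; rewrite /K in xw *; lra.
  by rewrite /M /B' -/K; lra.
exists (cmod (F 0) + B') => z.
set K := 1 + cmod z.
have K0 : 0 < K by rewrite /K ltr_wpDr// cmod_ge0.
have := holC1_mean_le (z := z) FF (M := (e * K ^+ d.+1 + B') / K).
move=> H; apply: le_trans (H _) _.
  by move=> w wz; rewrite ler_pdivlMr//; exact: dF.
have : cmod z * ((e * K ^+ d.+1 + B') / K) <= e * K ^+ d.+1 + B'.
  rewrite mulrCA -[leRHS]mulr1 ler_wpM2l//.
    by rewrite addr_ge0// mulr_ge0// ?exprn_ge0// ltW.
  by rewrite ler_pdivrMr// mul1r /K lerDr.
by lra.
Qed.

End Growth.

(** * The forms of the logarithm of the squared norm *)

Section LogTau.
Context {R : realType} {m : nat}.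
Local Notation C := R[i].
Local Notation V := 'rV[C]_m.
Local Notation Re := (@complex.Re R).
Local Notation Im := (@complex.Im R).
Implicit Types z v w : V.

Lemma Re_sum (I : Type) (r : seq I) (P : pred I) (F : I -> C) :
  Re (\sum_(i <- r | P i) F i) = \sum_(i <- r | P i) Re (F i).
Proof. exact: (big_morph Re (@cReD R) erefl). Qed.
Lemma Im_sum (I : Type) (r : seq I) (P : pred I) (F : I -> C) :
  Im (\sum_(i <- r | P i) F i) = \sum_(i <- r | P i) Im (F i).
Proof. exact: (big_morph Im (@cImD R) erefl). Qed.

(** The Hermitian product on the tangent space, antilinear in the first argument. *)
Definition hdot z v : C := \sum_(j < m) conjc (z 0 j) * v 0 j.

Lemma hdotDr z v w : hdot z (v + w) = hdot z v + hdot z w.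
Proof. by rewrite /hdot -big_split; apply: eq_bigr => j _; rewrite mxE mulrDr. Qed.
Lemma hdotDl z v w : hdot (z + v) w = hdot z w + hdot v w.
Proof. by rewrite /hdot -big_split; apply: eq_bigr => j _; rewrite mxE rmorphD mulrDl. Qed.
Lemma hdotZr (c : C) z v : hdot z (c *: v) = c * hdot z v.
Proof. by rewrite /hdot mulr_sumr; apply: eq_bigr => j _; rewrite mxE mulrCA. Qed.
Lemma hdotZl (c : C) z v : hdot (c *: z) v = conjc c * hdot z v.
Proof. by rewrite /hdot mulr_sumr; apply: eq_bigr => j _; rewrite mxE rmorphM mulrA. Qed.
Lemma hdotJ z v : conjc (hdot z v) = hdot v z.
Proof.
rewrite /hdot rmorph_sum; apply: eq_bigr => j _.
by rewrite rmorphM /= conjcK mulrC.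
Qed.
Lemma tauE z : (tau z)%:C = hdot z z.
Proof.
rewrite /tau /hdot rmorph_sum; apply: eq_bigr => j _.
by rewrite mulrC mulJ.
Qed.

Lemma hdot_delta z j : hdot z (delta_mx 0 j) = conjc (z 0 j).
Proof.
rewrite /hdot (bigD1 j)//= mxE !eqxx mulr1 big1 ?addr0// => k kj.
by rewrite mxE (negbTE kj) andbF mulr0.
Qed.

Lemma tau_line z v (t : R) : tau (z + t%:C *: v) = tau z + 2 * t * Re (hdot z v) + t ^+ 2 * tau v.
Proof.
apply: (@complexI R); rewrite tauE !hdotDr !hdotDl !hdotZr !hdotZl conjc_real.
rewrite expr2 !rmorphD !rmorphM /= !tauE -(hdotJ z v).
rewrite (_ : (2:R)%:C = 2); last by rewrite rmorph_nat.
rewrite ReJ_add; by field.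
Qed.

Lemma real_derivE (g : R -> C) x (l : C) : cderive g x l -> real_deriv g x = l.
Proof.
case=> a b; rewrite /real_deriv !derive1E (@derive_val _ _ _ _ _ _ _ a) (@derive_val _ _ _ _ _ _ _ b).
by case: l {a b}.
Qed.

Lemma tau_deriv z v : is_derive (0:R) 1 (fun t : R => tau (z + t%:C *: v)) (2 * Re (hdot z v)).
Proof.
have d := is_derive_id (0:R) (1:R).
have := is_deriveD (is_deriveD (is_derive_cst (tau z) (0:R) 1) (is_deriveZ (2 * Re (hdot z v)) d)) (is_deriveZ (tau v) (is_deriveM d d)).
apply: is_derive_ext => [t|]; last by rewrite /GRing.scale /=; ring.
by rewrite tau_line -[LHS]/(tau z + 2 * Re (hdot z v) * t + tau v * (t * t)); ring.
Qed.

Lemma tau_line0 z v : tau (z + (0:R)%:C *: v) = tau z.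
Proof. by rewrite scale0r addr0. Qed.

Lemma log_tau_deriv z v : 0 < tau z ->
  dir_deriv log_tau z v = (2 * Re (hdot z v) / tau z)%:C.
Proof.
move=> z0; apply: real_derivE; apply: cderive_real.
have z0' : 0 < tau (z + (0:R)%:C *: v) by rewrite tau_line0.
have := is_derive1_comp (is_derive1_ln z0') (tau_deriv z v).
by apply: is_derive_ext => //; rewrite tau_line0 mulrC.
Qed.

(** The Wirtinger derivatives of the logarithm of the squared norm are the
    conjugate coordinates and the coordinates of [z], divided by the squared norm. *)
Lemma dc_log_tau z v : 0 < tau z ->
  dc log_tau z v = (Im (hdot z v) / (2 * pi * tau z))%:C.
Proof.
move=> z0; rewrite /dc /del /delbar.
have t0 : (tau z)%:C != 0 by rewrite -[0]/(0%:C) (inj_eq (@complexI R)) gt_eqF.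
have i2 : 'i%C * 'i%C = -1 :> C by rewrite -expr2 sqr_i.
have two : (2:R)%:C = 2 by rewrite rmorph_nat.
have Rj j : Re (conjc (z 0 j)) = Re (z 0 j) by rewrite cReJ.
have Ij j : Re ('i%C * conjc (z 0 j)) = Im (z 0 j) by rewrite !ReImE /=; ring.
have W j : wirt j log_tau z = conjc (z 0 j) / (tau z)%:C.
  rewrite /wirt !log_tau_deriv// hdotZr hdot_delta Rj Ij.
  have -> : conjc (z 0 j) = (Re (z 0 j))%:C - 'i%C * (Im (z 0 j))%:C.
    by case: (z 0 j) => a b; apply/eqP; rewrite eq_complex /=; apply/andP; split; apply/eqP; ring.
  rewrite !rmorphM !fmorphV /= two; move: (Re _)%:C (Im _)%:C => a b.
  by field.
have Wb j : wirt_bar j log_tau z = z 0 j / (tau z)%:C.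
  rewrite /wirt_bar !log_tau_deriv// hdotZr hdot_delta Rj Ij.
  rewrite [in RHS](complexE (z 0 j)).
  rewrite !rmorphM !fmorphV /= two; move: (Re _)%:C (Im _)%:C => a b.
  by field.
have -> : \sum_(j < m) wirt_bar j log_tau z * conjc (v 0 j) = conjc (hdot z v) / (tau z)%:C.
  by rewrite /hdot rmorph_sum mulr_suml; apply: eq_bigr => j _; rewrite Wb rmorphM /= conjcK mulrAC.
have -> : \sum_(j < m) wirt j log_tau z * v 0 j = hdot z v / (tau z)%:C.
  by rewrite /hdot mulr_suml; apply: eq_bigr => j _; rewrite W mulrAC.
have -> : conjc (hdot z v) / (tau z)%:C - hdot z v / (tau z)%:C =
    - 2 * 'i%C * (Im (hdot z v))%:C / (tau z)%:C.
  rewrite -mulrBl; congr (_ / _).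
  by case: (hdot z v) => a b; apply/eqP; rewrite eq_complex /=; apply/andP; split; apply/eqP; ring.
have pc : (pi : R)%:C != 0 by rewrite -[0]/(0%:C) (inj_eq (@complexI R)) gt_eqF// pi_gt0.
rewrite !rmorphM !fmorphV !rmorphM /= two.
have -> : (4:R)%:C = 4 by rewrite rmorph_nat.
have -> : 'i%C / (4 * pi%:C) * (- 2 * 'i%C * (Im (hdot z v))%:C / (tau z)%:C) =
  - (2 * ('i%C * 'i%C) / (4 * pi%:C) * (Im (hdot z v))%:C / (tau z)%:C) by ring.
rewrite i2; move: (Im _)%:C (pi%:C) pc ((tau z)%:C) t0 => a p p0 t t0'.
by field; rewrite t0' p0.
Qed.

(** On vectors tangent to the sphere the squared norm is stationary, so that only the
    differential of the imaginary part of the Hermitian product contributes. *)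
Lemma omega_log_tau z v w : 0 < tau z -> Re (hdot z v) = 0 -> Re (hdot z w) = 0 ->
  omega z v w = (Im (hdot v w) / (pi * tau z))%:C.
Proof.
move=> z0 zv zw.
have key a b : Re (hdot z a) = 0 ->
    dir_deriv (fun y => dc log_tau y b) z a = (Im (hdot a b) / (2 * pi * tau z))%:C.
  move=> za; apply: real_derivE.
  have tpz : 2 * pi * tau z != 0 by rewrite gt_eqF// mulr_gt0// mulr_gt0// pi_gt0.
  have d1 : is_derive (0:R) 1 (fun t : R => Im (hdot (z + t%:C *: a) b)) (Im (hdot a b)).
    have d := is_derive_id (0:R) (1:R).
    have := is_deriveD (is_derive_cst (Im (hdot z b)) (0:R) 1) (is_deriveZ (Im (hdot a b)) d).
    apply: is_derive_ext => [t|]; last by rewrite /GRing.scale /= mulr1 add0r.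
    by rewrite hdotDl hdotZl conjc_real !ReImE /= mul0r addr0 -[LHS]/(Im (hdot z b) + Im (hdot a b) * t) mulrC.
  have d2 : is_derive (0:R) 1 (fun t : R => 2 * pi * tau (z + t%:C *: a)) 0.
    have := is_deriveZ (2 * pi) (tau_deriv z a); apply: is_derive_ext => //.
    by rewrite za mulr0 scaler0.
  have z0' : 2 * pi * tau (z + (0:R)%:C *: a) != 0 by rewrite tau_line0.
  have d3 := is_deriveM d1 (@is_deriveV _ (fun t : R => 2 * pi * tau (z + t%:C *: a)) 0 _ 1 z0' d2).
  have d4 : cderive (fun t : R => (Im (hdot (z + t%:C *: a) b) / (2 * pi * tau (z + t%:C *: a)))%:C) 0
     (Im (hdot a b) / (2 * pi * tau z))%:C.
    apply: cderive_real; apply: is_derive_ext d3 => //.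
    by rewrite /GRing.scale /= !mulr0 add0r tau_line0 mulrC.
  apply/cderive_epsP => e e0; have [d d0 Hd] := (cderive_epsP _ _ _).1 d4 e e0.
  have [d' d'0 Hd'] : exists2 d' : R, 0 < d' & forall t : R, `|t| < d' -> 0 < tau (z + t%:C *: a).
    have := is_derive_cont (tau_deriv z a) => /cvgrPdist_lt/(_ (tau z) z0).
    case=> d' /= d'0 H; exists d' => // t td.
    have := H t; rewrite /= sub0r normrN tau_line0 => /(_ td).
    by rewrite ltr_norml => /andP[_]; rewrite ltrBlDr ltrDl.
  exists (Num.min d d'); first by rewrite lt_min d0.
  move=> t; rewrite lt_min => /andP[td td'].
  rewrite !dc_log_tau ?tau_line0//; last by rewrite add0r Hd'.
  by have := Hd t td; rewrite !tau_line0.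
rewrite /omega /ext_deriv !key// -rmorphB /=; congr (_%:C).
rewrite -(hdotJ v w) cImJ.
have t0 : tau z != 0 by rewrite gt_eqF.
have p0 : (pi : R) != 0 by rewrite gt_eqF// pi_gt0.
move: (Im _) (pi : R) p0 (tau z) t0 => a p p0 t t0.
by field; apply/andP; split.
Qed.

End LogTau.

(** * Signs of permutations that preserve a pairing *)

Section Pairing.
Context (R : numDomainType) (n : nat).
Local Notation I := 'I_(n.*2.+1).

Definition pos1 (j : 'I_n) : I := inord j.*2.+1.
Definition pos2 (j : 'I_n) : I := inord j.*2.+2.

Lemma pos1E (j : 'I_n) : pos1 j = j.*2.+1 :> nat.
Proof. by rewrite inordK//; have := ltn_ord j; lia. Qed.
Lemma pos2E (j : 'I_n) : pos2 j = j.*2.+2 :> nat.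
Proof. by rewrite inordK//; have := ltn_ord j; lia. Qed.

Lemma posP (x : I) : [\/ x = ord0, exists j, x = pos1 j | exists j, x = pos2 j].
Proof.
have [x0|x0] := posnP x; first by constructor 1; apply: val_inj.
have jn : (x.-1./2 < n)%N by have := ltn_ord x; lia.
have [ox|ex] := boolP (odd x).
  by constructor 2; exists (Ordinal jn); apply: ord_inj; rewrite pos1E /=; lia.
by constructor 3; exists (Ordinal jn); apply: ord_inj; rewrite pos2E /=; lia.
Qed.

Lemma pos1_inj : injective pos1.
Proof. by move=> i j /(congr1 val); rewrite /= !pos1E => -[] /double_inj/val_inj. Qed.
Lemma pos2_inj : injective pos2.
Proof. by move=> i j /(congr1 val); rewrite /= !pos2E => -[] /double_inj/val_inj. Qed.
Lemma pos12 i j : (pos1 i == pos2 j) = false.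
Proof. by rewrite -val_eqE /= pos1E pos2E; apply/eqP; lia. Qed.
Lemma pos21 i j : (pos2 i == pos1 j) = false.
Proof. by rewrite eq_sym pos12. Qed.
Lemma pos01 i : (ord0 == pos1 i) = false.
Proof. by rewrite -val_eqE /= pos1E. Qed.
Lemma pos02 i : (ord0 == pos2 i) = false.
Proof. by rewrite -val_eqE /= pos2E. Qed.
Lemma pos10 i : (pos1 i == ord0) = false.
Proof. by rewrite eq_sym pos01. Qed.
Lemma pos20 i : (pos2 i == ord0) = false.
Proof. by rewrite eq_sym pos02. Qed.

(** The matrix of [2 * pi * omega] on the coordinate vectors of the sphere.  An odd
    index is a coordinate of modulus; it is paired with the argument of the same
    entry, and, as the moduli have a constant sum, with the argument of the entry of
    index 0, with the opposite sign. *)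
Definition pair_form (k l : nat) : R :=
  if odd k && ~~ odd l then (l == k.+1)%:R - (l == 0)%:R
  else if ~~ odd k && odd l then (k == 0)%:R - (k == l.+1)%:R else 0.

Lemma pair_formC k l : pair_form l k = - pair_form k l.
Proof.
by rewrite /pair_form; case: (odd k); case: (odd l); rewrite /= ?oppr0 ?opprB.
Qed.

Lemma pair_form_oddodd k l : odd k -> odd l -> pair_form k l = 0.
Proof. by rewrite /pair_form => -> ->. Qed.

Definition pair_term (s : 'S_(n.*2.+1)) : R :=
  (-1) ^+ s * \prod_(j < n) pair_form (s (pos1 j)) (s (pos2 j)).

Lemma pair_term_flip s j : pair_term (tperm (pos1 j) (pos2 j) * s)%g = pair_term s.
Proof.
rewrite /pair_term odd_permM odd_tperm pos12 signr_addb expr1 mulN1r.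
rewrite (bigD1 j)//= [in RHS](bigD1 j)//= !permM tpermL tpermR pair_formC.
rewrite !mulNr mulrN opprK; congr (_ * (_ * _)).
apply: eq_bigr => i ij; have E1 : tperm (pos1 j) (pos2 j) (pos1 i) = pos1 i.
  by rewrite tpermD ?pos21// (inj_eq pos1_inj) eq_sym.
have E2 : tperm (pos1 j) (pos2 j) (pos2 i) = pos2 i.
  by rewrite tpermD ?pos12// (inj_eq pos2_inj) eq_sym.
by rewrite !permM E1 E2.
Qed.

Definition swap_pairs (j k : 'I_n) : 'S_(n.*2.+1) :=
  (tperm (pos1 j) (pos1 k) * tperm (pos2 j) (pos2 k))%g.

Lemma swap_pairs1 j k i : swap_pairs j k (pos1 i) = pos1 (tperm j k i).
Proof.
rewrite permM; case: (tpermP j k i) => [->|->|/eqP ij /eqP ik].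
- by rewrite tpermL tpermD// pos21.
- by rewrite tpermR tpermD// pos21.
have -> : tperm (pos1 j) (pos1 k) (pos1 i) = pos1 i.
  by rewrite tpermD// (inj_eq pos1_inj) eq_sym.
by rewrite tpermD// pos21.
Qed.

Lemma swap_pairs2 j k i : swap_pairs j k (pos2 i) = pos2 (tperm j k i).
Proof.
have E : tperm (pos1 j) (pos1 k) (pos2 i) = pos2 i by rewrite tpermD// pos12.
rewrite permM E; case: (tpermP j k i) => [->|->|/eqP ij /eqP ik].
- by rewrite tpermL.
- by rewrite tpermR.
by rewrite tpermD// (inj_eq pos2_inj) eq_sym.
Qed.

Lemma swap_pairs0 j k : swap_pairs j k ord0 = ord0.
Proof. by rewrite permM !tpermD// ?pos10 ?pos20. Qed.

Lemma pair_term_swap s j k : j != k -> pair_term (swap_pairs j k * s)%g = pair_term s.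
Proof.
move=> jk; rewrite /pair_term !odd_permM !odd_tperm.
rewrite (inj_eq pos1_inj) (inj_eq pos2_inj) jk /=; congr (_ * _).
rewrite [RHS](reindex_inj (@perm_inj _ (tperm j k))) /=.
by apply: eq_bigr => i _; rewrite !(permM _ s) swap_pairs1 swap_pairs2.
Qed.

Lemma pair_term_neq0 s j : pair_term s != 0 -> pair_form (s (pos1 j)) (s (pos2 j)) != 0.
Proof. by rewrite /pair_term (bigD1 j)//= => /eqP H; apply/eqP => E; apply: H; rewrite E mul0r mulr0. Qed.

(** Permuting the pairs, or exchanging the two members of a pair, does not change the
    term.  Each odd index can so be brought back to its own place, one after the
    other: in a nonzero term it cannot share its pair with another odd index. *)
Lemma pair_term_straighten s i : (i <= n)%N -> pair_term s != 0 -> ~~ odd (s ord0) ->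
  exists s', [/\ pair_term s' = pair_term s, s' ord0 = s ord0 &
    forall l : 'I_n, (l < i)%N -> s' (pos1 l) = pos1 l].
Proof.
move=> + T0 s0; elim: i => [|i IH] lin; first by exists s.
have [s' [Ts' s'0 Hs']] := IH (ltnW lin).
pose oi := Ordinal lin.
have [k ki [s2 [Ts2 s20 Hs2 s2k]]] : exists2 k : 'I_n, (i <= k)%N &
   exists s2, [/\ pair_term s2 = pair_term s, s2 ord0 = s ord0,
    forall l : 'I_n, (l < i)%N -> s2 (pos1 l) = pos1 l & s2 (pos1 k) = pos1 oi].
  have sq : s' ((s'^-1)%g (pos1 oi)) = pos1 oi by rewrite permKV.
  case: (posP ((s'^-1)%g (pos1 oi))) => [E|[k E]|[k E]]; rewrite E in sq.
  - by move: s0; rewrite -s'0 sq pos1E /= odd_double.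
  - exists k; last by exists s'.
    rewrite leqNgt; apply/negP => ki; move: sq; rewrite Hs'// => /pos1_inj kE.
    by move: ki; rewrite kE ltnn.
  - have ki : (i <= k)%N.
      rewrite leqNgt; apply/negP => ki.
      have := @pair_term_neq0 s' k; rewrite Ts' => /(_ T0); rewrite sq Hs'//.
      by rewrite pair_form_oddodd ?eqxx// pos1E /= odd_double.
    exists k => //; exists (tperm (pos1 k) (pos2 k) * s')%g; split.
    + by rewrite pair_term_flip.
    + by rewrite permM tpermD ?pos10 ?pos20.
    + move=> l li; rewrite permM tpermD ?pos21 ?(inj_eq pos1_inj) ?Hs'//.
      by apply/eqP => kl; move: li; rewrite -kl ltnNge ki.
    + by rewrite permM tpermL.
have [kE|kE] := eqVneq k oi.
  exists s2; split=> // l; rewrite ltnS leq_eqVlt => /orP[/eqP li|]; last exact: Hs2.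
  have -> : l = k by rewrite kE; apply: val_inj.
  by rewrite s2k kE.
exists (swap_pairs k oi * s2)%g; split.
- by rewrite pair_term_swap.
- by rewrite permM swap_pairs0.
move=> l; rewrite ltnS leq_eqVlt permM swap_pairs1 => /orP[/eqP li|li].
  have -> : l = oi by apply: val_inj.
  by rewrite tpermR.
rewrite tpermD ?Hs2//.
  by apply/eqP => kl; move: li; rewrite -kl ltnNge ki.
by apply/eqP => kl; move: li; rewrite -kl /= ltnn.
Qed.

Lemma pair_form_succ k : odd k -> pair_form k k.+1 = 1.
Proof. by rewrite /pair_form => ok; rewrite ok /= ok eqxx subr0. Qed.
Lemma pair_form_zero k : odd k -> pair_form k 0 = -1.
Proof. by rewrite /pair_form => ok; rewrite ok /= sub0r. Qed.

(** Once the odd indices are in place, a nonzero term leaves only two possibilities: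
    the identity, or one exchange of the index 0 with an even one, whose sign
    compensates the sign in [pair_form]. *)
Lemma pair_term_eq1 (s : 'S_(n.*2.+1)) : ~~ odd (s ord0) -> pair_term s != 0 -> pair_term s = 1.
Proof.
move=> s0 T0; have [t [Tt t0 Ht]] := pair_term_straighten (leqnn n) T0 s0.
rewrite -Tt; rewrite -Tt in T0.
have {}Ht l : t (pos1 l) = pos1 l by apply: Ht; exact: ltn_ord.
have t2 l : t (pos2 l) = pos2 l \/ t (pos2 l) = ord0.
  have := @pair_term_neq0 t l T0; rewrite Ht /pair_form pos1E /= odd_double /=.
  case: ifP => [_|_]; last by rewrite eqxx.
  have [E|_] := eqVneq (t (pos2 l) : nat) _; first by left; apply: ord_inj; rewrite /= E pos2E.
  have [E|_] := eqVneq (t (pos2 l) : nat) 0%N; first by right; apply: val_inj.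
  by rewrite subrr eqxx.
have [t00|t00] := eqVneq (t ord0) ord0.
  have {}t2 l : t (pos2 l) = pos2 l.
    by case: (t2 l) => //; rewrite -t00 => /perm_inj/eqP; rewrite pos20.
  have -> : t = 1%g.
    by apply/permP => x; rewrite perm1; case: (posP x) => [|[j]|[j]] ->.
  rewrite /pair_term odd_perm1 mul1r big1// => j _.
  by rewrite !perm1 pos1E pos2E pair_form_succ//= odd_double.
have tq : t ((t^-1)%g ord0) = ord0 by rewrite permKV.
have [l0 El0] : exists l0, t (pos2 l0) = ord0.
  case: (posP ((t^-1)%g ord0)) => [E|[k E]|[k E]]; rewrite E in tq.
  - by rewrite tq eqxx in t00.
  - by move/eqP: tq; rewrite Ht pos10.
  - by exists k.
have {}t2 l : l != l0 -> t (pos2 l) = pos2 l.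
  move=> ll0; case: (t2 l) => //; rewrite -El0 => /perm_inj/pos2_inj E.
  by rewrite E eqxx in ll0.
have tt0 : t ord0 = pos2 l0.
  case: (posP (t ord0)) => [E|[k E]|[k E]]; first by rewrite E eqxx in t00.
    by move/eqP: E; rewrite -Ht (inj_eq perm_inj) pos01.
  have [<-//|kl0] := eqVneq k l0.
  by move/eqP: E; rewrite -(t2 k)// (inj_eq perm_inj) pos02.
have -> : t = tperm ord0 (pos2 l0).
  apply/permP => x; case: (posP x) => [|[j]|[j]] ->.
  - by rewrite tpermL.
  - by rewrite tpermD ?pos01 ?pos21.
  - have [->|jl] := eqVneq j l0; first by rewrite tpermR.
    by rewrite tpermD ?pos02 ?(inj_eq pos2_inj) 1?eq_sym ?t2.
rewrite /pair_term odd_tperm pos02 expr1 (bigD1 l0)//= tpermR tpermD ?pos01 ?pos21//.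
rewrite pos1E pair_form_zero ?mulrA ?mulrNN ?mulr1 ?mul1r /= ?odd_double//.
rewrite big1// => j jl; rewrite !tpermD ?pos01 ?pos21 ?pos02 ?(inj_eq pos2_inj) 1?eq_sym//.
by rewrite pos1E pos2E pair_form_succ//= odd_double.
Qed.

Lemma pair_term_01 (s : 'S_(n.*2.+1)) : ~~ odd (s ord0) -> 0 <= pair_term s <= 1.
Proof.
move=> s0; have [->|T0] := eqVneq (pair_term s) 0; first by rewrite lexx ler01.
by rewrite (pair_term_eq1 s0 T0) lexx ler01.
Qed.

Lemma pair_term_id : pair_term 1 = 1.
Proof.
rewrite /pair_term odd_perm1 mul1r big1// => j _.
by rewrite !perm1 pos1E pos2E pair_form_succ//= odd_double.
Qed.

End Pairing.

(** * The density of the measure on the sphere *)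

Section Density.
Context {R : realType} (n : nat) (r : R) (u : nat -> R).
Local Notation C := R[i].
Local Notation Re := (@complex.Re R).
Local Notation Im := (@complex.Im R).
Local Notation z := (sphere_pt n.+1 r u).
Local Notation t := (sphere_sq n.+1 u).
Local Notation Tg k := (sphere_tangent n.+1 r u k).
Context (r0 : 0 < r).
Context (tpos : forall j, (j <= n)%N -> 0 < t j).

Lemma sphere_ptE (v : nat -> R) (j : 'I_n.+1) :
  sphere_pt n.+1 r v 0 j = (r * Num.sqrt (sphere_sq n.+1 v j))%:C * ei (v j.*2).
Proof. by rewrite mxE. Qed.

Lemma sphere_sq_sum : \sum_(j < n.+1) t j = 1.
Proof.
rewrite big_ord_recl /= {1}/sphere_sq /=.
have -> : \sum_(i < n) t (lift ord0 i) = \sum_(1 <= l < n.+1) u l.*2.-1.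
  by rewrite big_add1 big_mkord; apply: eq_bigr => i _.
by rewrite subrK.
Qed.

Lemma sum_pick (F : nat -> R) (q : nat) : (q <= n)%N ->
  \sum_(j < n.+1) (j == q :> nat)%:R * F j = F q.
Proof.
move=> qn; have qn' : (q < n.+1)%N by [].
rewrite (bigD1 (Ordinal qn'))//= eqxx mul1r big1 ?addr0// => j jq.
by rewrite (_ : (j == q :> nat) = false) ?mul0r//; apply/negbTE.
Qed.

(** The coordinate vectors of the sphere are diagonal multiples of its point, by
    [tangentE]. *)
Definition tangent_coef (k j : nat) : C :=
  if odd k then ((j == k./2.+1)%:R / (2 * t j) - (j == 0)%:R / (2 * t 0))%:C
  else (j == k./2)%:R%:C * 'i%C.

Lemma sphere_sq_upd_even k x j : ~~ odd k -> sphere_sq n.+1 (upd u k x) j = t j.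
Proof.
move=> ek; rewrite /sphere_sq; case: ifP => j0.
  congr (1 - _); apply: eq_big_nat => l /andP[l1 _].
  rewrite /upd (_ : (l.*2.-1 == k) = false)//; apply/negP => /eqP E.
  by move: ek; rewrite -E; case: l l1 {E} => //= l _; rewrite odd_double.
rewrite /upd (_ : (j.*2.-1 == k) = false)//; apply/negP => /eqP E.
by move: ek; rewrite -E; case: j j0 {E} => //= j _; rewrite odd_double.
Qed.

Lemma sphere_sq_upd_odd k x (j : nat) : odd k -> (k < n.*2.+1)%N ->
  sphere_sq n.+1 (upd u k x) j =
  t j + ((j == k./2.+1)%:R - (j == 0)%:R) * (x - u k).
Proof.
move=> ok kn; rewrite /sphere_sq; case: ifP => [/eqP ->|j0].
  rewrite /= sub0r mulN1r.
  have qn : (k./2 < n)%N by have := odd_double_half k; rewrite ok; lia.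
  have kE : k./2.+1.*2.-1 = k by have := odd_double_half k; rewrite ok; lia.
  have -> : \sum_(1 <= l < n.+1) upd u k x l.*2.-1 = \sum_(1 <= l < n.+1) u l.*2.-1 + (x - u k).
    transitivity (\sum_(1 <= l < n.+1) (u l.*2.-1 + (l == k./2.+1)%:R * (x - u k))).
      apply: eq_big_nat => l /andP[l1 _]; rewrite /upd.
      have -> : (l == k./2.+1) = (l.*2.-1 == k).
        by apply/eqP/eqP; have := odd_double_half k; rewrite ok; lia.
      by case: eqP => [->|_]; rewrite ?mul1r ?mul0r ?addr0// addrC subrK.
    rewrite big_split /=; congr (_ + _).
    rewrite -[RHS](sum_pick (fun=> x - u k) qn) big_ord_recl /= mul0r add0r.
    by rewrite big_add1 big_mkord.
  by ring.
rewrite /upd subr0; have [E|E] := eqVneq j.*2.-1 k.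
  have -> : (j == k./2.+1) = true.
    by apply/eqP; have := odd_double_half k; rewrite ok; lia.
  by rewrite mul1r E addrC subrK.
have -> : (j == k./2.+1) = false.
  by apply/eqP => jk; move/eqP: E; apply; have := odd_double_half k; rewrite ok; lia.
by rewrite mul0r addr0.
Qed.

Lemma tangentE k (j : 'I_n.+1) : (k < n.*2.+1)%N -> Tg k 0 j = tangent_coef k j * z 0 j.
Proof.
move=> kn; rewrite mxE; apply: real_derivE.
have F x : sphere_pt n.+1 r (upd u k x) 0 j =
    (r * Num.sqrt (sphere_sq n.+1 (upd u k x) j))%:C * ei (upd u k x j.*2).
  exact: sphere_ptE.
rewrite sphere_ptE; apply: cderive_ext (_ : cderive (fun x => (r * Num.sqrt (sphere_sq n.+1 (upd u k x) j))%:C * ei (upd u k x j.*2)) _ _) => //.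
rewrite /tangent_coef; have [ok|ek] := boolP (odd k).
  have ang x : upd u k x j.*2 = u j.*2.
    rewrite /upd (_ : (j.*2 == k) = false)//; apply/eqP => E; move: ok.
    by rewrite -E odd_double.
  pose c : R := (j == k./2.+1 :> nat)%:R - (j == 0 :> nat)%:R.
  have d1 : is_derive (u k) 1 (fun x => t j + c * (x - u k)) c.
    have := is_deriveD (is_derive_cst (t j) (u k) 1) (is_deriveZ c (is_deriveB (is_derive_id (u k) (1:R)) (is_derive_cst (u k) (u k) 1))).
    by apply: is_derive_ext => //; rewrite /GRing.scale /= subr0 mulr1 add0r.
  have tj : 0 < t j by apply: tpos; rewrite -ltnS.
  have tj' : 0 < t j + c * (u k - u k) by rewrite subrr mulr0 addr0.
  have d2 := is_derive1_comp (g := fun x => t j + c * (x - u k)) (is_derive1_sqrt tj') d1.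
  have d3 := cderiveM (cderive_real (is_deriveZ r d2)) (cderive_cst (ei (u j.*2)) (u k)).
  apply: cderive_ext d3 => [x|].
    by rewrite ang sphere_sq_upd_odd.
  rewrite mulr0 addr0 mulrA -rmorphM /GRing.scale /= subrr mulr0 addr0; congr (_%:C * _).
  have s0 : Num.sqrt (t j) != 0 by rewrite gt_eqF// sqrtr_gt0.
  have s2 : t j = Num.sqrt (t j) * Num.sqrt (t j) by rewrite -expr2 sqr_sqrtr// ltW.
  have -> : (j == 0 :> nat)%:R / (2 * t 0) = (j == 0 :> nat)%:R / (2 * t j).
    by have [->//|] := eqVneq (j : nat) 0%N; rewrite !mul0r.
  rewrite -mulrBl -/c; move: s2 s0; move: (Num.sqrt (t j)) => s -> s0.
  by field.
have sq x : sphere_sq n.+1 (upd u k x) j = t j by exact: sphere_sq_upd_even.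
have [E|E] := eqVneq (j : nat) k./2.
  have jk : j.*2 = k by rewrite E; have := odd_double_half k; rewrite (negbTE ek); lia.
  have d := cderiveZ (r * Num.sqrt (t j))%:C (cderive_ei (u k)).
  apply: cderive_ext d => [x|].
    by rewrite sq /upd jk eqxx.
  by rewrite jk mul1r; ring.
have jk : (j.*2 == k) = false.
  by apply/eqP => jk; move/eqP: E; apply; rewrite -jk doubleK.
apply: cderive_ext (cderive_cst ((r * Num.sqrt (t j))%:C * ei (u j.*2)) (u k)) => [x|].
  by rewrite sq /upd jk.
by rewrite !mul0r.
Qed.

Lemma sphere_pt_sq (j : 'I_n.+1) : conjc (z 0 j) * z 0 j = (r ^+ 2 * t j)%:C.
Proof.
rewrite mulrC mulJ sphere_ptE cmodM cmod_ei mulr1 cmod_real; congr (_%:C).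
have tj : 0 < t j by apply: tpos; rewrite -ltnS.
by rewrite real_normK ?num_real// exprMn sqr_sqrtr// ltW.
Qed.

Lemma hdot_pt_tangent k : (k < n.*2.+1)%N ->
  hdot z (Tg k) = \sum_(j < n.+1) (r ^+ 2 * t j)%:C * tangent_coef k j.
Proof.
by move=> kn; apply: eq_bigr => j _; rewrite tangentE// mulrCA sphere_pt_sq mulrC.
Qed.

Lemma hdot_tangent k l : (k < n.*2.+1)%N -> (l < n.*2.+1)%N ->
  hdot (Tg k) (Tg l) = \sum_(j < n.+1) (r ^+ 2 * t j)%:C * (conjc (tangent_coef k j) * tangent_coef l j).
Proof.
move=> kn ln; apply: eq_bigr => j _; rewrite !tangentE// rmorphM -sphere_pt_sq.
by rewrite mulrACA [RHS]mulrC.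
Qed.

Lemma tau_pt : tau z = r ^+ 2.
Proof.
apply: (@complexI R); rewrite tauE /hdot.
under eq_bigr do rewrite sphere_pt_sq.
by rewrite -rmorph_sum /= -mulr_sumr sphere_sq_sum mulr1.
Qed.

Lemma tau_pt_gt0 : 0 < tau z. Proof. by rewrite tau_pt exprn_gt0. Qed.

Lemma Re_hdot_pt k : (k < n.*2.+1)%N -> Re (hdot z (Tg k)) = 0.
Proof.
move=> kn; rewrite hdot_pt_tangent// Re_sum /tangent_coef.
have [ok|ek] := boolP (odd k); last first.
  by apply: big1 => j _; rewrite !ReImE /=; ring.
have qn : (k./2.+1 <= n)%N by have := odd_double_half k; rewrite ok; lia.
transitivity (\sum_(j < n.+1) ((j == k./2.+1 :> nat)%:R * (r ^+ 2 / 2) - (j == 0 :> nat)%:R * (r ^+ 2 / 2))).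
  apply: eq_bigr => j _; rewrite !ReImE /= mul0r subr0.
  have tj : t j != 0 by rewrite gt_eqF// tpos// -ltnS.
  have -> : (j == 0 :> nat)%:R / (2 * t 0) = (j == 0 :> nat)%:R / (2 * t j).
    by have [->//|] := eqVneq (j : nat) 0%N; rewrite !mul0r.
  by field.
rewrite sumrB.
by rewrite (sum_pick (fun=> r ^+ 2 / 2) qn) (sum_pick (fun=> r ^+ 2 / 2) (leq0n n)) subrr.
Qed.

Lemma Im_hdot_pt k : (k < n.*2.+1)%N ->
  Im (hdot z (Tg k)) = if odd k then 0 else r ^+ 2 * t k./2.
Proof.
move=> kn; rewrite hdot_pt_tangent// Im_sum /tangent_coef.
have [ok|ek] := boolP (odd k).
  by apply: big1 => j _; rewrite !ReImE /=; ring.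
have qn : (k./2 <= n)%N by have := odd_double_half k; lia.
rewrite -(sum_pick (fun j => r ^+ 2 * t j) qn); apply: eq_bigr => j _.
by rewrite !ReImE /=; ring.
Qed.

Lemma Im_hdot_tangent k l : (k < n.*2.+1)%N -> (l < n.*2.+1)%N ->
  Im (hdot (Tg k) (Tg l)) = r ^+ 2 / 2 * pair_form R k l.
Proof.
have main a b : (a < n.*2.+1)%N -> (b < n.*2.+1)%N -> odd a -> ~~ odd b ->
    Im (hdot (Tg a) (Tg b)) = r ^+ 2 / 2 * pair_form R a b.
  move=> an bn oa eb; have -> : pair_form R a b = (b == a.+1)%:R - (b == 0)%:R by rewrite /pair_form oa eb.
  rewrite hdot_tangent// Im_sum /tangent_coef oa (negbTE eb).
  have qn : (b./2 <= n)%N by have := odd_double_half b; lia.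
  transitivity (\sum_(j < n.+1) (j == b./2 :> nat)%:R * (r ^+ 2 / 2 * ((j == a./2.+1 :> nat)%:R - (j == 0 :> nat)%:R))).
    apply: eq_bigr => j _; rewrite !ReImE /= .
    have tj : t j != 0 by rewrite gt_eqF// tpos// -ltnS.
    have -> : (j == 0 :> nat)%:R / (2 * t 0) = (j == 0 :> nat)%:R / (2 * t j).
      by have [->//|] := eqVneq (j : nat) 0%N; rewrite !mul0r.
    by field.
  rewrite (sum_pick (fun j => r ^+ 2 / 2 * ((j == a./2.+1)%:R - (j == 0)%:R)) qn).
  have -> : (b./2 == a./2.+1) = (b == a.+1).
    by apply/eqP/eqP; have := odd_double_half a; have := odd_double_half b; rewrite oa (negbTE eb); lia.
  have -> : (b./2 == 0%N) = (b == 0%N).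
    by apply/eqP/eqP; have := odd_double_half b; rewrite (negbTE eb); lia.
  by [].
move=> kn ln; have [ok|ek] := boolP (odd k); have [ol|el] := boolP (odd l).
- rewrite pair_form_oddodd// mulr0 hdot_tangent// Im_sum /tangent_coef ok ol.
  by apply: big1 => j _; rewrite !ReImE /=; ring.
- exact: main.
- by rewrite -(hdotJ (Tg l)) cImJ main// pair_formC mulrN opprK.
- rewrite /pair_form ek el (negbTE ek) (negbTE el) /= mulr0 hdot_tangent// Im_sum /tangent_coef (negbTE ek) (negbTE el).
  by apply: big1 => j _; rewrite !ReImE /=; ring.
Qed.

(** The coefficient of the measure in the coordinates of the sphere.  It is constant,
    but bounds are enough to compare integrals: all the terms of
    [densityE] are nonnegative, and the identity contributes [sphere_sq n.+1 u 0]. *)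
Definition density : R := Re (sigma z (fun k : 'I_(n.*2.+1) => Tg k)).

Definition kappa : R := (2 ^+ n)^-1 * (2 * pi)^-1 ^+ n.+1.

Lemma kappa_gt0 : 0 < kappa.
Proof. by rewrite mulr_gt0 ?invr_gt0 ?exprn_gt0// invr_gt0 twopi_gt0. Qed.

Lemma densityE : density =
  kappa * \sum_(s : 'S_(n.*2.+1)) (if odd (s ord0) then 0 else t (s ord0)./2) * pair_term R s.
Proof.
have p0 : (pi : R) != 0 by rewrite gt_eqF// pi_gt0.
have rn0 : r != 0 by rewrite gt_eqF.
have zt := tau_pt_gt0.
have aE k : (k < n.*2.+1)%N -> dc log_tau z (Tg k) = ((2 * pi)^-1 * (if odd k then 0 else t k./2))%:C.
  move=> kn; rewrite dc_log_tau// Im_hdot_pt// tau_pt; congr (_%:C).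
  case: ifP => _; first by rewrite mul0r mulr0.
  move: (pi : R) p0 => p p0.
  by field; apply/andP; split.
have wE k l : (k < n.*2.+1)%N -> (l < n.*2.+1)%N -> omega z (Tg k) (Tg l) = ((2 * pi)^-1 * pair_form R k l)%:C.
  move=> kn ln; rewrite omega_log_tau ?Re_hdot_pt// Im_hdot_tangent// tau_pt; congr (_%:C).
  move: (pi : R) p0 => p p0.
  by field; apply/andP; split.
rewrite /density /sigma /=.
have two : (2 : C) = (2:R)%:C by rewrite rmorph_nat.
rewrite two -rmorphXn -fmorphV.
have -> : (\sum_(s : 'S_(n.*2.+1)) (-1) ^+ s * dc log_tau z (Tg (s ord0)) *
    \prod_(j < n) omega z (Tg (s (inord j.*2.+1))) (Tg (s (inord j.*2.+2))))
  = (\sum_(s : 'S_(n.*2.+1)) (2 * pi)^-1 ^+ n.+1 * ((if odd (s ord0) then 0 else t (s ord0)./2) * pair_term R s))%:C.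
  rewrite rmorph_sum; apply: eq_bigr => s _.
  rewrite aE//; under eq_bigr do rewrite wE//.
  rewrite -rmorph_prod big_split /= prodr_const card_ord.
  rewrite -[(-1) ^+ s](_ : ((-1) ^+ s)%:C = _); last by rewrite rmorphXn rmorphN1.
  rewrite -!rmorphM /=; congr (_%:C).
  rewrite /pair_term /pos1 /pos2 exprS.
  set A := (if _ then _ else _); set P := \prod_(j < n) _; set B := (-1) ^+ s.
  set p := (2 * pi)^-1; set q := p ^+ n.
  by ring.
rewrite -rmorphM /= -mulr_sumr mulrA; congr (_ * _).
Qed.

Lemma density_ge : kappa * t 0 <= density.
Proof.
rewrite densityE ler_pM2l ?kappa_gt0// (bigD1 1%g)//= perm1 /= pair_term_id mulr1 lerDl.
apply: sumr_ge0 => s _; case: ifP => os; first by rewrite mul0r.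
have /andP[p0 _] := pair_term_01 R (negbT os).
by rewrite mulr_ge0// ltW// tpos//; have := ltn_ord (s ord0); lia.
Qed.

Lemma density_le : density <= kappa * #|{: 'S_(n.*2.+1)}|%:R.
Proof.
rewrite densityE ler_pM2l ?kappa_gt0// -sum1_card natr_sum; apply: ler_sum => s _.
case: ifP => os; first by rewrite mul0r ler01.
have /andP[p0 p1] := pair_term_01 R (negbT os).
have qn : ((s ord0)./2 <= n)%N by have := ltn_ord (s ord0); lia.
have tq1 : t (s ord0)./2 <= 1.
  rewrite -[leRHS]sphere_sq_sum (bigD1 (Ordinal (qn : (_ < n.+1)%N)))//= lerDl.
  by apply: sumr_ge0 => j _; rewrite ltW// tpos// -ltnS.
have t0 : 0 <= t (s ord0)./2 by rewrite ltW// tpos.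
by apply: mulr_ile1.
Qed.

End Density.

(** * Bounds for the characteristic function *)

Section IteratedIntegral.
Context {R : realType}.
Local Notation mu := (@lebesgue_measure R).

(** The integral of a nonnegative function is a supremum over the simple functions
    below it, hence monotone for arbitrary functions.  This spares a study of the
    measurability of iterated integrals in the remaining coordinates. *)
Lemma le_integral_subset (D' D : set R) (f g : R -> \bar R) : D' `<=` D ->
  (forall x, D x -> 0 <= g x)%E -> (forall x, D' x -> 0 <= f x <= g x)%E ->
  (\int[mu]_(x in D') f x <= \int[mu]_(x in D) g x)%E.
Proof.
move=> D'D g0 fg.
have f0 x : D' x -> (0 <= f x)%E by move=> /fg /andP[].
rewrite !ge0_integralE//; apply: ereal_sup_le => _ /= [h hf <-].
exists h => // x; apply: le_trans (hf x) _.
rewrite /patch; case: ifPn => [|xD']; last first.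
  by case: ifP => // /set_mem; exact: g0.
rewrite inE => xD'; have xD := D'D x xD'.
by rewrite mem_set//; have /andP[] := fg x xD'.
Qed.

Definition in_range (N k : nat) (u : nat -> R) : Prop :=
  forall l, (k <= l < N)%N -> coord_range l (u l).

Lemma in_range_upd N k u x : in_range N k.+1 u -> coord_range k x ->
  in_range N k (upd u k x).
Proof.
move=> ur kx l /andP[kl lN]; rewrite /upd; case: eqP => [->//|/eqP lk].
by apply: ur; rewrite lN andbT ltn_neqAle eq_sym lk.
Qed.

Lemma iter_integral_ge0 N F : (forall u, in_range N 0 u -> (0 <= F u)%E) ->
  forall k u, in_range N k u -> (0 <= iter_integral k F u)%E.
Proof.
move=> F0; elim=> [|k IH] u ur /=; first exact: F0.
by apply: integral_ge0 => x kx; apply: IH; exact: in_range_upd.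
Qed.

Lemma range_le_2pi k : (mu (@coord_range R k) <= (2 * pi)%:E)%E.
Proof.
have p1 : 1 <= 2 * pi :> R by have := @pi_ge2 R; lra.
rewrite /coord_range; case: ifP => _; rewrite lebesgue_measure_itv /= lte_fin.
  by rewrite ltr01 sube0 lee_fin.
by rewrite twopi_gt0 sube0 lexx.
Qed.

Lemma coord_range_meas k : measurable (@coord_range R k).
Proof. by rewrite /coord_range; case: ifP => _; exact: measurable_itv. Qed.

Lemma iter_integral_le N F (B : R) : 0 <= B ->
  (forall u, in_range N 0 u -> (0 <= F u <= B%:E)%E) ->
  forall k u, in_range N k u -> (iter_integral k F u <= (B * (2 * pi) ^+ k)%:E)%E.
Proof.
move=> B0 FB; elim=> [|k IH] u ur /=.
  by rewrite expr0 mulr1; have /andP[] := FB u ur.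
have c0 : 0 <= B * (2 * pi) ^+ k by rewrite mulr_ge0// exprn_ge0// ltW// twopi_gt0.
apply: (@le_trans _ _ (\int[mu]_(x in coord_range k) (B * (2 * pi) ^+ k)%:E)%E).
  rewrite (_ : (\int[mu]_(x in coord_range k) (B * (2 * pi) ^+ k)%:E)%E =
    (\int[mu]_(x in coord_range k) (cst (B * (2 * pi) ^+ k)%:E) x)%E)//.
  apply: le_integral_subset => // x kx.
  have xr := in_range_upd ur kx; rewrite IH// andbT.
  by apply: (iter_integral_ge0 (N := N)) => // v /FB /andP[].
rewrite integral_cst; last exact: coord_range_meas.
rewrite exprSr mulrA [X in (_ <= X)%E]EFinM; apply: lee_wpmul2l; first by rewrite lee_fin.
exact: range_le_2pi.
Qed.

(** The coordinates of the points of the sphere for which all the entries but the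
    one of index 0 are small. *)
Definition small_range (d : R) (k : nat) : set R :=
  if odd k then `]0, d[%classic else `[0, 2 * pi]%classic.

Definition in_small (d : R) (N k : nat) (u : nat -> R) : Prop :=
  forall l, (k <= l < N)%N -> small_range d l (u l).

Lemma small_range_sub d k : d <= 1 -> small_range d k `<=` coord_range k.
Proof.
move=> d1 x; rewrite /small_range /coord_range; case: ifP => // _.
by rewrite /= !in_itv /= => /andP[-> xd]; exact: lt_le_trans d1.
Qed.

Lemma small_range_ge d k : 0 < d -> d <= 1 -> (d%:E <= mu (small_range d k))%E.
Proof.
move=> d0 d1; rewrite /small_range; case: ifP => _; rewrite lebesgue_measure_itv /= lte_fin.
  by rewrite d0 sube0.
rewrite twopi_gt0 sube0 lee_fin; apply: le_trans d1 _.
by have := @pi_ge2 R; lra.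
Qed.

Lemma in_small_upd d N k u x : in_small d N k.+1 u -> small_range d k x ->
  in_small d N k (upd u k x).
Proof.
move=> ur kx l /andP[kl lN]; rewrite /upd; case: eqP => [->//|/eqP lk].
by apply: ur; rewrite lN andbT ltn_neqAle eq_sym lk.
Qed.

(** A lower bound for the innermost integral, valid on the whole box of small
    coordinates, is multiplied by the sides of this box, each at least [d]. *)
Lemma iter_integral_ge N F (d c : R) : 0 < d -> d <= 1 -> 0 <= c ->
  (forall u, in_range N 0 u -> (0 <= F u)%E) ->
  (forall u, in_small d N 1 u -> (c%:E <= iter_integral 1 F u)%E) ->
  forall k u, in_small d N k.+1 u -> ((c * d ^+ k)%:E <= iter_integral k.+1 F u)%E.
Proof.
move=> d0 d1 c0 F0 Fc; elim=> [|k IH] u us; first by rewrite expr0 mulr1; exact: Fc.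
have cd : 0 <= c * d ^+ k by rewrite mulr_ge0// exprn_ge0// ltW.
have ur : in_range N k.+2 u.
  by move=> l lN; apply: (small_range_sub d1); exact: us.
apply: (@le_trans _ _ (\int[mu]_(x in small_range d k.+1) (c * d ^+ k)%:E)%E).
  rewrite integral_cst; last by rewrite /small_range; case: ifP => _; exact: measurable_itv.
  rewrite exprSr mulrA [X in (X <= _)%E]EFinM; apply: lee_wpmul2l; first by rewrite lee_fin.
  exact: small_range_ge.
rewrite [iter_integral k.+2 _ _]/=.
apply: le_integral_subset => [|x kx|x kx].
- exact: small_range_sub.
- by apply: (iter_integral_ge0 F0 (k := k.+1)); exact: in_range_upd.
- rewrite lee_fin cd /=; apply: IH; exact: in_small_upd.
Qed.

End IteratedIntegral.

Section Characteristic.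
Context {R : realType} (n : nat).
Local Notation C := R[i].
Local Notation Re := (@complex.Re R).
Local Notation Im := (@complex.Im R).
Context (f : 'rV[C]_n.+1 -> C) (u : C -> R) (h h' : C -> C).
Context (fu : forall z, log_plus (cmod (f z)) = Num.max (u (\sum_j z 0 j)) 0).

Definition integrand (r : R) (v : nat -> R) : \bar R :=
  if 0 < sphere_sq n.+1 v 0 then
    (log_plus (cmod (f (sphere_pt n.+1 r v))) *
       Re (sigma (sphere_pt n.+1 r v) (fun k : 'I_(n.+1.-1.*2.+1) => sphere_tangent n.+1 r v k)))%:E
  else 0%E.

Lemma characteristicE r : nevanlinna_T r f = iter_integral n.*2.+1 (integrand r) (fun=> 0).
Proof. by []. Qed.

Lemma range_sq_pos (v : nat -> R) : in_range n.*2.+1 0 v -> 0 < sphere_sq n.+1 v 0 ->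
  forall j, (j <= n)%N -> 0 < sphere_sq n.+1 v j.
Proof.
move=> vr t0 [|j] jn //; rewrite /sphere_sq /=.
have := vr j.*2.+1; rewrite /coord_range /= odd_double /= in_itv /=.
have jn2 : (0 <= j.*2.+1 < n.*2.+1)%N by rewrite /= ltnS ltn_double.
by move=> /(_ jn2)/andP[].
Qed.

Lemma integrandE r v : 0 < sphere_sq n.+1 v 0 ->
  integrand r v = (Num.max (u (\sum_j sphere_pt n.+1 r v 0 j)) 0 * density n r v)%:E.
Proof. by move=> t0; rewrite /integrand t0 fu. Qed.

Lemma integrand_ge0 r v : 0 < r -> in_range n.*2.+1 0 v -> (0 <= integrand r v)%E.
Proof.
move=> r0 vr; have [t0|t0] := boolP (0 < sphere_sq n.+1 v 0); last first.
  by rewrite /integrand (negbTE t0).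
have tpos := range_sq_pos vr t0.
rewrite integrandE// lee_fin mulr_ge0//; first by rewrite le_max lexx orbT.
apply: le_trans (density_ge r0 tpos); rewrite mulr_ge0 ?ltW//.
exact: kappa_gt0.
Qed.

Lemma sphere_pt_entry_le (r : R) (v : nat -> R) (j : 'I_n.+1) : 0 < r ->
  (forall j, (j <= n)%N -> 0 < sphere_sq n.+1 v j) ->
  cmod (sphere_pt n.+1 r v 0 j) = r * Num.sqrt (sphere_sq n.+1 v j).
Proof.
move=> r0 tpos; rewrite sphere_ptE cmodM cmod_ei mulr1 cmod_real ger0_norm//.
by rewrite mulr_ge0 ?sqrtr_ge0// ltW.
Qed.

Lemma cmod_sum (I : Type) (s : seq I) (P : pred I) (F : I -> C) :
  cmod (\sum_(i <- s | P i) F i) <= \sum_(i <- s | P i) cmod (F i).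
Proof.
elim/big_rec2: _ => [|i x y _ H]; first by rewrite cmod0.
by apply: le_trans (cmodD _ _) _; rewrite lerD2l.
Qed.

Lemma characteristic_le r B : 0 < r -> 0 <= B ->
  (forall z, cmod z <= n.+1%:R * r -> u z <= B) ->
  (nevanlinna_T r f <= (B * (kappa (R := R) n * #|{: 'S_(n.*2.+1)}|%:R) * (2 * pi) ^+ n.*2.+1)%:E)%E.
Proof.
move=> r0 B0 uB; rewrite characteristicE.
have K0 : 0 <= kappa (R := R) n * #|{: 'S_(n.*2.+1)}|%:R.
  by rewrite mulr_ge0// ltW// kappa_gt0.
apply: (@iter_integral_le R n.*2.+1); first by rewrite mulr_ge0.
  move=> v vr; rewrite integrand_ge0//=.
  have [t0|t0] := boolP (0 < sphere_sq n.+1 v 0); last first.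
    by rewrite /integrand (negbTE t0) lee_fin mulr_ge0.
  have tpos := range_sq_pos vr t0.
  rewrite integrandE// lee_fin; apply: ler_pM.
  - by rewrite le_max lexx orbT.
  - apply: le_trans (density_ge r0 tpos); rewrite mulr_ge0 ?ltW//.
    exact: kappa_gt0.
  - rewrite ge_max B0 andbT; apply: uB; apply: le_trans (cmod_sum _ _ _) _.
    apply: (@le_trans _ _ (\sum_(j < n.+1) r)); last by rewrite sumr_const card_ord mulr_natl.
    apply: ler_sum => j _; rewrite sphere_pt_entry_le// -[leRHS]mulr1 ler_pM2l//.
    rewrite -[leRHS]sqrtr1 ler_sqrt// -[leRHS](sphere_sq_sum n v) (bigD1 j)//= lerDl.
    by apply: sumr_ge0 => i _; rewrite ltW// tpos// -ltnS.
  - exact: density_le.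
by move=> l /andP[]; rewrite leqNgt => /negP.
Qed.

(** With squared moduli below [delta * r ^+ 2], the entries of positive index have a sum of
    modulus at most [r / 8] ([centre_le]) and the entry of index 0 has modulus at
    least [r / 2] ([radius_ge]), as [off_centre_bound] requires. *)
Definition delta : R := (8 * n.+1%:R) ^- 2.

Let n1 : 1 <= n.+1%:R :> R. Proof. by rewrite ler1n. Qed.

Lemma delta_gt0 : 0 < delta.
Proof. by rewrite invr_gt0 exprn_gt0// mulr_gt0. Qed.

Lemma delta_sqrt : Num.sqrt delta = (8 * n.+1%:R)^-1.
Proof. by rewrite /delta -exprVn sqrtr_sqr ger0_norm// invr_ge0 mulr_ge0. Qed.

Lemma delta_sum : n.+1%:R * delta <= 1 / 64.
Proof.
rewrite /delta exprMn invfM; move: n1; move: (n.+1%:R : R) => N N1.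
have N0 : N != 0 by rewrite gt_eqF// (lt_le_trans _ N1).
have -> : N * (8 ^- 2 * N ^- 2) = 1 / 64 * N^-1 by field.
by rewrite ler_piMr// invf_le1// (lt_le_trans _ N1).
Qed.

Lemma delta_le1 : delta <= 1.
Proof.
have := delta_sum; have := delta_gt0; move: n1; move: (n.+1%:R : R) => N N1 d0 dN.
have : delta <= N * delta by rewrite ler_peMl// ltW.
by lra.
Qed.

Section SmallPoint.
Context (r : R) (v : nat -> R).
Context (r0 : 0 < r).
Context (vs : in_small delta n.*2.+1 1 v).

Lemma small_entry j : (0 < j <= n)%N -> 0 < sphere_sq n.+1 v j < delta.
Proof.
case: j => [//|j] /= jn; rewrite /sphere_sq /=.
have := vs (l := j.*2.+1); rewrite /small_range /= odd_double /= in_itv /=; apply.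
by rewrite ltnS ltn_double.
Qed.

Lemma small_sq0 : 1 / 4 <= sphere_sq n.+1 v 0.
Proof.
have := sphere_sq_sum n v; rewrite big_ord_recl /= => E.
have : \sum_(i < n) sphere_sq n.+1 v (lift ord0 i) <= \sum_(i < n) delta.
  apply: ler_sum => i _; rewrite ltW//.
  by have /andP[] := small_entry (j := lift ord0 i) (ltn_ord _).
rewrite sumr_const card_ord -mulr_natl => H.
have := delta_sum; rewrite -natr1 mulrDl mul1r; have := delta_gt0.
move: E H; rewrite /=; lra.
Qed.

Lemma small_pos j : (j <= n)%N -> 0 < sphere_sq n.+1 v j.
Proof.
case: j => [_|j jn]; first by have := small_sq0; lra.
by have /andP[] := small_entry (j := j.+1) jn.
Qed.

Definition centre : C := \sum_(j < n) sphere_pt n.+1 r v 0 (lift ord0 j).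
Definition radius : R := r * Num.sqrt (sphere_sq n.+1 v 0).

Lemma radius_ge : r / 2 <= radius.
Proof.
have s0 := small_sq0.
have s1 : 0 <= sphere_sq n.+1 v 0 by lra.
have -> : r / 2 = r * Num.sqrt (1 / 4).
  have -> : 1 / 4 = (2^-1 : R) ^+ 2 by field.
  by rewrite sqrtr_sqr ger0_norm.
by rewrite ler_pM2l// ler_sqrt.
Qed.

Lemma centre_le : cmod centre <= r / 8.
Proof.
apply: le_trans (cmod_sum _ _ _) _.
apply: (@le_trans _ _ (\sum_(j < n) (r * (8 * n.+1%:R)^-1))).
  apply: ler_sum => j _; rewrite sphere_pt_entry_le//; last exact: small_pos.
  rewrite ler_pM2l// -delta_sqrt; apply: ler_wsqrtr.
  by rewrite ltW//; have /andP[] := small_entry (j := lift ord0 j) (ltn_ord _).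
rewrite sumr_const card_ord -[X in X <= _]mulr_natl.
have nn : n%:R <= n.+1%:R :> R by rewrite ler_nat.
move: n1 nn; move: (n.+1%:R : R) (n%:R : R) => N M N1 MN.
have N0 : 0 < N by apply: lt_le_trans N1.
have -> : M * (r * (8 * N)^-1) = (r / 8) * (M / N) by field; rewrite gt_eqF.
have MN1 : M / N <= 1 by rewrite ler_pdivrMr// mul1r.
by rewrite ler_piMr// divr_ge0// ltW.
Qed.

Lemma small_range0 x : 0 <= x <= 2 * pi -> in_range n.*2.+1 0 (upd v 0 x).
Proof.
move=> xI; apply: in_range_upd; last by rewrite /coord_range /= in_itv.
by move=> l lN; apply: (small_range_sub delta_le1); exact: vs.
Qed.

(** When the argument of the entry of index 0 varies, which is the innermost
    integration, the sum of the entries runs over a circle. *)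
Lemma sum_sphere_pt x : \sum_j sphere_pt n.+1 r (upd v 0 x) 0 j = centre + radius%:C * ei x.
Proof.
rewrite big_ord_recl addrC; congr (_ + _).
  apply: eq_bigr => j _; rewrite !sphere_ptE sphere_sq_upd_even//.
by rewrite sphere_ptE sphere_sq_upd_even.
Qed.

End SmallPoint.

Lemma circ_EFin (k : R -> R) : continuous k ->
  (circ k)%:E = (\int[@lebesgue_measure R]_(x in `[0%R, (2 * pi)%R]%classic) (k x)%:E)%E.
Proof.
move=> ck; rewrite /circ /Rintegral fineK//.
exact: integrable_fin_num (circ_integrable ck).
Qed.

Context (uh : gradC1 setT u h).
Context (hh : holC1 setT h h').

(** On the box of small coordinates, the innermost integral is over a circle to which
    [off_centre_bound] applies. *)
Lemma characteristic_ge r z : 0 < r -> cmod z <= r / 32 ->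
  ((kappa (R := R) n / 4 * Num.max (2 * pi / 12 * (cmod (h z) * (r / 32) - 6 * `|u 0|)) 0 *
    delta ^+ n.*2)%:E <= nevanlinna_T r f)%E.
Proof.
move=> r0 zr; rewrite characteristicE; set q := Num.max _ 0.
have k0 := kappa_gt0 (R := R) n.
have q0 : 0 <= q by rewrite le_max lexx orbT.
apply: (@iter_integral_ge R n.*2.+1 _ delta).
- exact: delta_gt0.
- exact: delta_le1.
- by rewrite mulr_ge0// divr_ge0// ltW.
- by move=> v; exact: integrand_ge0.
- move=> v vs /=.
  pose k x := Num.max (u (centre r v + (radius r v)%:C * ei x)) 0.
  have cu w : u x @[x --> w] --> u w by exact: gradC1_cont openCT uh I.
  have ck : continuous k by apply: max0_cont; exact: ei_comp_contR cu.
  have ckk : continuous (fun x => kappa (R := R) n / 4 * k x).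
    by move=> x; apply: cvgM; [exact: cvg_cst|exact: ck].
  apply: (@le_trans _ _ (circ (fun x => kappa (R := R) n / 4 * k x))%:E).
    have k4 : 0 <= kappa (R := R) n / 4 by rewrite divr_ge0// ltW.
    rewrite lee_fin circZ// ler_wpM2l// ge_max; apply/andP; split; last first.
      by apply: Rintegral_ge0 => x _; rewrite le_max lexx orbT.
    have := off_centre_bound uh hh r0 (centre_le r0 vs) (radius_ge r0 vs) zr.
    rewrite -/k; move: (circ k) => c H.
    have p0 := @twopi_gt0 R.
    have : (cmod (h z) * (r / 32) - 6 * `|u 0|) <= 12 * (c / (2 * pi)) by lra.
    rewrite mulrA ler_pdivlMr// => H'.
    by lra.
  rewrite circ_EFin//.
  apply: le_integral_subset => [|x|x].
  - by rewrite /coord_range /=.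
  - rewrite /coord_range /= in_itv /= => xI.
    by apply: integrand_ge0 => //; exact: small_range0.
  - rewrite /= in_itv /= => xI; rewrite lee_fin mulr_ge0 ?le_max ?lexx ?orbT ?divr_ge0//=; last exact: ltW.
    have E0 : sphere_sq n.+1 (upd v 0 x) 0 = sphere_sq n.+1 v 0 by exact: sphere_sq_upd_even.
    have t0 : 0 < sphere_sq n.+1 (upd v 0 x) 0 by rewrite E0; exact: small_pos.
    rewrite integrandE// sum_sphere_pt lee_fin mulrC ler_wpM2l ?le_max ?lexx ?orbT//.
    apply: le_trans (density_ge r0 (range_sq_pos (small_range0 vs xI) t0)).
    by rewrite E0 ler_pM2l// -[leLHS]mul1r; exact: small_sq0.
- by move=> l; rewrite leqNgt; case/andP => /negP.
Qed.

End Characteristic.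

(** * The complex exponential and logarithmic derivatives *)

Section Exponential.
Context {R : realType}.
Local Notation C := R[i].
Local Notation Re := (@complex.Re R).
Local Notation Im := (@complex.Im R).

Lemma cexpE (z : C) : cexp z = (expR (Re z))%:C * ei (Im z).
Proof. by []. Qed.

Lemma cmod_cexp (z : C) : cmod (cexp z) = expR (Re z).
Proof. by rewrite cexpE cmodM cmod_ei mulr1 cmod_real gtr0_norm// expR_gt0. Qed.

Lemma cexp_neq0 (z : C) : cexp z != 0.
Proof. by rewrite -cmod_eq0 cmod_cexp gt_eqF// expR_gt0. Qed.

Lemma cexp0 : cexp (0 : C) = 1.
Proof. by rewrite cexpE /= expR0 mul1r /ei cos0 sin0. Qed.

Lemma cexpD (z w : C) : cexp (z + w) = cexp z * cexp w.
Proof.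
rewrite !cexpE cReD cImD expRD rmorphM /=.
have -> : ei (Im z + Im w) = ei (Im z) * ei (Im w).
  by rewrite /ei cosD sinD; apply/eqP; rewrite eq_complex /= [sin _ * cos _ + _]addrC !eqxx.
by rewrite mulrACA.
Qed.

Lemma holC1_cexp : holC1 setT (@cexp R) (@cexp R).
Proof.
move=> z _; split; last first.
  apply: cvg_mulc.
    apply: cvg_real; apply: (cvg_comp _ _ (cvg_Re (@cvg_id _ (nbhs z)))).
    exact: continuous_expR.
  exact: (cvg_comp _ _ (cvg_Im (@cvg_id _ (nbhs z))) (@ei_cont R _)).
move=> v.
have [dr di] := cderive_line z v 0.
have dr' : is_derive (0:R) 1 (fun t : R => Re (z + t%:C * v)) (Re v) by exact: dr.
have di' : is_derive (0:R) 1 (fun t : R => Im (z + t%:C * v)) (Im v) by exact: di.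
have d1 := cderive_real (is_derive1_comp (g := fun t : R => Re (z + t%:C * v)) (is_derive_expR _) dr').
have d2 := cderive_comp (g := fun t : R => Im (z + t%:C * v)) (cderive_ei _) di'.
have := cderiveM d1 d2; apply: cderive_ext => //.
rewrite /= !mul0r !addr0 cexpE rmorphM /=; move: (expR _)%:C (ei _) => e x.
rewrite [in RHS](complexE v); ring.
Qed.

End Exponential.

Section Bridge.
Context {R : realType} {m : nat}.
Local Notation C := R[i].
Local Notation V := 'rV[C]_m.
Local Notation Re := (@complex.Re R).
Local Notation Im := (@complex.Im R).

Lemma differentiable_line (f : V -> C) (z v : V) : differentiable f z ->
  cderive (fun t : R => f (z + t%:C *: v)) 0 ('D_v f z).
Proof.
move=> fz; have df : derivable f z v by exact: diff_derivable.
have H : (fun h : C => h^-1 *: (f (h *: v + z) - f z)) @ 0^' --> 'D_v f z by exact: df.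
apply/cderive_epsP => e e0.
have /cvg_cmodP/(_ e e0) [d /= /gt0_complexP[d' d'0 ->] Hd] := H.
exists d' => // t td; rewrite add0r scale0r addr0.
have [->|t0] := eqVneq t 0; first by rewrite scale0r addr0 subrr mulr0 subr0 cmod0 normr0 mulr0.
have t0' : t%:C != 0 :> C by rewrite -[0]/(0%:C) (inj_eq (@complexI R)).
have := Hd t%:C; rewrite /= sub0r normrN cmod_norm ltcR cmod_real => /(_ td t0').
rewrite -[_ *: (_ - _)]/(_ * _) => {}Hd.
have -> : f (z + t%:C *: v) - f z - 'D_v f z * t%:C =
    ((t%:C)^-1 * (f (t%:C *: v + z) - f z) - 'D_v f z) * t%:C.
  by rewrite [t%:C *: v + z]addrC; field.
by rewrite cmodM cmod_real ler_wpM2r// ltW.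
Qed.

Lemma derive_sum (f : V -> C) (z v : V) : differentiable f z ->
  'D_v f z = \sum_(j < m) v 0 j * 'D_(delta_mx 0 j) f z.
Proof.
move=> fz; rewrite deriveE// [in LHS](row_sum_delta v) linear_sum.
by apply: eq_bigr => j _; rewrite linearZ deriveE.
Qed.

End Bridge.

Section LogarithmicDerivative.
Context {R : realType}.
Local Notation C := R[i].
Local Notation Re := (@complex.Re R).
Local Notation Im := (@complex.Im R).

Lemma cderive_unique (g : R -> C) t l k : cderive g t l -> cderive g t k -> l = k.
Proof. by move=> gl gk; rewrite -(real_derivE gl) (real_derivE gk). Qed.

Lemma cderive_cmod_sq (g : R -> C) t (b : C) : cderive g t (b * g t) ->
  is_derive t 1 (fun t => cmod (g t) ^+ 2) (2 * Re b * cmod (g t) ^+ 2).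
Proof.
case=> dr di.
have := is_deriveD (is_deriveM dr dr) (is_deriveM di di).
apply: is_derive_ext => [s|]; first by rewrite cmod_sq !expr2.
by rewrite cmod_sq !ReImE /GRing.scale /=; ring.
Qed.

Context (g H : C -> C).
Context (gH : holC1 setT g (fun s => H s * g s)).
Context (cH : forall z, H w @[w --> z] --> H z).

(** Along a segment, [cmod (g _) ^+ 2] satisfies a linear differential equation with a
    bounded coefficient; multiplied by a decreasing exponential, it cannot grow. *)
Lemma ode_zero (s0 s : C) : g s0 = 0 -> g s = 0.
Proof.
move=> g0; set v := s - s0.
pose y (t : R) := g (s0 + t%:C * v).
pose b (t : R) := 2 * Re (H (s0 + t%:C * v) * v).
have cb : continuous b.
  move=> t; apply: cvgM; first exact: cvg_cst.
  apply: cvg_Re; apply: cvg_mulc; last exact: cvg_cst.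
  have l : s0 + x%:C * v @[x --> t] --> s0 + t%:C * v := cderive_cont (cderive_line s0 v t).
  exact: (cvg_comp _ _ l (@cH _)).
have [c _ Hc] : exists2 c, c \in `[(0:R), 1] & forall t, t \in `[(0:R), 1] -> b t <= b c.
  by apply: EVT_max => //; exact: continuous_subspaceT.
(* the weight [expR (- M * t)] makes the derivative nonpositive *)
pose M := b c.
have dy (t : R) : is_derive t 1 (fun t => cmod (y t) ^+ 2) (b t * cmod (y t) ^+ 2).
  have := holC1_lineD s0 v t gH; rewrite mulrAC => /cderive_cmod_sq.
  by apply: is_derive_ext.
have dE (t : R) : is_derive t 1 (fun t => expR (- M * t)) (expR (- M * t) * - M).
  have d := is_deriveM (is_derive_cst (- M) t 1) (is_derive_id t (1:R)).
  have := is_derive1_comp (g := fun t => - M * t) (is_derive_expR (- M * t)) d.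
  by apply: is_derive_ext => //; rewrite /GRing.scale /= mulr1 mulr0 addr0.
pose p t := cmod (y t) ^+ 2 * expR (- M * t).
have dp (t : R) : is_derive t 1 p ((b t - M) * p t).
  have := is_deriveM (dy t) (dE t); apply: is_derive_ext => //.
  by rewrite /p /GRing.scale /=; ring.
have [t t01 E] : exists2 t, t \in `[(0:R), 1] & p 1 - p 0 = (b t - M) * p t * (1 - 0).
  apply: (MVT_segment (f := p) (df := fun t => (b t - M) * p t)) => //.
  by apply: continuous_subspaceT => x; exact: is_derive_cont (dp x).
have p0 : p 0 = 0 by rewrite /p /y mul0r addr0 g0 cmod0 expr0n mul0r.
have pt x : 0 <= p x by rewrite mulr_ge0 ?sqr_ge0// ltW// expR_gt0.
have : p 1 <= 0.
  move: E; rewrite p0 !subr0 mulr1 => ->.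
  by rewrite mulr_le0_ge0// subr_le0; exact: Hc.
move=> p1; have : p 1 == 0 by rewrite eq_le p1 pt.
rewrite mulf_eq0 [X in _ || X]gt_eqF ?expR_gt0// orbF sqrf_eq0 cmod_eq0 => /eqP.
by rewrite /y mul1r /v addrC subrK.
Qed.

Context (g_neq0 : forall s, g s != 0).

Lemma ln_cmod_gradC1 : gradC1 setT (fun s => ln (cmod (g s))) H.
Proof.
move=> z _; split; last exact: cH.
move=> v.
have q0 t : 0 < cmod (g (z + t%:C * v)) ^+ 2 by rewrite exprn_gt0// cmod_gt0.
have d1 : is_derive (0:R) 1 (fun t : R => cmod (g (z + t%:C * v)) ^+ 2)
    (2 * Re (H (z + (0:R)%:C * v) * v) * cmod (g (z + (0:R)%:C * v)) ^+ 2).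
  by apply: cderive_cmod_sq; have := holC1_lineD z v 0 gH; rewrite mulrAC.
have d2 := is_derive1_comp (g := fun t : R => cmod (g (z + t%:C * v)) ^+ 2) (is_derive1_ln (q0 0)) d1.
have := is_deriveM (is_derive_cst (2^-1 : R) (0:R) 1) d2.
apply: is_derive_ext => [t|].
  rewrite -[LHS]/(2^-1 * ln (cmod (g (z + t%:C * v)) ^+ 2)) lnXn ?cmod_gt0//.
  by rewrite -(mulr_natr (ln _) 2) mulrC mulfK.
rewrite /GRing.scale /= mul0r addr0.
have : cmod (g z) ^+ 2 != 0 by rewrite expf_neq0// cmod_eq0.
by move: (cmod (g z) ^+ 2) => q qn; field.
Qed.

(** The quotient of [g'] by [g], where [g'] is differentiable by [holC1_deriv]. *)
Lemma log_derivative_holC1 : exists H', holC1 setT H H'.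
Proof.
have g' := holC1_deriv gH.
have gV := holC1V openCT gH (fun s _ => g_neq0 s).
exists (fun z => deriv2 (fun s => H s * g s) z * (g z)^-1 + H z * g z * (- (H z * g z) / g z ^+ 2)).
apply: holC1_ext (holC1M openCT g' gV) _ _ => // z.
by rewrite mulfK.
Qed.

End LogarithmicDerivative.

Section ODE.
Context {R : realType}.
Local Notation C := R[i].
Local Notation Re := (@complex.Re R).

(** The derivative of [a] is the logarithmic derivative of [cexp a], hence
    continuous.  The definition of complex differentiability does not give this
    continuity. *)
Lemma holC1_exp_lift (a a' H' : C -> C) :
  (forall z v, cderive (fun t : R => a (z + t%:C * v)) 0 (a' z * v)) ->
  (forall z, a w @[w --> z] --> a z) ->
  holC1 setT (fun z => cexp (a z)) H' -> holC1 setT a a'.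
Proof.
move=> da ca aH.
have E z : a' z = H' z * (cexp (a z))^-1.
  have d1 := holC1_chain openCT (@holC1_cexp R) I (da z 1).
  rewrite mul0r addr0 !mulr1 in d1.
  have [/(_ 1) d2 _] := aH z I; rewrite mulr1 in d2.
  by rewrite -(cderive_unique d1 d2) mulrC mulKf// cexp_neq0.
move=> z _; split; first exact: da.
rewrite (funext E); apply: cvg_mulc; first exact: (aH z I).2.
apply: cvg_invc; first exact: cexp_neq0.
exact: holC1_contT aH z.
Qed.

Lemma ode_solution (g : C -> C) (k : C) : holC1 setT g (fun s => k * g s) ->
  forall s, g s = g 0 * cexp (k * s).
Proof.
move=> gk s.
have d (t : R) : cderive (fun t : R => g (0 + t%:C * s) * cexp (- k * (0 + t%:C * s))) t 0.
  have d1 := holC1_lineD 0 s t gk.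
  have d2 := holC1_chain openCT (@holC1_cexp R) I (cderiveZ (- k) (cderive_line 0 s t)).
  by apply: cderive_ext (cderiveM d1 d2) => //; ring.
have := cderive_is_cst d 1 0; rewrite !mul0r !addr0 mulr0 cexp0 mulr1 add0r mul1r => <-.
by rewrite -mulrA -cexpD mulNr addNr cexp0 mulr1.
Qed.

End ODE.

(** * Bounds on the hyper-order *)

Section HyperOrder.
Context {R : realType} {m : nat}.
Implicit Types (f : 'rV[R[i]]_m -> R[i]).

(** If the bound failed at [r], the characteristic function and its logarithm would
    be large there, and the iterated logarithm would be that of a real number, too
    large for the limit superior. *)
Lemma hyper_order_lt f (s : R) : (hyper_order f < s%:E)%E ->
  exists2 r0 : R, 1 < r0 & forall r, r0 < r ->
    (nevanlinna_T r f <= (expR (expR (s * ln r)))%:E)%E.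
Proof.
rewrite /hyper_order limf_esupE => /ereal_inf_lt[_ [V /= [M [_ HM]] <-] Vs].
exists (Num.max 2 M); first by rewrite lt_max ltr1n.
move=> r; rewrite gt_max => /andP[r2 rM].
have r1 : 1 < r by apply: lt_trans r2; rewrite ltr1n.
have lr : 0 < ln r by rewrite ln_gt0.
have : (lne (lne (nevanlinna_T r f)) * ((ln r)^-1)%:E < s%:E)%E.
  apply: le_lt_trans Vs; apply: ereal_sup_ubound; exists r => //.
  exact: HM.
move=> H; rewrite leNgt; apply/negP => TE; move: H; apply/negP; rewrite -leNgt.
case: (nevanlinna_T r f) TE => [x| |]; last by rewrite ltNge leNye.
  rewrite lte_fin => Ex.
  have x0 : 0 < x by apply: lt_trans Ex; exact: expR_gt0.
  have l1 : expR (s * ln r) < ln x by rewrite -ltr_expR lnK.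
  have l0 : 0 < ln x by apply: lt_trans l1; exact: expR_gt0.
  have l2 : s * ln r < ln (ln x) by rewrite -ltr_expR (lnK (x := ln x)).
  rewrite !lne_EFin// -EFinM lee_fin ler_pdivlMr//.
  exact: ltW.
by move=> _; rewrite /= gt0_mulye ?lte_fin ?invr_gt0// leey.
Qed.

Lemma hyper_order_le f (s r0 : R) :
  (forall r, r0 < r -> (nevanlinna_T r f <= (expR (expR (s * ln r)))%:E)%E) ->
  (hyper_order f <= s%:E)%E.
Proof.
move=> H; rewrite /hyper_order limf_esupE.
set V := [set r : R | Num.max 1 r0 < r].
apply: (@le_trans _ _ (ereal_sup ((fun r : R => (lne (lne (nevanlinna_T r f)) * ((ln r)^-1)%:E)%E) @` V))).
  by apply: ereal_inf_lbound; exists V => //; exists (Num.max 1 r0); split => //; exact: num_real.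
apply: ge_ereal_sup => _ [r /= rV <-]; move: rV; rewrite /V /= gt_max => /andP[r1 rr0].
have lr : 0 < ln r by rewrite ln_gt0.
have Ny : (-oo * ((ln r)^-1)%:E = -oo :> \bar R)%E by rewrite gt0_mulNye// lte_fin invr_gt0.
have := H r rr0; case: (nevanlinna_T r f) => [x| |].
- rewrite lee_fin => xE.
  have [x0|x0] := leP x 0; first by rewrite (le0_lneNy (x := x%:E)) ?lee_fin// le0_lneNy// Ny leNye.
  rewrite (lne_EFin x0); have [l0|l0] := leP (ln x) 0.
    by rewrite le0_lneNy ?lee_fin// Ny leNye.
  rewrite (lne_EFin l0) -EFinM lee_fin ler_pdivrMr// -ler_expR lnK//.
  by rewrite -ler_expR lnK.
- by rewrite leNgt ltey.
- by move=> _; rewrite !(@le0_lneNy R -oo%E) ?leNye// Ny leNye.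
Qed.

End HyperOrder.

Section Estimates.
Context {R : realType}.

Lemma exp_ln_pow (d : nat) (x : R) : 0 < x -> expR (d%:R * ln x) = x ^+ d.
Proof. by move=> x0; rewrite mulr_natl -lnXn// lnK// posrE exprn_gt0. Qed.

(** [expR (s * ln x)] is [x] to the real power [s]. *)
Lemma power_little_o (d : nat) (s e : R) : 0 < s -> s < d%:R -> 0 < e ->
  exists2 B, 0 <= B & forall x, 1 <= x -> expR (s * ln x) <= e * x ^+ d + B.
Proof.
move=> s0 sd e0; pose t := d%:R - s; have t0 : 0 < t by rewrite subr_gt0.
(* beyond this value of [ln x] the power [s] is below [e] times the power [d] *)
pose y := - ln e / t.
exists (expR (s * y)); first by rewrite ltW// expR_gt0.
move=> x x1; have x0 : 0 < x by apply: lt_le_trans x1.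
have ex0 : 0 <= e * x ^+ d by rewrite mulr_ge0 ?exprn_ge0// ltW.
have [xy|xy] := leP (ln x) y.
  apply: le_trans (_ : expR (s * y) <= _); first by rewrite ler_expR ler_pM2l.
  by rewrite lerDr.
apply: (@le_trans _ _ (e * x ^+ d)); last by rewrite lerDl ltW// expR_gt0.
have -> : e * x ^+ d = expR (ln e + d%:R * ln x) by rewrite expRD lnK// exp_ln_pow.
rewrite ler_expR.
have : - ln e < ln x * t by rewrite -ltr_pdivrMr.
by rewrite /t; lra.
Qed.

End Estimates.

(** * Reduction to one variable and conclusion *)

Lemma cderive_at0 (R : realType) (g : R -> R[i]) (t : R) (l : R[i]) :
  cderive (fun s => g (t + s)) 0 l -> cderive g t l.
Proof. by case=> a b; split; exact: is_derive_at0. Qed.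

Section Reduction.
Context {R : realType} {n : nat}.
Local Notation C := R[i].
Local Notation V := 'rV[C]_n.+1.
Local Notation Re := (@complex.Re R).
Context (f alpha : V -> C).
Context (f_entire : entire f).
Context (alpha_entire : entire alpha).
Context (f_eq : forall (i : 'I_n.+1) (z : V), partial i f z = cexp (alpha z) * f z).
Context (f_nonconst : ~ exists c : C, forall z, f z = c).

(** The equations make [f] a function of this sum. *)
Definition coord_sum (z : V) : C := \sum_j z 0 j.
Definition axis (s : C) : V := s *: delta_mx 0 ord0.

Lemma coord_sum_axis s : coord_sum (axis s) = s.
Proof.
rewrite /coord_sum (bigD1 ord0)//= !mxE !eqxx mulr1 big1 ?addr0// => j j0.
by rewrite !mxE (negbTE j0) andbF mulr0.
Qed.

Lemma coord_sumB z w : coord_sum (z - w) = coord_sum z - coord_sum w.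
Proof. by rewrite /coord_sum -sumrB; apply: eq_bigr => j _; rewrite !mxE. Qed.

Lemma axis_line z (t : R) v : axis (z + t%:C * v) = axis z + t%:C *: axis v.
Proof. by rewrite /axis scalerDl scalerA. Qed.

(** All the partial derivatives are equal, so that the derivative along [v] vanishes when
    the entries of [v] have sum zero. *)
Lemma derive_all z v : 'D_v f z = coord_sum v * (cexp (alpha z) * f z).
Proof.
rewrite derive_sum// mulr_suml; apply: eq_bigr => j _.
by rewrite -(f_eq j).
Qed.

Lemma axis_cont (F : V -> C) : entire F -> forall z, F (axis w) @[w --> z] --> F (axis z).
Proof.
move=> eF z.
have cF : {for axis z, continuous F} by exact: differentiable_continuous.
have ca : axis w @[w --> z] --> axis z by exact: scalel_continuous.
exact: (cvg_comp _ _ ca cF).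
Qed.

Lemma entire_line (F : V -> C) (z v : V) (t : R) : entire F ->
  cderive (fun t : R => F (z + t%:C *: v)) t ('D_v F (z + t%:C *: v)).
Proof.
move=> eF; have E s : F (z + t%:C *: v + s%:C *: v) = F (z + (t + s)%:C *: v).
  by rewrite -addrA -scalerDl -rmorphD.
have D := differentiable_line v (eF (z + t%:C *: v)).
rewrite (funext E) in D.
exact: (cderive_at0 (g := fun t : R => F (z + t%:C *: v)) D).
Qed.

Lemma f_factor z : f z = f (axis (coord_sum z)).
Proof.
set w := axis _; pose v := z - w.
have v0 : coord_sum v = 0 by rewrite coord_sumB coord_sum_axis subrr.
have d (t : R) : cderive (fun t : R => f (w + t%:C *: v)) t 0.
  by have := entire_line w v t f_entire; rewrite derive_all v0 mul0r.
have := cderive_is_cst d 1 0; rewrite scale0r addr0 scale1r.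
by rewrite addrC subrK.
Qed.

(** The function of one variable such that [f z = profile (coord_sum z)]. *)
Definition profile (s : C) : C := f (axis s).
Definition exponent (s : C) : C := alpha (axis s).

Lemma exponent_cont : forall z, exponent w @[w --> z] --> exponent z.
Proof. exact: axis_cont. Qed.

Lemma cexp_exponent_cont : forall z, cexp (exponent w) @[w --> z] --> cexp (exponent z).
Proof.
by move=> z; exact: (cvg_comp exponent (@cexp R) (@exponent_cont z) (holC1_contT (@holC1_cexp R) (z := exponent z))).
Qed.

Lemma profile_holC1 : holC1 setT profile (fun s => cexp (exponent s) * profile s).
Proof.
move=> z _; split.
  move=> v; have := differentiable_line (axis v) (f_entire (axis z)).
  apply: cderive_ext => [t|]; first by rewrite /profile axis_line.
  by rewrite derive_all coord_sum_axis mulrC.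
by apply: cvg_mulc; [exact: cexp_exponent_cont|exact: axis_cont].
Qed.

Lemma profile_neq0 s : profile s != 0.
Proof.
apply/eqP => g0; apply: f_nonconst; exists 0 => z.
by rewrite f_factor; exact: (ode_zero profile_holC1 cexp_exponent_cont _ g0).
Qed.

Lemma exponent_holC1 : exists a', holC1 setT exponent a'.
Proof.
have [H' HH] := log_derivative_holC1 profile_holC1 profile_neq0.
exists (fun s => partial ord0 alpha (axis s)); apply: holC1_exp_lift HH; last exact: exponent_cont.
move=> z v; have := differentiable_line (axis v) (alpha_entire (axis z)).
apply: cderive_ext => [t|]; first by rewrite /exponent axis_line.
have da : differentiable alpha (axis z) by exact: alpha_entire.
by rewrite /partial !deriveE// [X in 'd _ _ X]/axis linearZ mulrC.
Qed.

Definition potential (s : C) : R := ln (cmod (profile s)).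

Lemma potential_gradC1 : gradC1 setT potential (fun s => cexp (exponent s)).
Proof. exact: ln_cmod_gradC1 profile_holC1 cexp_exponent_cont profile_neq0. Qed.

Lemma log_plus_f z : log_plus (cmod (f z)) = Num.max (potential (\sum_j z 0 j)) 0.
Proof. by rewrite f_factor. Qed.

(** The modulus of [cexp (exponent z)], the logarithmic derivative of [profile], is
    at most of the order of the characteristic function at a radius comparable
    with [cmod z]; taking logarithms bounds the real part of [exponent]. *)
Lemma Re_exponent_growth (d : nat) (s : R) : 0 < s -> s < d.+1%:R ->
  (hyper_order f < s%:E)%E -> little_o_pow d.+1 (fun z => Re (exponent z)).
Proof.
move=> s0 sd /hyper_order_lt[r0 r01 HT] e e0.
have [H' HH] := log_derivative_holC1 profile_holC1 profile_neq0.
pose k : R := kappa (R := R) n / 4 * delta n ^+ n.*2.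
have k0 : 0 < k.
  by rewrite mulr_gt0 ?exprn_gt0 ?delta_gt0// divr_gt0// kappa_gt0.
pose L : R := 32 + r0; have L0 : 0 < L by rewrite /L; lra.
have [B B0 HB] := power_little_o s0 sd (divr_gt0 e0 (exprn_gt0 d.+1 L0)).
have p0 := @pi_gt0 R.
(* [K] makes [characteristic_ge] read [expR (Re (exponent z)) <= E * K], as [1 <= E] *)
pose K := 6 * `|potential 0| + 6 / (pi * k).
have K0 : 0 < K by rewrite ltr_wpDl ?mulr_ge0// divr_gt0// mulr_gt0.
exists (B + ln K) => z.
pose y := 1 + cmod z; have y1 : 1 <= y by rewrite /y lerDl cmod_ge0.
(* a radius beyond the threshold [r0] for which [cmod z <= r / 32] *)
pose r := 32 * y + r0.
have r_gt : r0 < r by rewrite /r; lra.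
have rpos : 0 < r by apply: lt_trans r_gt; apply: lt_trans r01.
have zr : cmod z <= r / 32 by move: r01; rewrite /r /y; lra.
have rL : r <= L * y by rewrite /r /L; nra.
have r1 : 1 <= r by lra.
pose E := expR (expR (s * ln r)).
have E1 : 1 <= E by rewrite -expR0 ler_expR ltW// expR_gt0.
have := le_trans (characteristic_ge log_plus_f potential_gradC1 HH rpos zr) (HT r r_gt).
rewrite lee_fin cmod_cexp -/E; set q := 2 * pi / 12 * _ => Hq.
have {}Hq : k * q <= E.
  apply: le_trans Hq; rewrite /k mulrAC; apply: ler_wpM2r.
    by rewrite exprn_ge0// ltW// delta_gt0.
  by rewrite ler_wpM2l ?le_max ?lexx// divr_ge0// ltW// kappa_gt0.
have H1 : expR (Re (exponent z)) <= E * K.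
  have h0 : 0 <= expR (Re (exponent z)) by rewrite ltW// expR_gt0.
  have rr : 1 <= r / 32 by move: r01; rewrite /r; lra.
  have H2 : expR (Re (exponent z)) <= expR (Re (exponent z)) * (r / 32) by rewrite ler_peMr.
  have H3 : q <= E / k by rewrite ler_pdivlMr// mulrC.
  have H4 : expR (Re (exponent z)) * (r / 32) - 6 * `|potential 0| <= E * (6 / (pi * k)).
    have -> : E * (6 / (pi * k)) = 6 / pi * (E / k).
      move: (pi : R) p0 => p p0.
      by field; rewrite !gt_eqF.
    have -> : expR (Re (exponent z)) * (r / 32) - 6 * `|potential 0| = 6 / pi * q.
      rewrite /q; move: (pi : R) p0 => p p0.
      by field; rewrite gt_eqF.
    by rewrite ler_pM2l// divr_gt0.
  have H5 : 6 * `|potential 0| <= E * (6 * `|potential 0|) by rewrite ler_peMl// mulr_ge0.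
  by rewrite /K mulrDr; lra.
have H6 : Re (exponent z) <= expR (s * ln r) + ln K.
  by rewrite -ler_expR expRD lnK.
apply: le_trans H6 _; rewrite addrA lerD2r.
apply: le_trans (HB r r1) _; rewrite lerD2r -/y.
have Ld : 0 < L ^+ d.+1 by rewrite exprn_gt0.
rewrite -mulrA ler_pM2l// ler_pdivrMl// -exprMn.
by rewrite lerXn2r// nnegrE ?mulr_ge0// ltW// ?(lt_le_trans _ y1)// mulr_gt0// (lt_le_trans _ y1).
Qed.

(** The gradient of the potential has modulus [cmod (cexp (exponent w))]. *)
Lemma potential_le (B : R) (M : R) z : 0 <= M -> cmod z <= B ->
  (forall w, cmod w <= B -> cmod (cexp (exponent w)) <= M) ->
  potential z <= `|potential 0| + B * M.
Proof.
move=> M0 zB HM.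
have d (t : R) := gradC1_line (z := 0) (w := z) (t := t) potential_gradC1 I.
have [t t01 E] : exists2 c, c \in `[(0:R), 1] &
    potential (0 + 1%:C * z) - potential (0 + 0%:C * z) = Re (cexp (exponent (0 + c%:C * z)) * z) * (1 - 0).
  apply: (MVT_segment (f := fun t : R => potential (0 + t%:C * z)) (df := fun c : R => Re (cexp (exponent (0 + c%:C * z)) * z))) => //.
  by apply: continuous_subspaceT => x; exact: is_derive_cont (d x).
move: E; rewrite !add0r mul1r mul0r subr0 mulr1 => E.
have -> : potential z = potential 0 + Re (cexp (exponent (t%:C * z)) * z) by rewrite -E addrC subrK.
apply: lerD; first exact: ler_norm.
apply: le_trans (Re_le _) _; rewrite cmodM mulrC; apply: ler_pM => //; rewrite ?cmod_ge0//.
apply: HM; move: t01; rewrite in_itv /= => /andP[t0 t1].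
rewrite cmodM cmod_real ger0_norm//; apply: le_trans zB.
by rewrite ler_piMl// cmod_ge0.
Qed.

(** If [exponent] has polynomial growth of degree [d.+1], the logarithm of the modulus of
    [f] is at most [expR (c * r ^+ d.+1)] on the sphere of radius [r]. *)
Lemma hyper_order_upper (d : nat) (K : R) : 0 <= K ->
  (forall z, cmod (exponent z) <= K * (1 + cmod z) ^+ d.+1) ->
  forall e, 0 < e -> (hyper_order f <= (d.+1%:R + e)%:E)%E.
Proof.
move=> K0 HK e e0.
pose N : R := n.+1%:R; have N1 : 1 <= N by rewrite ler1n.
pose K1 : R := kappa (R := R) n * #|{: 'S_(n.*2.+1)}|%:R.
pose K2 : R := K1 * (2 * pi) ^+ n.*2.+1.
have K20 : 0 <= K2.
  apply: mulr_ge0; last by rewrite exprn_ge0// ltW// twopi_gt0.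
  by rewrite mulr_ge0// ltW// kappa_gt0.
pose A := (`|potential 0| + N) * K2.
have A0 : 0 <= A by rewrite mulr_ge0// addr_ge0//; lra.
pose Q := K * (1 + N) ^+ d.+1.
have Q0 : 0 <= Q by rewrite mulr_ge0// exprn_ge0//; lra.
(* [A], [r] and [M] are at most the exponentials of [A * r ^+ d.+1],
     [r ^+ d.+1] and [Q * r ^+ d.+1] *)
pose c := A + 1 + Q.
have c0 : 0 < c by rewrite /c; lra.
apply: (@hyper_order_le _ _ _ _ (Num.max 1 (expR (ln c / e)))) => r.
rewrite gt_max => /andP[r1 rc]; have r0 : 0 < r by apply: lt_trans r1.
pose M := expR (K * (1 + N * r) ^+ d.+1).
have M1 : 1 <= M.
  by rewrite -expR0 ler_expR mulr_ge0// exprn_ge0// addr_ge0// mulr_ge0//; lra.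
have B0 : 0 <= `|potential 0| + N * r * M by rewrite addr_ge0// !mulr_ge0//; lra.
apply: le_trans (characteristic_le log_plus_f r0 B0 _) _.
  move=> z zr; apply: potential_le => //; first by lra.
  move=> w wr; rewrite cmod_cexp ler_expR; apply: le_trans (Re_le _) _.
  apply: le_trans (HK w) _; rewrite ler_wpM2l// lerXn2r ?nnegrE ?addr_ge0 ?cmod_ge0//.
    by rewrite mulr_ge0//; lra.
  by rewrite lerD2l.
rewrite lee_fin -mulrA -/K1 -/K2.
have rM : 1 <= r * M by rewrite -[1]mulr1 ler_pM//; lra.
apply: (@le_trans _ _ (A * (r * M))).
  have -> : A * (r * M) = (`|potential 0| * (r * M) + N * r * M) * K2 by rewrite /A; ring.
  by rewrite ler_wpM2r// lerD2r ler_peMr.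
have rd : 1 <= r ^+ d.+1 by rewrite exprn_ege1// ltW.
have rrd : r <= r ^+ d.+1 by rewrite exprS ler_peMr ?exprn_ege1// ltW.
have xe (x : R) : x <= expR x by apply: le_trans (expR_ge1Dx x); lra.
apply: (@le_trans _ _ (expR (c * r ^+ d.+1))).
  have -> : c * r ^+ d.+1 = A * r ^+ d.+1 + (r ^+ d.+1 + Q * r ^+ d.+1) by rewrite /c; ring.
  rewrite !expRD; apply: ler_pM => //.
  - by rewrite mulr_ge0//; lra.
  - by apply: le_trans (xe A) _; rewrite ler_expR ler_peMr.
  apply: ler_pM; [by lra|by lra| |].
    by apply: le_trans (xe r) _; rewrite ler_expR.
  rewrite /M ler_expR /Q -mulrA ler_wpM2l// -exprMn lerXn2r ?nnegrE//.
  - by rewrite addr_ge0// mulr_ge0//; lra.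
  - by rewrite mulr_ge0//; lra.
  - by rewrite mulrDl mul1r lerD2r ltW.
rewrite ler_expR [(_ + e) * _]mulrDl expRD exp_ln_pow// [_ * expR _]mulrC ler_wpM2r//; first by lra.
rewrite -[leLHS](lnK (x := c))// ler_expR mulrC -ler_pdivrMr//.
by rewrite -ler_expR lnK// ltW.
Qed.

(** Let [d] be the integral part of the hyper-order, or 0 if the latter is negative.
    Growth with a real exponent below [d.+1] makes [exponent] a polynomial of degree
    at most [d].  If [d] were positive, the hyper-order would be at most [d], hence equal
    to [d], which is excluded. *)
Lemma exponent_const :
  (forall k : nat, (1 <= k)%N -> hyper_order f <> (k%:R)%:E) ->
  hyper_order f <> +oo%E -> forall s, exponent s = exponent 0.
Proof.
move=> Hnat Hfin.
have [a' Ha] := exponent_holC1.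
have fin K : (forall z, cmod (exponent z) <= K * (1 + cmod z) ^+ 0) ->
    forall s, exponent s = exponent 0.
  move=> HK; apply: (liouville Ha) => e e0; exists K => z.
  apply: le_trans (HK z) _; rewrite expr0 mulr1 lerDr mulr_ge0 ?ltW// expr1.
  by rewrite ltr_wpDr// cmod_ge0.
have [l El] : exists l : R, (hyper_order f <= l%:E)%E /\ (0 < l -> hyper_order f = l%:E).
  case E : (hyper_order f) => [l| |].
  - by exists l.
  - by case: Hfin.
  - by exists 0; split => //; [rewrite leNye|rewrite ltxx].
case: El => El El'.
pose d := Num.truncn (Num.max l 0).
have l0 : 0 <= Num.max l 0 by rewrite le_max lexx orbT.
have /andP[dl ld] := truncn_itv l0; rewrite -/d in dl ld.
(* a positive exponent strictly between the hyper-order and [d.+1] *)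
pose s := (Num.max l 0 + d.+1%:R) / 2.
have s0 : 0 < s by rewrite /s; have : 0 < d.+1%:R :> R by []; lra.
have sd : s < d.+1%:R by rewrite /s; lra.
have ls : l < s.
  have : l <= Num.max l 0 by rewrite le_max lexx.
  by rewrite /s; lra.
have Hs : (hyper_order f < s%:E)%E by apply: le_lt_trans El _; rewrite lte_fin.
have Ho := little_o_of_Re Ha (Re_exponent_growth s0 sd Hs).
have [K K0 HK] := growth_drop Ha Ho.
case: d dl {ld s s0 sd ls Hs Ho} HK => [|d] dl HK; first exact: (fin K).
exfalso.
have lpos : 0 < l.
  rewrite ltNge; apply/negP => l0'; move: dl; rewrite (max_idPr l0').
  by rewrite lern0.
rewrite (max_idPl (ltW lpos)) in dl.
have El2 := El' lpos.
have dl' : d.+1%:R < l.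
  rewrite lt_neqAle dl andbT; apply/eqP => E.
  by apply: (Hnat d.+1) => //; rewrite El2 E.
have e0 : 0 < (l - d.+1%:R) / 2 by rewrite divr_gt0// subr_gt0.
have := hyper_order_upper K0 HK e0; rewrite El2 lee_fin.
by lra.
Qed.

End Reduction.

Theorem theorem1p1 (R : realType) (m : nat) (hm : (1 <= m)%N)
    (f : 'rV[R[i]]_m -> R[i]) (f_entire : entire f)
    (f_nonconst : ~ exists c : R[i], forall z, f z = c)
    (f_order_nat : forall k : nat, (1 <= k)%N -> hyper_order f <> (k%:R)%:E)
    (f_order_fin : hyper_order f <> +oo%E)
    (alpha : 'rV[R[i]]_m -> R[i]) (alpha_entire : entire alpha)
    (f_eq : forall (i : 'I_m) (z : 'rV[R[i]]_m),
        partial i f z = cexp (alpha z) * f z) :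
  exists c c1 : R[i],
    [/\ forall z, alpha z = c,
        cexp c != 0,
        c1 != 0 &
        forall z, f z = c1 * cexp (cexp c * \sum_(j < m) z 0 j)].
Proof.
case: m hm f f_entire f_nonconst f_order_nat f_order_fin alpha alpha_entire f_eq => [//|n] _
  f f_entire f_nonconst f_order_nat f_order_fin alpha alpha_entire f_eq.
have ec := exponent_const f_entire alpha_entire f_eq f_nonconst f_order_nat f_order_fin.
have pn := profile_neq0 f_entire alpha_entire f_eq f_nonconst.
have fac := f_factor f_entire f_eq.
have ph := profile_holC1 f_entire alpha_entire f_eq.
set c := exponent alpha 0 in ec.
have ph' : holC1 setT (profile f) (fun s => cexp c * profile f s).
  by apply: holC1_ext ph _ _ => // s; rewrite ec.
exists c, (profile f 0); split => //.
- have E z : cexp (alpha z) = cexp c.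
    have d1 := entire_line z (axis 1) 0 f_entire.
    rewrite (derive_all f_entire f_eq) coord_sum_axis mul1r scale0r addr0 in d1.
    have d2 := holC1_lineD (coord_sum z) 1 0 ph'.
    rewrite mulr1 mul0r addr0 in d2.
    have d2' : cderive (fun t : R => f (z + t%:C *: axis 1)) 0 (cexp c * profile f (coord_sum z)).
      apply: cderive_ext d2 => // t; rewrite fac /profile; congr (f (axis _)).
      have -> : z + t%:C *: axis 1 = z - axis (- t%:C).
        by rewrite /axis scaleNr opprK scale1r.
      by rewrite coord_sumB coord_sum_axis opprK mulr1.
    have := cderive_unique d1 d2'; rewrite fac -/(profile f _).
    by apply: mulIf; exact: pn.
  move=> z.
  have d (t : R) : cderive (fun t : R => alpha (0 + t%:C *: z)) t 0.
    have da := entire_line 0 z t alpha_entire.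
    have de := holC1_chain openCT (@holC1_cexp R) I da.
    have d0 : cderive (fun t : R => cexp (alpha (0 + t%:C *: z))) t 0.
      by apply: cderive_ext (cderive_cst (cexp c) t) => // s; rewrite E.
    have := cderive_unique de d0; move/eqP; rewrite mulf_eq0 (negbTE (cexp_neq0 _)) /= => /eqP D0.
    by rewrite D0 in da.
  have := cderive_is_cst d 1 0; rewrite !add0r scale1r scale0r => ->.
  by rewrite /c /exponent /axis scale0r.
- exact: cexp_neq0.
- by move=> z; rewrite fac -/(profile f _) (ode_solution ph').
Qed.
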